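(* Let $\mu\in(0,1]$ be fixed. There exists a threshold $T_*>0$ (depending on $\mu$, the fractional order $\alpha$ and the Lipschitz constant $L$ of $f$) such that for any $T\in(0,T_* )$ there is a constant $c>0$ for which the following stability estimate holds for all $\phi_1,\phi_2\in \dot H^{-\mu}(\Omega)$: $$\|\phi_1-\phi_2\|_{\dot H^{-\mu}(\Omega)}\le c\,\|S(T)\phi_1-S(T)\phi_2\|_{\dot H^{2-\mu}(\Omega)},$$ where $S(T)$ is the nonlinear solution operator (at time $T$) of the semilinear subdiffusion problem.
   Context: Let $\Omega\subset\mathbb R^d$ ($d\ge1$) be a bounded convex polygonal domain, and let $\alpha\in(0,1)$ be fixed. Let $A=-\Delta$ with homogeneous Dirichlet boundary condition on $\Omega$, with eigenpairs $\{(\lambda_j,\varphi_j)\}_{j\ge1}$, where $\{\varphi_j\}$ is an orthonormal basis of $L^2(\Omega)$. For $q\ge-1$, $\dot H^q(\Omega)$ is the Hilbert space with norm $\|v\|_{\dot H^q(\Omega)}^2=\|A^{q/2}v\|_{L^2(\Omega)}^2=\sum_{j}\lambda_j^q(v,\varphi_j)^2$ (for negative $q$, $(v,\varphi_j)$ is the duality pairing; $\dot H^{-q}(\Omega)$ is the dual of $\dot H^q(\Omega)$ for $q\in[0,1]$). The function $f:\mathbb R\to\mathbb R$ satisfies $|f(u)-f(v)|\le L|u-v|$ for all $u,v\in\mathbb R$, with $L>0$, and $f(0)=0$. Define $F(t)v=\sum_j E_{\alpha,1}(-\lambda_jt^\alpha)(v,\varphi_j)\varphi_j$ and $E(t)v=\sum_j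 t^{\alpha-1}E_{\alpha,\alpha}(-\lambda_jt^\alpha)(v,\varphi_j)\varphi_j$, with $E_{\alpha,\beta}(z)$ the two-parameter Mittag--Leffler function. For $\phi\in\dot H^{-\mu}(\Omega)$, $S(t)\phi:=u(t)$ where $u\in C([0,T];\dot H^{-\mu}(\Omega))\cap C((0,T];\dot H^{2-\mu}(\Omega))$ is the unique mild solution of $\partial_t^\alpha u-\Delta u=f(u)$ in $\Omega\times(0,T]$, $u=0$ on $\partial\Omega\times(0,T]$, $u(0)=\phi$, i.e. $u(t)=F(t)\phi+\int_0^tE(t-s)f(u(s))\,ds$. Here $\partial_t^\alpha u(t)=\frac1{\Gamma(1-\alpha)}\int_0^t(t-s)^{-\alpha}u'(s)\,ds$ is the Djrbashian--Caputo derivative. *)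

(* Defs.v *)
From HB Require Import structures.
From mathcomp Require Import all_boot all_order all_algebra.
From mathcomp Require Import all_classical all_reals all_analysis.

Set Implicit Arguments.
Unset Strict Implicit.
Unset Printing Implicit Defensive.

Import Order.TTheory GRing.Theory Num.Theory.
Import numFieldNormedType.Exports.
Local Open Scope classical_set_scope.
Local Open Scope ring_scope.

(* The library has no Lebesgue measure on R^d. It is built on d-tuples by
   iterating the binary product measure, then transported to row vectors, which
   carry the coordinate (i.e. Borel) sigma-algebra. *)
Section lebesgue_tuple.
Variable R : realType.
Local Notation RR := (measurableTypeR R).
Local Open Scope ereal_scope.

Definition tcons n (p : RR * n.-tuple RR) : n.+1.-tuple RR :=
  [the n.+1.-tuple RR of p.1 :: p.2].

Lemma measurable_tcons n : measurable_fun [set: RR * n.-tuple RR] (@tcons n).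
Proof. exact: measurable_cons. Qed.

Section succ.
Variables (n : nat) (m : {sigma_finite_measure set (n.-tuple RR) -> \bar R}).

Definition lebesgue_tuple_succ :=
  pushforward ((@lebesgue_measure R) \x m) (@tcons n).

Let mcons A : measurable A -> measurable (@tcons n @^-1` A).
Proof. by move=> mA; rewrite -[X in measurable X]setTI; exact: measurable_tcons. Qed.

Let succ0 : lebesgue_tuple_succ set0 = 0.
Proof. by rewrite /lebesgue_tuple_succ /pushforward preimage_set0 measure0. Qed.

Let succ_ge0 A : 0 <= lebesgue_tuple_succ A.
Proof. by rewrite /lebesgue_tuple_succ /pushforward; exact: measure_ge0. Qed.

Let succ_additive : semi_sigma_additive lebesgue_tuple_succ.
Proof.
move=> F mF tF mUF; rewrite /lebesgue_tuple_succ /pushforward preimage_bigcup.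
apply: measure_semi_sigma_additive.
- by move=> k; exact: mcons.
- apply/trivIsetP => /= i j _ _ ij; rewrite -preimage_setI.
  by move/trivIsetP : tF => /(_ _ _ _ _ ij) ->//; rewrite preimage_set0.
- by rewrite -preimage_bigcup; exact: mcons.
Qed.

HB.instance Definition _ := isMeasure.Build _ _ _ lebesgue_tuple_succ
  succ0 succ_ge0 succ_additive.

Let succ_sigma_finite : sigma_finite setT lebesgue_tuple_succ.
Proof.
have /sigma_finiteP[F [TF ndF Foo]] := sigma_finiteT (@lebesgue_measure R).
have /sigma_finiteP[G [TG ndG Goo]] := sigma_finiteT m.
pose H k : set (n.+1.-tuple RR) :=
  [set t | F k (thead t) /\ G k [tuple of behead t]].
have HE k : @tcons n @^-1` (H k) = F k `*` G k.
  apply/seteqP; split => -[x y] /=; rewrite /H /tcons /= theadE.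
    by move=> [? +]; rewrite (_ : [tuple of _] = y)//; exact/val_inj.
  by move=> [? ?]; split => //; rewrite (_ : [tuple of _] = y)//; exact/val_inj.
exists H => [|k].
  apply/seteqP; split => // t _.
  have [i _ Fi] : (\bigcup_i F i) (thead t) by rewrite -TF.
  have [j _ Gj] : (\bigcup_i G i) [tuple of behead t] by rewrite -TG.
  exists (maxn i j) => //; split.
    by move: Fi; exact/subsetPset/ndF/leq_maxl.
  by move: Gj; exact/subsetPset/ndG/leq_maxr.
split.
  have mth : measurable_fun setT (fun t : n.+1.-tuple RR => thead t).
    exact: measurable_tnth.
  apply: measurableI.
    by rewrite -[X in measurable X]setTI; apply: mth => //; exact: (Foo k).1.
  rewrite -[X in measurable X]setTI.
  by apply: measurable_behead => //; exact: (Goo k).1.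
rewrite /lebesgue_tuple_succ /pushforward HE product_measure1E//.
- have [_ F1] := Foo k; have [_ G1] := Goo k.
  by rewrite lte_mul_pinfty// ge0_fin_numE.
- exact: (Foo k).1.
- exact: (Goo k).1.
Qed.

HB.instance Definition _ := Measure_isSigmaFinite.Build _ _ _
  lebesgue_tuple_succ succ_sigma_finite.

End succ.

Fixpoint lebesgue_tuple d : {sigma_finite_measure set (d.-tuple RR) -> \bar R} :=
  match d with
  | 0%N => @dirac _ _ [tuple] R
  | n.+1 => lebesgue_tuple_succ (lebesgue_tuple n)
  end.

End lebesgue_tuple.

Definition row_display : measure_display -> measure_display.
Proof. exact. Qed.

Section lebesgue_row.
Variables (R : realType) (d : nat).
Local Notation RR := (measurableTypeR R).

Definition row_of_tuple (t : d.-tuple RR) : 'rV[R]_d := \row_i tnth t i.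

Let rowm : set (set 'rV[R]_d) := [set A | measurable (row_of_tuple @^-1` A)].

Let rowm0 : rowm set0.
Proof. by rewrite /rowm /= preimage_set0. Qed.

Let rowmC A : rowm A -> rowm (~` A).
Proof. by rewrite /rowm /= preimage_setC; exact: measurableC. Qed.

Let rowmU (F : (set 'rV[R]_d)^nat) :
  (forall i, rowm (F i)) -> rowm (\bigcup_i F i).
Proof.
by rewrite /rowm /= => mF; rewrite preimage_bigcup; exact: bigcupT_measurable.
Qed.

HB.instance Definition _ := @isMeasurable.Build (row_display default_measure_display)
  'rV[R]_d rowm rowm0 rowmC rowmU.

Lemma measurable_row_of_tuple : measurable_fun [set: d.-tuple RR] row_of_tuple.
Proof. by move=> _ A mA; rewrite setTI. Qed.

Definition lebesgue_row : set 'rV[R]_d -> \bar R :=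
  pushforward (lebesgue_tuple R d) row_of_tuple.

HB.instance Definition _ := Measure.copy lebesgue_row
  (measure_function_pushforward__canonical__measure_function_Measure
     (lebesgue_tuple R d) measurable_row_of_tuple).

End lebesgue_row.

Section domain_and_laplacian.
Variables (R : realType) (d : nat).
Local Notation V := 'rV[R]_d.
Implicit Types (Om : set V) (v w z g : V -> R).

(* A nonempty bounded intersection of finitely many open half-spaces; such a
   set is automatically open and convex. *)
Definition convex_polygonal_domain Om : Prop :=
  [/\ Om !=set0, bounded_set Om &
      exists (n : nat) (a : 'I_n -> V) (b : 'I_n -> R),
        Om = [set x | forall k, \sum_(i < d) a k 0 i * x 0 i < b k]].

Definition L2 Om v : Prop :=
  measurable_fun Om v /\
  (\int[@lebesgue_row R d]_(x in Om) ((v x) ^+ 2)%:E < +oo)%E.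

Definition L2ip Om v w : R := \int[@lebesgue_row R d]_(x in Om) (v x * w x).

Definition L2norm Om v : R := Num.sqrt (L2ip Om v v).

Definition partial (i : 'I_d) g : V -> R := fun x => 'D_(delta_mx 0 i) g x.

(* C^oo: all iterated partial derivatives are differentiable. *)
Definition smooth g : Prop :=
  forall (s : seq 'I_d) (x : V), differentiable (foldr partial g s) x.

Definition test_function Om g : Prop :=
  smooth g /\
  exists K : set V, [/\ compact K, K `<=` Om & forall x, ~ K x -> g x = 0].

(* v belongs to H^1_0(Om), the closure of C_c^oo(Om) in H^1(Om), and G is its
   gradient. *)
Definition H10 Om v (G : 'I_d -> V -> R) : Prop :=
  [/\ L2 Om v, forall i, L2 Om (G i) &
    exists g : nat -> V -> R,
      [/\ forall n, test_function Om (g n),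
          L2norm Om (g n \- v) @[n --> \oo] --> (0 : R) &
          forall i, L2norm Om (partial i (g n) \- G i) @[n --> \oo] --> (0 : R)]].

(* v is in the domain of A = -Delta (homogeneous Dirichlet condition) and
   A v = w: A is the operator on L^2(Om) associated with the Dirichlet form. *)
Definition dirichlet_laplacian Om v w : Prop :=
  L2 Om w /\
  exists2 G, H10 Om v G &
    forall z H, H10 Om z H -> \sum_(i < d) L2ip Om (G i) (H i) = L2ip Om w z.

Definition orthonormal_basis Om (phi : nat -> V -> R) : Prop :=
  [/\ forall j, L2 Om (phi j),
      forall i j, L2ip Om (phi i) (phi j) = (i == j)%:R &
      forall v, L2 Om v ->
        L2norm Om (fun x => v x - \sum_(j < n) L2ip Om v (phi j) * phi j x)
          @[n --> \oo] --> (0 : R)].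

Definition dirichlet_eigenbasis Om (lam : nat -> R) (phi : nat -> V -> R) :=
  orthonormal_basis Om phi /\
  forall j, dirichlet_laplacian Om (phi j) (fun x => lam j * phi j x).

End domain_and_laplacian.

Section mittag_leffler.
Variable R : realType.

Definition Gamma (x : R) : R :=
  \int[@lebesgue_measure R]_(t in `]0, +oo[) (t `^ (x - 1) * expR (- t)).

Definition mittag_leffler (a b z : R) : R :=
  limn (series (fun k : nat => z ^+ k / Gamma (a * k%:R + b))).

End mittag_leffler.

(* Both the functions in L^2(Om) and the elements of the dual spaces are viewed
   as functionals v |-> ell v on functions; (ell, phi_j) is then ell (phi j). *)
Section fractional_spaces.
Variables (R : realType) (d : nat) (Om : set 'rV[R]_d).
Variables (lam : nat -> R) (phi : nat -> 'rV[R]_d -> R).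
Local Notation fn := ('rV[R]_d -> R).
Local Notation functional := (fn -> R).
Implicit Types (v z : fn) (ell : functional) (q : R).

Definition as_functional v : functional := fun z => L2ip Om v z.

Definition coef ell : nat -> R := fun j => ell (phi j).

Definition hnorm2 q ell : \bar R :=
  (\sum_(0 <= j <oo) (lam j `^ q * (coef ell j) ^+ 2)%:E)%E.

(* The norm of dot H^q; meaningful when hnorm2 q ell is finite. *)
Definition hnorm q ell : R := Num.sqrt (fine (hnorm2 q ell)).

(* v belongs to dot H^q, q >= 0. *)
Definition in_dotH q v : Prop :=
  L2 Om v /\ (hnorm2 q (as_functional v) < +oo)%E.

(* ell belongs to dot H^(-q), the dual of dot H^q, q in [0, 1]: a bounded linear
   functional on dot H^q. Its values outside dot H^q are irrelevant. *)
Definition in_dotH_dual q ell : Prop :=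
  (forall (a : R) v z, in_dotH q v -> in_dotH q z ->
     ell (fun x => a * v x + z x) = a * ell v + ell z) /\
  exists C : R, forall v, in_dotH q v ->
    `|ell v| <= C * hnorm q (as_functional v).

End fractional_spaces.

Section mild_solutions.
Variables (R : realType) (d : nat) (Om : set 'rV[R]_d).
Variables (lam : nat -> R) (phi : nat -> 'rV[R]_d -> R) (alpha mu : R).
Local Notation fn := ('rV[R]_d -> R).
Local Notation functional := (fn -> R).

(* The operators F(t) and E(t), acting on the sequences of coefficients. *)
Definition Fop (t : R) (c : nat -> R) : nat -> R := fun j =>
  mittag_leffler alpha 1 (- lam j * t `^ alpha) * c j.

Definition Eop (t : R) (c : nat -> R) : nat -> R := fun j =>
  t `^ (alpha - 1) * mittag_leffler alpha alpha (- lam j * t `^ alpha) * c j.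

(* u is in C([0,T]; dot H^(-mu)) and in C((0,T]; dot H^(2-mu)), where U t is the
   function representing u t for t > 0, and
     u(t) = F(t) phi0 + \int_0^t E(t-s) f(u(s)) ds.
   The Duhamel integral is the Bochner integral of an L^2(Om)-valued function,
   with source f(u) in L^1(0,T; L^2(Om)); the identity is written in the
   coordinates of the basis. *)
Definition mild_solution (f : R -> R) (T : R) (phi0 : functional)
    (u : R -> functional) : Prop :=
  exists U : R -> fn,
  [/\ u 0 = phi0,
      (forall t, t \in `[0, T] -> in_dotH_dual Om lam phi mu (u t)) /\
      (forall t0, t0 \in `[0, T] ->
         hnorm lam phi (- mu) (u t \- u t0)
           @[t --> within `[0, T] (nbhs t0)] --> (0 : R)),
      (forall t, t \in `]0, T] ->
         in_dotH Om lam phi (2 - mu) (U t) /\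
         forall z, in_dotH Om lam phi mu z -> u t z = as_functional Om (U t) z) /\
      (forall t0, t0 \in `]0, T] ->
         hnorm lam phi (2 - mu) (u t \- u t0)
           @[t --> within `]0, T] (nbhs t0)] --> (0 : R)),
      (@lebesgue_measure R).-integrable `]0, T[
        (fun s => (L2norm Om (f \o U s))%:E) &
      forall t, t \in `]0, T] -> forall j,
        coef phi (u t) j = Fop t (coef phi phi0) j +
          \int[@lebesgue_measure R]_(s in `]0, t[)
            Eop (t - s) (coef phi (as_functional Om (f \o U s))) j].

(* The graph of S(T): w is the value at time T of the mild solution issued
   from phi0. *)
Definition solution_operator (f : R -> R) (T : R) (phi0 w : functional) : Prop :=
  exists2 u, mild_solution f T phi0 u & w = u T.

End mild_solutions.

(* Main.v *)
(* On each eigenmode, Duhamel's formula at time T gives the coefficient of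
   phi1 - phi2 as E_{alpha,1}(-lambda T^alpha)^-1 times the difference of the
   coefficients of w1 - w2 and of the Duhamel integral of f(u1) - f(u2).
   Since 1 / (1 + C x) <= E_{alpha,1}(-x) <= 1 / (1 + c x), the inversion costs
   1 + C lambda T^alpha; the Poincare inequality bounds lambda from below, so the
   first term is controlled by the dot H^(2-mu) norm of w1 - w2. In the second
   one, with beta = alpha mu / 2, the inverted kernel
   E_{alpha,1}(-lambda T^alpha)^-1 lambda^(-mu/2) s^(alpha-1) E_{alpha,alpha}(-lambda s^alpha)
   is at most C T^(alpha-beta) s^(beta-1) uniformly in lambda, and a singular
   Gronwall argument bounds the integral of (T-s)^(beta-1) |f(u1) - f(u2)|(s) in
   L^2 by the dot H^(-mu) norm of phi1 - phi2. For small T this term is absorbed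
   by the left-hand side.

   The bounds on E_{alpha,1} and E_{alpha,alpha} come from the positivity of the
   kernel k(t) = t^(alpha-1) E_{alpha,alpha}(-lambda t^alpha), which makes
   E_{alpha,1}(-lambda t^alpha) = 1 - lambda (1 * k)(t) nonincreasing in t;
   comparing the convolution kernels t^(a-1) with their values at the end point
   then gives both sides. *)
Require Import Defs.
From HB Require Import structures.
From mathcomp Require Import all_boot all_order all_algebra.
From mathcomp Require Import all_classical all_reals all_analysis.
From mathcomp Require Import measurable_realfun lra ring.
Import Order.TTheory GRing.Theory Num.Theory.
Import numFieldNormedType.Exports.
Local Open Scope classical_set_scope.
Local Open Scope ring_scope.
Set Implicit Arguments.
Unset Strict Implicit.
Unset Printing Implicit Defensive.

(** All kernel estimates rest on one algebraic fact: under convolution the Riemann-Liouville kernels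
    [gker a] and [gker b] give [gker (a + b)], and the Mittag-Leffler kernels inherit it, [gker a]
    sending [mlker alpha l b] to [mlker alpha l (a + b)]. Two-sided bounds and the Gronwall
    inequality then reduce to pointwise comparisons of kernels, without Laplace transforms or
    contour integrals. The obstacle is the roughness of the data: [phi1 - phi2] lies only in dot
    H^(-mu), so the L^2 norm of the difference of the solutions may grow like t^(-beta) at 0, while
    the inverted kernel is singular at T. The exponents match: convolving [gker beta] with
    [gker (1 - beta)] gives the constant 1, so the singular integral needed for stability is the one
    for which Gronwall closes. Absorption requires this integral to be finite beforehand;
    integrability of the source near 0 and continuity away from 0 supply this. Duhamel's formula is
    available mode by mode; bounds on finite sums of coefficients, uniform in the number of modes,
    pass to the L^2 norm by completeness of the basis. *)

Section affine.
Context {R : realType}.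
Local Notation mu := (@lebesgue_measure R).
Variables (k b : R).
Hypothesis k0 : k != 0.

Let phi (x : measurableTypeR R) : measurableTypeR R := k * x + b.

Let mphi : measurable_fun setT phi.
Proof. by apply: measurable_funD => //; exact: measurable_funM. Qed.

HB.instance Definition _ := isMeasurableFun.Build _ _ _ _ phi mphi.

(** Both sides are measures that agree on half-open intervals, so uniqueness of Lebesgue measure
    applies. For [k < 0] the preimage of []u, v]] is half-open at the other end, with the same
    length. *)
Lemma lebesgue_measure_affine (A : set (measurableTypeR R)) : measurable A ->
  mu A = (`|k|%:E * mu (phi @^-1` A))%E.
Proof.
have nk0 : (0 <= `|k|)%R by [].
move=> mA.
rewrite (@lebesgue_measure_unique _ (mscale (NngNum nk0) (pushforward mu phi))) //.
move=> _ [[u v] _ <-] /=; rewrite /mscale/= /pushforward.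
have [kp|kn] := ltP 0 k.
- have -> : phi @^-1` `]u, v] = `](u - b) / k, (v - b) / k]%classic.
    apply/seteqP; split => x /=; rewrite !in_itv /= /phi ltr_pdivrMr// ler_pdivlMr//.
      by lra.
    by lra.
  rewrite !lebesgue_measure_itv/= !lte_fin ltr_pM2r ?invr_gt0//.
  rewrite ltrD2r; case: ifPn => _; last by rewrite mule0.
  by rewrite -EFinB -EFinM; congr EFin; rewrite gtr0_norm//; field.
- have {}kn : k < 0 by rewrite lt_neqAle k0.
  have -> : phi @^-1` `]u, v] = `[(v - b) / k, (u - b) / k[%classic.
    apply/seteqP; split => x /=; rewrite !in_itv /= /phi ltr_ndivlMr// ler_ndivrMr//.
      by lra.
    by lra.
  rewrite !lebesgue_measure_itv/= !lte_fin ltr_nM2r ?invr_lt0//.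
  rewrite ltrD2r; case: ifPn => _; last by rewrite mule0.
  by rewrite -EFinB -EFinM; congr EFin; rewrite ltr0_norm//; field.
Qed.

Lemma ge0_integral_affine (f : R -> \bar R) : measurable_fun setT f ->
  (forall x, 0 <= f x)%E ->
  (\int[mu]_x f x = `|k|%:E * \int[mu]_x f (k * x + b)%R)%E.
Proof.
move=> mf f0.
have nk0 : (0 <= `|k|)%R by [].
rewrite (@eq_measure_integral _ _ _ _ (mscale (NngNum nk0) (pushforward mu phi))); last first.
  by move=> A mA _ /=; rewrite lebesgue_measure_affine.
rewrite ge0_integral_mscale//; congr (_ * _)%E.
by rewrite ge0_integral_pushforward//.
Qed.

End affine.

(** * Power kernels and the Gamma function *)

(* The kernels are extended by 0 to t <= 0: convolutions over (0, t) are then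
   integrals over the whole line. *)
HB.lock Definition pker {R : realType} (a t : R) : R :=
  if 0 < t then t `^ (a - 1) else 0.

Section power_kernel.
Context {R : realType}.
Local Notation mu := (@lebesgue_measure R).
Implicit Types a b s t : R.

Lemma ler_powRl a x y : 0 <= a -> 0 <= x -> x <= y -> x `^ a <= y `^ a.
Proof.
move=> a0 x0 xy; apply: ge0_ler_powR => //; rewrite nnegrE//.
exact: le_trans xy.
Qed.

Lemma pker_ge0 a t : 0 <= pker a t.
Proof. by rewrite pker.unlock; case: ifP => // _; exact: powR_ge0. Qed.

Lemma pker_gt0 a t : 0 < t -> 0 < pker a t.
Proof. by move=> t0; rewrite pker.unlock t0; exact: powR_gt0. Qed.

Lemma pker_eq0 a t : t <= 0 -> pker a t = 0.
Proof. by rewrite leNgt => /negbTE t0; rewrite pker.unlock t0. Qed.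

Lemma pkerE a t : 0 < t -> pker a t = t `^ (a - 1).
Proof. by rewrite pker.unlock => ->. Qed.

Lemma measurable_pker a : measurable_fun setT (pker a).
Proof.
rewrite pker.unlock.
apply: measurable_fun_ifT => //; first exact: measurable_fun_ltr.
Qed.

Lemma pkerZ a t s : 0 < t -> pker a (t * s) = t `^ (a - 1) * pker a s.
Proof.
move=> t0; rewrite pker.unlock pmulr_rgt0//=; case: ifP => s0; last by rewrite mulr0.
by rewrite powRM// ltW.
Qed.

(** For [a < 1] the integrand is singular at 0, so the antiderivative is used on the intervals
    [[1 / i.+2, 1]] and monotone convergence gives the rest; [i.+2] keeps these intervals
    nondegenerate. *)
Lemma integral_powR01_lty a : 0 < a ->
  (\int[mu]_(x in `]0%R, 1%R]) (x `^ (a - 1))%:E < +oo)%E.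
Proof.
move=> a0.
have mf D : measurable_fun D (fun x : R => (x `^ (a - 1))%:E).
  by apply/measurable_EFinP/measurable_funTS; exact: measurable_powR.
have -> : `]0%R, 1%R]%classic = \bigcup_i `[(i.+2%:R^-1 : R)%R, 1%R]%classic.
  apply/seteqP; split => [x|x [i _]] /=; rewrite !in_itv/=.
    move=> /andP[x0 x1]; exists (Num.bound x^-1) => //=.
    rewrite in_itv/= x1 andbT invf_ple ?posrE//.
    have := archi_boundP (ltW (_ : 0 < x^-1)); rewrite invr_gt0 => /(_ x0) h.
    by rewrite (le_trans (ltW h))// ler_nat -addn2 leq_addr.
  by move=> /andP[xi ->]; rewrite andbT (lt_le_trans _ xi).
apply: (@le_lt_trans _ _ (a^-1)%:E); last exact: ltry.
have cvF : (\int[mu]_(x in `[(i.+2%:R^-1 : R)%R, 1%R]) (x `^ (a - 1))%:E @[i --> \oo] -->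
    \int[mu]_(x in \bigcup_i `[(i.+2%:R^-1 : R)%R, 1%R]%classic) (x `^ (a - 1))%:E)%E.
  apply: ge0_nondecreasing_set_cvg_integral => //.
    move=> m n mn; rewrite subsetEset => x /=; rewrite !in_itv/= => /andP[+ ->].
    by rewrite andbT; apply: le_trans; rewrite lef_pV2 ?posrE// ler_nat !ltnS.
    by move=> i; exact: mf.
  by move=> i x xi; rewrite lee_fin powR_ge0.
apply: (cvge_to_le cvF).
apply: nearW => i.
have i0 : (0 : R) < i.+2%:R^-1 by rewrite invr_gt0.
have dF (x : R) : 0 < x -> is_derive x 1 (fun y : R => a^-1 * y `^ a) (x `^ (a - 1)).
  move=> x0; have := is_deriveZ (a^-1) (is_derive1_powR a x0).
  by move/is_derive_eq; apply; rewrite /GRing.scale/= mulrA mulVf ?gt_eqF// mul1r.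
have cF (x : R) : 0 < x -> {for x, continuous (fun y : R => a^-1 * y `^ a)}.
  move=> x0; apply: differentiable_continuous; apply/derivable1_diffP.
  exact: @ex_derive _ _ _ _ _ _ _ (dF _ x0).
rewrite (@continuous_FTC2 _ _ (fun y => a^-1 * y `^ a)).
- by rewrite powR1 mulr1 lee_fin lerBlDr lerDl mulr_ge0 ?invr_ge0 ?powR_ge0// ltW.
- by rewrite invf_lt1 // ltr1n.
- apply: derivable_within_continuous => x; rewrite in_itv/= => /andP[xi _].
  by apply: derivable_powR; rewrite in_itv/= andbT (lt_le_trans _ xi).
- split.
  + move=> x; rewrite in_itv/= => /andP[xi _].
    by apply: (@ex_derive _ _ _ _ _ _ _ (dF _ _)); exact: lt_trans xi.
  + by apply: cvg_at_right_filter; exact: cF.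
  + by apply: cvg_at_left_filter; exact: cF.
- move=> x; rewrite in_itv/= => /andP[xi _]; rewrite derive1E.
  by apply: (@derive_val _ _ _ _ _ _ _ (dF _ _)); exact: lt_trans xi.
Qed.

Lemma ge0_integral_gammaE a :
  (\int[mu]_(x in `]0%R, +oo[) (x `^ (a - 1) * expR (- x))%:E =
  \int[mu]_x (pker a x * expR (- x))%:E)%E.
Proof.
rewrite integral_mkcond; apply: eq_integral => x _.
rewrite patchE mem_setE in_itv/= andbT pker.unlock.
by case: ifP; rewrite ?mul0r.
Qed.

Lemma integral_gamma_lty a : 0 < a ->
  (\int[mu]_x (pker a x * expR (- x))%:E < +oo)%E.
Proof.
move=> a0.
pose n := Num.bound a.
have an : a - 1 <= n.+1%:R.
  rewrite (@le_trans _ _ a) ?lerBlDr ?lerDl// (le_trans (ltW (archi_boundP (ltW a0))))//.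
  by rewrite ler_nat.
(* The exponential series gives [(x / 2) ^ n.+1 / n.+1! <= expR (x / 2)], hence
   [x ^ n.+1 <= K * expR (x / 2)]: beyond 1 the integrand is at most [K * expR (- x / 2)], a
   multiple of the exponential density of rate 1/2. *)
pose K : R := 2 ^+ n.+1 * n.+1`!%:R.
have K0 : 0 <= K by rewrite mulr_ge0.
pose p1 := (fun x : R => (x `^ (a - 1))%:E) \_ `]0%R, 1%R].
pose p2 x := (2 * K * exponential_pdf (2^-1) x)%:E.
have mpdf : measurable_fun setT (exponential_pdf (2^-1 : R)).
  exact: measurable_exponential_pdf.
have h0 : (0:R) < 2^-1 by rewrite invr_gt0.
have p10 x : (0 <= p1 x)%E.
  by rewrite /p1 patchE; case: ifP => _ //; rewrite lee_fin powR_ge0.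
have pdf0 (x : R) : 0 <= exponential_pdf (2^-1) x.
  by rewrite exponential_pdf_ge0.
have p20 x : (0 <= p2 x)%E by rewrite lee_fin; apply: mulr_ge0 => //; exact: mulr_ge0.
have mp1 : measurable_fun setT p1.
  rewrite /p1; apply/(measurable_restrictT (fun x : R => (x `^ (a - 1))%:E)) => //.
  by apply/measurable_EFinP/measurable_funTS; exact: measurable_powR.
have mp2 : measurable_fun setT p2.
  by apply/measurable_EFinP/measurable_funM.
apply: (@le_lt_trans _ _ (\int[mu]_x (p1 x + p2 x))%E).
  apply: ge0_le_integral => //.
  - by move=> x _; rewrite lee_fin mulr_ge0 ?pker_ge0 ?expR_ge0.
  - apply/measurable_EFinP/measurable_funM; first exact: measurable_pker.
    by apply: measurableT_comp => //; exact: measurable_funN.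
  - exact: emeasurable_funD.
  move=> x _; have [x0|x0] := leP x 0.
    by rewrite pker_eq0// mul0r adde_ge0.
  rewrite pkerE//; have [x1|x1] := leP x 1.
    apply: (@le_trans _ _ (p1 x)); last by rewrite leeDl.
    rewrite /p1 patchE mem_setE in_itv/= x0 x1 lee_fin ler_piMr ?powR_ge0//.
    by rewrite expR_le1 oppr_le0 ltW.
  apply: (@le_trans _ _ (p2 x)); last by rewrite leeDr.
  rewrite /p2 /exponential_pdf patchE mem_setE in_itv/= (ltW x0)/= lee_fin.
  rewrite mulrA (mulrAC 2) mulfV ?mul1r//.
  have -> : - x = - 2^-1 * x + - 2^-1 * x by field.
  rewrite expRD mulrA ler_wpM2r ?expR_ge0// mulNr expRN ler_pdivrMr ?expR_gt0//.
  apply: (@le_trans _ _ (x ^+ n.+1)).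
    by rewrite -powR_mulrn ?(ltW x0)// ler_powR// (ltW x1).
  have xh0 : 0 <= 2^-1 * x by rewrite mulr_ge0// ltW.
  have := expR_ge1Dxn n xh0.
  have f0 : (0 : R) < n.+1`!%:R by rewrite ltr0n fact_gt0.
  move=> h; have {}h : (2^-1 * x) ^+ n.+1 / n.+1`!%:R <= expR (2^-1 * x).
    by apply: le_trans h; rewrite lerDr.
  rewrite ler_pdivrMr// in h.
  rewrite -(@ler_pM2l _ (2^-1 ^+ n.+1)) ?exprn_gt0// -exprMn (le_trans h)//.
  have e2 : (2^-1 : R) ^+ n.+1 * 2 ^+ n.+1 = 1 by rewrite -exprMn mulVf// expr1n.
  by rewrite /K mulrA (mulrA (2^-1 ^+ n.+1)) e2 mul1r mulrC.
rewrite ge0_integralD//; apply: lte_add_pinfty.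
  rewrite /p1 -integral_mkcond; exact: integral_powR01_lty.
rewrite /p2; under eq_integral do rewrite EFinM.
rewrite ge0_integralZl//; last 3 first.
- exact/measurable_EFinP.
- by move=> x _; rewrite lee_fin.
- by rewrite lee_fin mulr_ge0.
by rewrite integral_exponential_pdf// mule1 ltry.
Qed.

Lemma EFin_Gamma a : 0 < a ->
  ((Gamma a)%:E = \int[mu]_x (pker a x * expR (- x))%:E)%E.
Proof.
move=> a0; rewrite /Gamma /Rintegral ge0_integral_gammaE fineK//.
rewrite ge0_fin_numE ?integral_gamma_lty//.
by apply: integral_ge0 => x _; rewrite lee_fin mulr_ge0 ?pker_ge0 ?expR_ge0.
Qed.

Lemma Gamma1 : Gamma 1 = 1 :> R.
Proof.
apply: EFin_inj; rewrite EFin_Gamma//.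
rewrite -[RHS](@integral_exponential_pdf _ (1 : R))//.
have -> : (\int[mu]_x (exponential_pdf 1 x)%:E = \int[mu]_(x in `[0%R, +oo[) (expR (- x))%:E)%E.
  rewrite [RHS]integral_mkcond; apply: eq_integral => x _.
  rewrite /exponential_pdf !patchE; case: ifP => //.
  by rewrite mul1r mulN1r.
rewrite -integral_itv_obnd_cbnd.
  rewrite [RHS]integral_mkcond; apply: eq_integral => x _.
  rewrite patchE mem_setE in_itv/= andbT pker.unlock subrr powRr0.
  by case: ifP; rewrite ?mul0r ?mul1r.
by apply/measurable_EFinP/measurable_funTS; exact: measurableT_comp.
Qed.

Lemma Gamma_lb a c (M : R) : 0 < a -> 0 < M -> 0 <= c ->
  (forall x, M <= x <= M + 1 -> c <= x `^ (a - 1)) ->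
  c * expR (- (M + 1)) <= Gamma a.
Proof.
move=> a0 M0 c0 cx; rewrite -lee_fin EFin_Gamma//.
have -> : ((c * expR (- (M + 1)))%:E =
  \int[mu]_(x in `[M, (M + 1)%R]) (cst (c * expR (- (M + 1)))%:E x))%E.
  rewrite integral_cst//= lebesgue_measure_itv/= lte_fin ltrDl ltr01.
  by rewrite -EFinB addrAC subrr add0r mule1.
have mf D : measurable_fun D (fun x => (pker a x * expR (- x))%:E).
  apply/measurable_EFinP/measurable_funTS/measurable_funM; first exact: measurable_pker.
  by apply: measurableT_comp => //; exact: measurable_funN.
have f0 x : (0 <= (pker a x * expR (- x))%:E)%E.
  by rewrite lee_fin mulr_ge0 ?pker_ge0 ?expR_ge0.
apply: (@le_trans _ _ (\int[mu]_(x in `[M, (M + 1)%R]) (pker a x * expR (- x))%:E)%E).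
  apply: ge0_le_integral => //.
  - by move=> x _; rewrite lee_fin mulr_ge0 ?expR_ge0.
  - exact: mf.
  move=> x /=; rewrite in_itv/= => /andP[Mx xM].
  rewrite lee_fin ler_pM ?expR_ge0//; last by rewrite ler_expR lerN2.
  by rewrite pkerE ?(lt_le_trans M0)// cx// Mx.
by apply: ge0_subset_integral => //; exact: mf.
Qed.

(** On [[M, M + 1]] one has [x ^ (a - 1) = x ^ a / x >= M ^ a / (M + 1)], whatever the sign of
    [a - 1]. Since [M] is free, the inverse Gamma coefficients decay faster than every geometric
    sequence, with no need of Stirling's formula. *)
Lemma Gamma_ge a (M : R) : 0 < a -> 0 < M ->
  M `^ a / (M + 1) * expR (- (M + 1)) <= Gamma a.
Proof.
move=> a0 M0; have M1 : 0 < M + 1 by rewrite addr_gt0.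
apply: Gamma_lb; rewrite ?divr_ge0 ?powR_ge0 ?(ltW M1)// => x /andP[Mx xM].
have x0 : 0 < x := lt_le_trans M0 Mx.
rewrite ler_pdivrMr// (@le_trans _ _ (x `^ (a - 1) * x))//.
  by rewrite [leRHS]mulrC mulr_powRB1 ?(ltW x0)//; apply: ler_powRl => //; exact: ltW.
by rewrite ler_wpM2l ?powR_ge0.
Qed.

Lemma Gamma_gt0 a : 0 < a -> 0 < Gamma a.
Proof.
move=> a0; apply: lt_le_trans (Gamma_ge a0 ltr01).
by rewrite mulr_gt0 ?divr_gt0 ?powR_gt0 ?expR_gt0 ?addr_gt0.
Qed.

End power_kernel.

(** The Riemann-Liouville kernel: convolution with it is fractional integration of order [a]. *)
HB.lock Definition gker {R : realType} (a t : R) : R := pker a t / Gamma a.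

Local Opaque Gamma.

(** * Beta integral and the semigroup law of fractional integration *)

Section beta_gamma.
Context {R : realType}.
Local Notation mu := (@lebesgue_measure R).
Implicit Types a b s t : R.

Lemma measurable_pkerB a b t :
  measurable_fun setT (fun s => (pker a (t - s) * pker b s)%:E).
Proof.
apply/measurable_EFinP/measurable_funM; last exact: measurable_pker.
apply: measurableT_comp; first exact: measurable_pker.
exact: measurable_funB.
Qed.

Lemma pkerB_ge0 a b t s : (0 <= (pker a (t - s) * pker b s)%:E)%E.
Proof. by rewrite lee_fin mulr_ge0 ?pker_ge0. Qed.

(** Euler's beta integral, kept as an extended real because its finiteness is only deduced from
    [Gamma_betaE]. *)
Definition betaE a b : \bar R := (\int[mu]_s (pker a (1 - s) * pker b s)%:E)%E.

Lemma betaE_ge0 a b : (0 <= betaE a b)%E.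
Proof. by apply: integral_ge0 => s _; exact: pkerB_ge0. Qed.

Lemma conv_pker a b t :
  (\int[mu]_s (pker a (t - s) * pker b s)%:E = betaE a b * (pker (a + b) t)%:E)%E.
Proof.
have [t0|t0] := leP t 0.
  rewrite (@pker_eq0 _ (a + b))// mule0 integral0_eq// => s _.
  have [s0|s0] := leP s 0; first by rewrite (@pker_eq0 _ b)// mulr0.
  by rewrite (@pker_eq0 _ a) ?mul0r//; lra.
rewrite (@ge0_integral_affine _ t 0); last 3 first.
- by rewrite gt_eqF.
- exact: measurable_pkerB.
- by move=> x; exact: pkerB_ge0.
under eq_integral do rewrite addr0 -[in X in X - _](mulr1 t) -mulrBr !pkerZ// mulrACA EFinM.
rewrite ge0_integralZl//; last 3 first.
- exact: measurable_pkerB.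
- by move=> x _; exact: pkerB_ge0.
- by rewrite lee_fin mulr_ge0 ?powR_ge0.
rewrite /betaE muleCA muleA muleC -!EFinM; congr (_ * _)%E.
rewrite pkerE// gtr0_norm// -[X in _ * X](@powRr1 _ t) ?(ltW t0)//.
rewrite -!powRD ?(gt_eqF t0) ?implybT//.
by congr (_ `^ _)%:E; lra.
Qed.

(** In the product of the two Gamma integrals, the inner variable is shifted to become the sum of
    both; after Tonelli the inner integral is the convolution evaluated by [conv_pker]. *)
Lemma Gamma_betaE a b : 0 < a -> 0 < b ->
  ((Gamma a * Gamma b)%:E = betaE a b * (Gamma (a + b))%:E)%E.
Proof.
move=> a0 b0.
have mE (c : R) : measurable_fun setT (fun x : R => (pker c x * expR (- x))%:E).
  apply/measurable_EFinP/measurable_funM; first exact: measurable_pker.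
  by apply: measurableT_comp => //; exact: measurable_funN.
have E0 (c x : R) : (0 <= (pker c x * expR (- x))%:E)%E.
  by rewrite lee_fin mulr_ge0 ?pker_ge0 ?expR_ge0.
pose f (p : R * R) : \bar R := (pker a (p.2 - p.1) * pker b p.1 * expR (- p.2))%:E.
have mf : measurable_fun setT f.
  apply/measurable_EFinP/measurable_funM.
    apply: measurable_funM.
      apply: measurableT_comp; first exact: measurable_pker.
      by apply: measurable_funB.
    by apply: measurableT_comp => //; exact: measurable_pker.
  apply: measurableT_comp => //; apply: measurableT_comp => //.
have f0 x : (0 <= f x)%E.
  by rewrite lee_fin !mulr_ge0 ?pker_ge0 ?expR_ge0.
transitivity (\int[mu]_x \int[mu]_r f (x, r))%E.
  rewrite mulrC EFinM (EFin_Gamma b0).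
  rewrite -ge0_integralZr//; last 2 first.
  - exact: mE.
  - by rewrite lee_fin ltW// Gamma_gt0.
  apply: eq_integral => x _; rewrite (EFin_Gamma a0).
  rewrite (@ge0_integral_affine _ 1 (- x))//.
  rewrite normr1 mul1e -ge0_integralZl//; last first.
    by apply: (measurableT_comp (mE a)); apply: measurable_funD.
  apply: eq_integral => r _; rewrite /f/= mul1r -!EFinM; congr EFin.
  rewrite mulrACA -expRD (mulrC (pker b x)); congr (_ * _ * expR _).
  by ring.
rewrite fubini_tonelli//.
transitivity (\int[mu]_r (betaE a b * (pker (a + b) r * expR (- r))%:E))%E.
  apply: eq_integral => r _; rewrite /f/=.
  under eq_integral do rewrite EFinM.
  rewrite ge0_integralZr//; last 2 first.
  - exact: measurable_pkerB.
  - by move=> x _; exact: pkerB_ge0.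
  by rewrite conv_pker EFinM muleA.
rewrite EFin_Gamma ?addr_gt0// ge0_integralZl// ?betaE_ge0//; exact: mE.
Qed.

Lemma gker_ge0 a t : 0 < a -> 0 <= gker a t.
Proof. by move=> a0; rewrite gker.unlock divr_ge0 ?pker_ge0// ltW// Gamma_gt0. Qed.

Lemma gker_gt0 a t : 0 < a -> 0 < t -> 0 < gker a t.
Proof. by move=> a0 t0; rewrite gker.unlock divr_gt0 ?pker_gt0// Gamma_gt0. Qed.

Lemma gkerE a t : 0 < t -> gker a t = t `^ (a - 1) / Gamma a.
Proof. by move=> t0; rewrite gker.unlock pkerE. Qed.

Lemma gker_eq0 a t : t <= 0 -> gker a t = 0.
Proof. by move=> t0; rewrite gker.unlock pker_eq0// mul0r. Qed.

Lemma measurable_gker a : measurable_fun setT (gker a).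
Proof. by rewrite gker.unlock; apply: measurable_funM => //; exact: measurable_pker. Qed.

(** The normalization by Gamma cancels the beta factor of [conv_pker]. That factor is finite because
    [Gamma_betaE] equates a positive multiple of it with a real number. *)
Lemma conv_gker a b t : 0 < a -> 0 < b ->
  (\int[mu]_s (gker a (t - s) * gker b s)%:E = (gker (a + b) t)%:E)%E.
Proof.
move=> a0 b0.
have ab0 : 0 < a + b by rewrite addr_gt0.
have [[ga gb] gab] := (Gamma_gt0 a0, Gamma_gt0 b0, Gamma_gt0 ab0).
under eq_integral do rewrite gker.unlock mulrACA -invfM EFinM.
rewrite ge0_integralZr//; last 3 first.
- exact: measurable_pkerB.
- by move=> x _; exact: pkerB_ge0.
- rewrite lee_fin invr_ge0; exact: ltW (mulr_gt0 ga gb).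
rewrite conv_pker.
have -> : betaE a b = (Gamma a * Gamma b / Gamma (a + b))%:E.
  have := Gamma_betaE a0 b0.
  case: (betaE a b) (betaE_ge0 a b) => [r _|_|//]; rewrite -?EFinM.
  - by move=> [->]; rewrite mulfK// gt_eqF.
  - by rewrite gt0_mulye// lte_fin.
rewrite -!EFinM gker.unlock; congr EFin.
rewrite mulrAC [X in X * _]mulrAC mulfV ?mul1r 1?mulrC//.
exact: lt0r_neq0 (mulr_gt0 gb ga).
Qed.

End beta_gamma.

(** * Mittag-Leffler functions *)

Section rapidly_decreasing_coefficients.
Context {R : realType}.
Implicit Types (c : nat -> R) (z r : R).

(** Infinite radius of convergence, stated as a Cauchy bound at every radius, a form that passes
    directly to the derived series. *)
Definition rapid c :=
  forall M : R, 0 < M -> exists2 C : R, 0 <= C & forall n, `|c n| * M ^+ n <= C.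

Lemma rapid_diffs c : rapid c -> rapid (pseries_diffs c).
Proof.
move=> rc M M0; have M20 : 0 < 2 * M by rewrite mulr_gt0.
have [C C0 cC] := rc _ M20; exists (C / M); first by rewrite divr_ge0// ltW.
move=> n; rewrite ler_pdivlMr// -mulrA -exprSr (le_trans _ (cC n.+1))//.
rewrite /pseries_diffs normrM exprMn mulrA.
rewrite ler_wpM2r ?exprn_ge0 ?(ltW M0)// mulrC ler_wpM2l// normr_nat.
by rewrite -natrX ler_nat ltnW// ltn_expl.
Qed.

Lemma rapid_term c r : rapid c -> 0 <= r ->
  exists2 C : R, 0 <= C & forall n z, `|z| <= r -> `|c n * z ^+ n| <= C * 2^-1 ^+ n.
Proof.
(* Using [r + 1] keeps the radius positive when [r = 0]; the factor 2 leaves the geometric ratio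
   1/2. *)
move=> rc r0; have r1 : 0 < 2 * (r + 1) by rewrite mulr_gt0// ltr_wpDl.
have [C C0 cC] := rc _ r1; exists C => // n z zr.
rewrite exprVn ler_pdivlMr ?exprn_gt0// normrM normrX (le_trans _ (cC n))//.
rewrite exprMn -mulrA ler_wpM2l// mulrC ler_wpM2l ?exprn_ge0//.
by rewrite lerXn2r ?nnegrE ?(le_trans zr)// ?lerDl// addr_ge0.
Qed.

Lemma rapid_cvg c z : rapid c -> cvgn (pseries c z).
Proof.
move=> rc; have [C C0 cC] := rapid_term rc (normr_ge0 z).
apply: normed_cvg; apply: (@series_le_cvg _ _ (geometric C 2^-1)) => //=.
- by move=> n; rewrite mulr_ge0 ?exprn_ge0.
- by move=> n; exact: cC.
- by apply: is_cvg_geometric_series; rewrite ger0_norm// invf_lt1// ltr1n.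
Qed.

(** The bound is uniform in the number of terms: it provides the dominating function of
    [conv_mlker]. *)
Lemma rapid_bounded c r : rapid c -> 0 <= r ->
  exists2 K : R, 0 <= K & forall n z, `|z| <= r -> `|pseries c z n| <= K.
Proof.
move=> rc r0; have [C C0 cC] := rapid_term rc r0.
exists (C * 2); first by rewrite mulr_ge0.
move=> n z zr; rewrite /pseries /series/= (le_trans (ler_norm_sum _ _ _))//.
apply: (@le_trans _ _ (\sum_(0 <= k < n) C * 2^-1 ^+ k)).
  by apply: ler_sum => k _; exact: cC.
rewrite -mulr_sumr ler_wpM2l// big_mkord.
have : (1 - 2^-1) * (\sum_(i < n) 2^-1 ^+ i) = 1 - (2^-1 : R) ^+ n.
  by rewrite -opprB mulNr -subrX1 opprB.
have : (0 : R) <= 2^-1 ^+ n by rewrite exprn_ge0.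
by lra.
Qed.

Lemma rapid_continuous c : rapid c -> continuous (fun z => limn (pseries c z)).
Proof.
move=> rc z; apply: differentiable_continuous; apply/derivable1_diffP.
have zz : `|z| < `| `|z| + 1 |.
  by rewrite [ltRHS]ger0_norm ?ltrDl// addr_ge0.
apply: (@ex_derive _ _ _ _ _ _ _ (pseries_snd_diffs _ _ _ zz)).
all: by apply: rapid_cvg => //; do ?apply: rapid_diffs.
Qed.

End rapidly_decreasing_coefficients.

HB.lock Definition mlcoef {R : realType} (alpha b : R) (n : nat) : R :=
  (Gamma (alpha * n%:R + b))^-1.

(** For an eigenmode [l], [b = 1] gives the decay of the initial value and [b = alpha] the Duhamel
    kernel. *)
HB.lock Definition mlker {R : realType} (alpha l b t : R) : R :=
  pker b t * mittag_leffler alpha b (- l * t `^ alpha).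

Section mittag_leffler_kernel.
Context {R : realType}.
Local Notation mu := (@lebesgue_measure R).
Variable alpha : R.
Hypothesis alpha_gt0 : 0 < alpha.
Implicit Types (a b l s t z : R).
Local Notation mlcoef := (mlcoef alpha).
Local Notation mlker := (mlker alpha).

Lemma mlcoefS b n : mlcoef b n.+1 = mlcoef (alpha + b) n.
Proof.
rewrite mlcoef.unlock; congr (Gamma _)^-1.
by rewrite -natr1 mulrDr mulr1 addrA.
Qed.

Lemma mlcoef0 b : mlcoef b 0 = (Gamma b)^-1.
Proof. by rewrite mlcoef.unlock; congr (Gamma _)^-1; rewrite mulr0 add0r. Qed.

Lemma mlarg_gt0 b n : 0 < b -> 0 < alpha * n%:R + b.
Proof. by move=> b0; rewrite ltr_wpDl// mulr_ge0// ltW. Qed.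

Lemma mittag_lefflerE b z :
  mittag_leffler alpha b z = limn (pseries (mlcoef b) z).
Proof.
rewrite /mittag_leffler /pseries mlcoef.unlock; congr (lim (series _ @ \oo)).
by apply/funext => k; rewrite mulrC.
Qed.

Local Opaque mittag_leffler.

(** [Gamma_ge] is applied at [N = M ^ (1 / alpha)], for which [N ^ (alpha * n) = M ^ n]. *)
Lemma mlcoef_rapid b : 0 < b -> rapid (mlcoef b).
Proof.
move=> b0 M M0; pose N := M `^ alpha^-1.
have N0 : 0 < N by rewrite powR_gt0.
have N1 : 0 < N + 1 by rewrite addr_gt0.
have NM n : N `^ (alpha * n%:R) = M ^+ n.
  rewrite -powRrM mulrA mulVf ?gt_eqF// mul1r powR_mulrn// ltW//.
exists ((N + 1) / N `^ b * expR (N + 1)).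
  by rewrite mulr_ge0 ?expR_ge0 ?divr_ge0 ?powR_ge0// ltW.
move=> n; have x0 := mlarg_gt0 n b0.
have G0 := Gamma_gt0 x0.
rewrite mlcoef.unlock gtr0_norm ?invr_gt0// mulrC ler_pdivrMr//.
apply: (@le_trans _ _ ((N + 1) / N `^ b * expR (N + 1) *
    (N `^ (alpha * n%:R + b) / (N + 1) * expR (- (N + 1))))); last first.
  apply: ler_wpM2l; last exact: Gamma_ge.
  by rewrite mulr_ge0 ?expR_ge0 ?divr_ge0 ?powR_ge0// ltW.
rewrite powRD ?(gt_eqF N0) ?implybT// NM expRN.
have e0 := expR_gt0 (N + 1); have p0 : 0 < N `^ b by rewrite powR_gt0.
move: (expR (N + 1)) (N `^ b) e0 p0 => e p e0 p0.
by rewrite le_eqVlt; apply/orP; left; apply/eqP; field; rewrite !gt_eqF.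
Qed.

Lemma continuous_mittag_leffler b : 0 < b ->
  continuous (mittag_leffler alpha b).
Proof.
move=> b0; rewrite (_ : mittag_leffler _ _ = fun z => limn (pseries (mlcoef b) z)).
  exact: rapid_continuous (mlcoef_rapid b0).
by apply/funext => z; exact: mittag_lefflerE.
Qed.

Lemma mittag_leffler_rec b z : 0 < b ->
  mittag_leffler alpha b z =
  (Gamma b)^-1 + z * mittag_leffler alpha (alpha + b) z.
Proof.
move=> b0; rewrite !mittag_lefflerE.
have ab0 : 0 < alpha + b by rewrite addr_gt0.
have c1 := rapid_cvg (z := z) (mlcoef_rapid b0).
have c2 := rapid_cvg (z := z) (mlcoef_rapid ab0).
apply/cvg_lim => //; rewrite -(cvg_shiftS (pseries _ _)).
have -> : (fun n => pseries (mlcoef b) z n.+1) =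
    (fun n => (Gamma b)^-1 + z * pseries (mlcoef (alpha + b)) z n).
  apply/funext => n; rewrite /pseries /series/= big_nat_recl//=.
  rewrite expr0 mulr1 mlcoef0 mulr_sumr; congr (_ + _).
  by apply: eq_bigr => k _; rewrite exprS mulrCA mlcoefS.
by apply: cvgD; [exact: cvg_cst|apply: cvgMr].
Qed.

Lemma mittag_leffler0 b : 0 < b -> mittag_leffler alpha b 0 = (Gamma b)^-1.
Proof. by move=> b0; rewrite mittag_leffler_rec// mul0r addr0. Qed.

Lemma mlker_eq0 l b t : t <= 0 -> mlker l b t = 0.
Proof. by move=> t0; rewrite mlker.unlock (pker_eq0 _ t0) mul0r. Qed.

Lemma measurable_mlarg l : measurable_fun setT (fun t => - l * t `^ alpha).
Proof. by apply: measurable_funM => //; exact: measurable_powR. Qed.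

Lemma measurable_mlker l b : 0 < b -> measurable_fun setT (mlker l b).
Proof.
move=> b0; rewrite mlker.unlock; apply: measurable_funM; first exact: measurable_pker.
apply: measurableT_comp; last exact: measurable_mlarg.
by apply: continuous_measurable_fun; exact: continuous_mittag_leffler.
Qed.

(** By [conv_mlker] the last kernel is the convolution of [gker alpha] with [mlker l b], so this is
    a Volterra equation for [mlker l b]. *)
Lemma mlker_rec l b t : 0 < b ->
  mlker l b t = gker b t - l * mlker l (alpha + b) t.
Proof.
move=> b0; have [t0|t0] := leP t 0.
  by rewrite !mlker_eq0// gker_eq0// mulr0 subr0.
rewrite mlker.unlock mittag_leffler_rec// mulrDr; congr (_ + _).
  by rewrite gker.unlock.
have -> : pker (alpha + b) t = pker b t * t `^ alpha.
  rewrite !pkerE// -powRD ?(gt_eqF t0) ?implybT//.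
  by congr (_ `^ _); ring.
by ring.
Qed.

Lemma mlker_partial l b n t : pker b t * pseries (mlcoef b) (- l * t `^ alpha) n =
  \sum_(0 <= k < n) (- l) ^+ k * gker (alpha * k%:R + b) t.
Proof.
rewrite /pseries /series/= mulr_sumr; apply: eq_bigr => k _.
have [t0|t0] := leP t 0.
  by rewrite gker_eq0// pker_eq0// mul0r mulr0.
have e : pker (alpha * k%:R + b) t = pker b t * (t `^ alpha) ^+ k.
  rewrite -powR_mulrn ?powR_ge0// -powRrM !pkerE// -powRD ?(gt_eqF t0) ?implybT//.
  by congr (_ `^ _); ring.
rewrite mlcoef.unlock gker.unlock e exprMn; move: (Gamma _)^-1 ((- l) ^+ k) (_ ^+ k) => u v w; ring.
Qed.

(** Each partial sum is a combination of kernels [gker], convolved by [conv_gker]; dominated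
    convergence gives the limit. The partial sums need a bound only for arguments up to
    [|l| * t ^ alpha], because [gker a (t - s)] vanishes for [s >= t]. *)
Lemma conv_mlker l a b t : 0 < a -> 0 < b ->
  mu.-integrable setT (fun s => (gker a (t - s) * mlker l b s)%:E) /\
  (\int[mu]_s (gker a (t - s) * mlker l b s)%:E = (mlker l (a + b) t)%:E)%E.
Proof.
move=> a0 b0.
have ab0 : 0 < a + b by rewrite addr_gt0.
have mga : measurable_fun setT (fun s => gker a (t - s)).
  by apply: measurableT_comp; [exact: measurable_gker|exact: measurable_funB].
pose r := `|l| * t `^ alpha.
have r0 : 0 <= r by rewrite mulr_ge0 ?powR_ge0.
have [K K0 cK] := rapid_bounded (mlcoef_rapid b0) r0.
pose fn n s := (gker a (t - s) *
  (pker b s * pseries (mlcoef b) (- l * s `^ alpha) n))%:E.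
pose g s := ((K * Gamma b) * (gker a (t - s) * gker b s))%:E.
have ig c : 0 < c -> mu.-integrable setT (fun s => (gker a (t - s) * gker c s)%:E).
  move=> c0; apply/integrableP; split.
    by apply/measurable_EFinP/measurable_funM => //; exact: measurable_gker.
  under eq_integral => s _ do rewrite /= ger0_norm ?mulr_ge0 ?(gker_ge0 _ a0) ?(gker_ge0 _ c0)//.
  by rewrite conv_gker// ltry.
have fnE n : fn n = fun s => (\sum_(k < n)
    ((- l) ^+ k)%:E * (gker a (t - s) * gker (alpha * k%:R + b) s)%:E)%E.
  apply/funext => s; rewrite /fn mlker_partial big_mkord mulr_sumr -sumEFin.
  by apply: eq_bigr => k _; rewrite mulrCA EFinM.
have mfn n : measurable_fun setT (fn n).
  rewrite fnE; apply: emeasurable_sum => k.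
  apply/measurable_EFinP/measurable_funM => //; apply: measurable_funM => //.
  exact: measurable_gker.
have mf : measurable_fun setT (fun s => (gker a (t - s) * mlker l b s)%:E).
  by apply/measurable_EFinP/measurable_funM => //; exact: measurable_mlker.
have [] := @dominated_convergence _ _ _ mu setT measurableT fn
  (fun s => (gker a (t - s) * mlker l b s)%:E) g mfn mf.
- apply: aeW => s _; apply: cvg_EFin; first exact: nearW.
  rewrite mlker.unlock mittag_lefflerE /fn/=; apply: cvgMr; apply: cvgMr.
  exact: rapid_cvg (mlcoef_rapid b0).
- by apply: (integrableZl _ _ (ig _ b0)).
- apply: aeW => s n _; rewrite lee_fin /fn.
  have [s0|s0] := leP s 0; first by rewrite (@gker_eq0 _ b)// pker_eq0// !(mul0r,mulr0) normr0.
  have [st|st] := leP t s.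
    by rewrite (@gker_eq0 _ a) ?subr_le0// !(mul0r,mulr0) normr0.
  rewrite normrM (ger0_norm (gker_ge0 _ a0)) mulrCA ler_wpM2l ?gker_ge0//.
  have -> : K * Gamma b * gker b s = pker b s * K.
    by rewrite gker.unlock mulrACA mulfV ?(lt0r_neq0 (Gamma_gt0 b0))// mulr1 mulrC.
  rewrite normrM (ger0_norm (pker_ge0 _ _)) ler_wpM2l ?pker_ge0//.
  apply: cK; rewrite normrM normrN /r ler_wpM2l// ger0_norm ?powR_ge0//.
  by apply: ler_powRl; exact: ltW.
move=> iF _ cF; split => //.
apply: (cvg_unique _ cF) => //.
have -> : [sequence (\int[mu]_x fn n x)%E]_n =
   fun n => (pker (a + b) t * pseries (mlcoef (a + b)) (- l * t `^ alpha) n)%:E.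
  apply/funext => n /=; rewrite fnE integral_sum//; last first.
    by move=> k; apply: integrableZl => //; apply: ig; exact: mlarg_gt0.
  rewrite mlker_partial big_mkord -sumEFin; apply: eq_bigr => k _.
  rewrite integralZl ?ig ?mlarg_gt0// conv_gker ?mlarg_gt0//.
  by rewrite addrCA EFinM.
apply: cvg_EFin; first exact: nearW.
rewrite mlker.unlock mittag_lefflerE; apply: cvgMr.
exact: rapid_cvg (mlcoef_rapid ab0).
Qed.

End mittag_leffler_kernel.

(** * Comparison of convolutions with known values *)

Section integral_value.
Context {R : realType}.
Local Notation mu := (@lebesgue_measure R).
Implicit Types (f g : R -> R) (x y c : R).

(** Carrying integrability and value together lets [hasint_le] turn a pointwise inequality of
    kernels into one between their known convolutions. *)
Definition hasint f x :=
  mu.-integrable setT (fun s => (f s)%:E) /\ (\int[mu]_s (f s)%:E = x%:E)%E.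

Lemma hasint_le f g x y : hasint f x -> hasint g y ->
  (forall s, f s <= g s) -> x <= y.
Proof.
move=> [fi fx] [gi gy] fg; rewrite -lee_fin -fx -gy.
by apply: le_integral => // s _; rewrite lee_fin.
Qed.

Lemma hasintZ c f x : hasint f x -> hasint (fun s => c * f s) (c * x).
Proof.
move=> [fi fx]; split.
  by under eq_fun do rewrite EFinM; exact: integrableZl.
by under eq_integral do rewrite EFinM; rewrite integralZl// fx.
Qed.

Lemma hasintD f g x y : hasint f x -> hasint g y ->
  hasint (fun s => f s + g s) (x + y).
Proof.
move=> [fi fx] [gi gy]; split.
  by under eq_fun do rewrite EFinD; exact: integrableD.
by under eq_integral do rewrite EFinD; rewrite integralD// fx gy.
Qed.

Lemma ge0_hasint f x : measurable_fun setT f -> (forall s, 0 <= f s) ->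
  (\int[mu]_s (f s)%:E = x%:E)%E -> hasint f x.
Proof.
move=> mf f0 fx; split => //; apply/integrableP; split; first exact/measurable_EFinP.
by under eq_integral do rewrite /= ger0_norm//; rewrite fx ltry.
Qed.

Lemma hasint_gker a b t : 0 < a -> 0 < b ->
  hasint (fun s => gker a (t - s) * gker b s) (gker (a + b) t).
Proof.
move=> a0 b0; apply: ge0_hasint; last exact: conv_gker.
  apply: measurable_funM; last exact: measurable_gker.
  by apply: measurableT_comp; [exact: measurable_gker|exact: measurable_funB].
by move=> s; apply: mulr_ge0; exact: gker_ge0.
Qed.

End integral_value.

(** * Positivity and monotonicity of the resolvent kernels *)

Section resolvent_kernel.
Context {R : realType}.
Local Notation mu := (@lebesgue_measure R).
Variables alpha l : R.
Hypotheses (alpha_gt0 : 0 < alpha) (alpha_lt1 : alpha < 1) (l_gt0 : 0 < l).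
Implicit Types (a b s t : R).
Local Notation P := (mlker alpha l).

Lemma hasint_mlker a b t : 0 < a -> 0 < b ->
  hasint (fun s => gker a (t - s) * P b s) (P (a + b) t).
Proof. by move=> a0 b0; have [? ?] := conv_mlker alpha_gt0 l t a0 b0. Qed.

Lemma gker1E t : 0 < t -> gker 1 t = 1 :> R.
Proof. by move=> t0; rewrite gkerE// subrr powRr0 Gamma1 divr1. Qed.

Lemma gker_le a s t : 0 < a -> a <= 1 -> 0 < s -> s <= t -> gker a t <= gker a s.
Proof.
move=> a0 a1 s0 st; have t0 := lt_le_trans s0 st.
rewrite !gkerE// ler_wpM2r ?invr_ge0 ?(ltW (Gamma_gt0 a0))//.
rewrite -(opprB 1 a) !powRN lef_pV2 ?posrE ?powR_gt0//.
by apply: ler_powRl; rewrite ?subr_ge0// ltW.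
Qed.

(** Before raising to the negative power [alpha - 1], this is [t * (m - s) <= (t - s) * m], that is
    [s * m <= s * t]. *)
Lemma gker_logconvex s m t : 0 < s -> s < m -> m <= t ->
  gker alpha (t - s) <= gker alpha t / gker alpha m * gker alpha (m - s).
Proof.
move=> s0 sm mt.
have m0 := lt_trans s0 sm; have t0 := lt_le_trans m0 mt.
have ms : 0 < m - s by rewrite subr_gt0.
have ts : 0 < t - s by rewrite subr_gt0 (lt_le_trans sm).
have gm := gker_gt0 alpha_gt0 m0.
rewrite mulrAC ler_pdivlMr// !gkerE//.
have G0 := Gamma_gt0 alpha_gt0.
rewrite mulrACA [leRHS]mulrACA ler_wpM2r ?mulr_ge0 ?invr_ge0 ?(ltW G0)//.
rewrite -!powRM ?(ltW m0) ?(ltW t0) ?(ltW ms) ?(ltW ts)//.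
rewrite -(opprB 1 alpha) !powRN lef_pV2 ?posrE ?powR_gt0 ?mulr_gt0//.
apply: ler_powRl; rewrite ?subr_ge0 ?(ltW alpha_lt1)//.
  by rewrite mulr_ge0// ltW.
by rewrite mulrBr mulrBl lerD2l lerN2 mulrC ler_wpM2r// ltW.
Qed.

Let phi t := mittag_leffler alpha alpha (- l * t `^ alpha).

Lemma continuous_phi t : 0 < t -> {for t, continuous phi}.
Proof.
move=> t0; apply: continuous_comp; last exact: continuous_mittag_leffler.
apply: continuousM; first exact: cst_continuous.
apply: differentiable_continuous; apply/derivable1_diffP.
exact: @ex_derive _ _ _ _ _ _ _ (is_derive1_powR alpha t0).
Qed.

Lemma mlkerE b t : 0 < t ->
  P b t = t `^ (b - 1) * mittag_leffler alpha b (- l * t `^ alpha).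
Proof. by move=> t0; rewrite mlker.unlock pkerE. Qed.

Lemma phi_near0 : exists2 tau : R, 0 < tau & forall t, 0 < t -> t < tau -> 0 < phi t.
Proof.
have G0 := Gamma_gt0 alpha_gt0.
have : mittag_leffler alpha alpha z @[z --> 0] --> (Gamma alpha)^-1.
  rewrite -(mittag_leffler0 alpha_gt0 alpha_gt0).
  exact: continuous_mittag_leffler.
move=> /cvgr_gt => /(_ 0); rewrite invr_gt0 => /(_ G0).
move=> /nbhs_ballP[d /= d0 dP].
exists ((d / l) `^ alpha^-1); first by apply: powR_gt0; exact: divr_gt0.
move=> t t0 td; apply: dP; rewrite /ball/= sub0r normrN normrM normrN.
rewrite !gtr0_norm ?powR_gt0// mulrC -ltr_pdivlMr//.
have dl : 0 <= d / l by rewrite divr_ge0// ltW.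
rewrite -[ltRHS](@powRr1 _ (d / l))// -(mulVf (lt0r_neq0 alpha_gt0)) powRrM.
by rewrite gt0_ltr_powR ?nnegrE ?powR_ge0 ?(ltW t0).
Qed.

(* The kernel solves the Volterra equation [k + l g * k = g] with [g] the
   log-convex kernel [gker alpha]; comparing the equation at a first zero [t0]
   with the one at a maximum point [m < t0] of [k] near [t0] is contradictory. *)
Lemma mlker_gt0 t : 0 < t -> 0 < P alpha t.
Proof.
move=> t_gt0; rewrite ltNge; apply/negP => Pt.
have kphi u : 0 < u -> (0 < P alpha u) = (0 < phi u).
  by move=> u0; rewrite mlkerE// pmulr_rgt0// powR_gt0.
have [tau tau0 tauP] := phi_near0.
(* The cut-off at [tau / 2], below which [phi] is positive, makes the infimum of [S] positive; this
   infimum is the first zero. *)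
pose S := [set u : R | tau / 2 <= u /\ phi u <= 0].
have St : S t.
  have pt : phi t <= 0 by rewrite leNgt -kphi// -leNgt.
  split => //; rewrite leNgt; apply/negP => tt.
  have : 0 < phi t by apply: tauP => //; lra.
  by rewrite ltNge pt.
have lbS : has_lbound S by exists (tau / 2) => u [].
have infS : has_inf S by split => //; exists t.
pose t0 := inf S.
have t00 : 0 < t0.
  apply: (@lt_le_trans _ _ (tau / 2)); first by rewrite divr_gt0.
  by apply: lb_le_inf; [exists t|move=> u []].
have pos u : 0 < u -> u < t0 -> 0 < phi u.
  move=> u0 ut0; have [ut|ut] := ltP u (tau / 2).
    by apply: tauP => //; lra.
  rewrite ltNge; apply/negP => pu; have Su : S u := conj ut pu.
  by have := ge_inf lbS Su; rewrite leNgt ut0.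
have pt0 : phi t0 <= 0.
  rewrite leNgt; apply/negP => p0.
  have /cvgr_gt/(_ 0 p0)/nbhs_ballP[d /= d0 dP] := @continuous_phi _ t00.
  have [u Su ud] := inf_adherent d0 infS.
  have t0u : t0 <= u by apply: ge_inf.
  have : 0 < phi u.
    by apply: dP; rewrite /ball/= ler0_norm ?subr_le0// opprB ltrBlDl.
  by rewrite ltNge Su.2.
have gm0 m : 0 < m -> 0 < gker alpha m by exact: gker_gt0.
have Ga := Gamma_gt0 (addr_gt0 alpha_gt0 ltr01).
(* If [eps ^ alpha <= c], then [l * gker (alpha + 1) eps <= 1/4]: this is [l] times the integral of
   [gker alpha] over a window of length [eps]. *)
pose c := Gamma (alpha + 1) / (4 * l).
have c0 : 0 < c by rewrite divr_gt0// mulr_gt0.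
pose eps := Num.min t0 (c `^ alpha^-1).
have eps0 : 0 < eps by rewrite lt_min t00 powR_gt0.
have epst : eps <= t0 by rewrite ge_min lexx.
have epsc : l * gker (alpha + 1) eps < 2^-1.
  rewrite gkerE// addrK mulrA ltr_pdivrMr// mulrC -ltr_pdivlMr//.
  apply: (@le_lt_trans _ _ c).
    rewrite -[leRHS](@powRr1 _ c) ?(ltW c0)// -(mulVf (lt0r_neq0 alpha_gt0)) powRrM.
    by apply: ler_powRl; rewrite ?(ltW alpha_gt0) ?(ltW eps0)// ge_min lexx orbT.
  rewrite /c invfM mulrA ltr_pM2r ?invr_gt0// mulrC ltr_pM2r//.
  by rewrite ltf_pV2 ?posrE// ltr_nat.
have a_lt : t0 - eps / 2 < t0 by rewrite ltrBlDr ltrDl divr_gt0.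
have a_gt : 0 < t0 - eps / 2 by lra.
have cP u : 0 < u -> {for u, continuous (P alpha)}.
  move=> u0.
  have -> : P alpha = (fun t => pker alpha t * phi t).
    by rewrite mlker.unlock.
  apply: continuousM; last exact: continuous_phi.
  have h : {for u, continuous (fun x : R => x `^ (alpha - 1))}.
    apply: differentiable_continuous; apply/derivable1_diffP.
    exact: @ex_derive _ _ _ _ _ _ _ (is_derive1_powR (alpha - 1) u0).
  suff : pker alpha x @[x --> u] --> pker alpha u by [].
  rewrite [X in _ --> X]pkerE//; apply: cvg_trans h; apply: near_eq_cvg.
  near=> x; rewrite pkerE//; near: x; exact: lt_nbhsr.
(* Only half of the window is searched: every [s] with [m <= s < t0] is then strictly above
   [t0 - eps], where the cut-off [gker 1 (s - (t0 - eps))] equals 1. *)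
have [m m_in mmax] : exists2 m, m \in `[t0 - eps / 2, t0] &
    forall u, u \in `[t0 - eps / 2, t0] -> P alpha u <= P alpha m.
  apply: EVT_max; first exact: ltW.
  apply: continuous_in_subspaceT => u /[!inE]/= /[!in_itv]/= /andP[au _].
  by apply: cP; exact: lt_le_trans au.
move: m_in; rewrite in_itv/= => /andP[am mt0].
have m0 : 0 < m := lt_le_trans a_gt am.
have Pm : 0 < P alpha m.
  apply: (@lt_le_trans _ _ (P alpha (t0 - eps / 2))); first by rewrite kphi// pos.
  by apply: mmax; rewrite in_itv/= lexx ltW.
have mlt : m < t0.
  rewrite lt_neqAle mt0 andbT; apply/eqP => mE.
  by move: Pm; rewrite mE kphi// ltNge pt0.
pose q := gker alpha t0 / gker alpha m.
have q0 : 0 < q by rewrite divr_gt0// gm0.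
(* Since [eps <= t0], one has [t0 <= 2 * m], so [q = (t0 / m) ^ (alpha - 1) >= 2 ^ (alpha - 1) >=
   1/2]. *)
have q2 : 2^-1 <= q.
  rewrite /q ler_pdivlMr ?gm0// !gkerE// mulrA ler_wpM2r ?invr_ge0 ?(ltW (Gamma_gt0 _))//.
  apply: (@le_trans _ _ (2 `^ (alpha - 1) * m `^ (alpha - 1))).
    rewrite ler_wpM2r ?powR_ge0// -(@powR_inv1 _ 2)// ler_powR ?ler1n//.
    by rewrite lerBrDr addNr ltW.
  rewrite -powRM ?(ltW m0)// -(opprB 1 alpha) !powRN lef_pV2 ?posrE ?powR_gt0 ?mulr_gt0//.
  by apply: ler_powRl; [rewrite subr_ge0 ltW|exact: ltW|lra].
have I0 := hasint_mlker t0 alpha_gt0 alpha_gt0.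
have Im := hasint_mlker m alpha_gt0 alpha_gt0.
have IH : hasint (fun s => gker alpha (t0 - s) * gker 1 (s - (t0 - eps))) (gker (alpha + 1) eps).
  apply: ge0_hasint.
  - apply: measurable_funM; apply: measurableT_comp; do ?exact: measurable_gker.
      exact: measurable_funB.
    exact: measurable_funB.
  - by move=> s; rewrite mulr_ge0 ?gker_ge0.
  rewrite (@ge0_integral_affine _ 1 (t0 - eps)).
  - rewrite normr1 mul1e -conv_gker//; apply: eq_integral => s _.
    by congr (_ * _)%:E; congr (gker _ _); ring.
  - exact: oner_neq0.
  - apply/measurable_EFinP/measurable_funM; apply: measurableT_comp; do ?exact: measurable_gker.
      exact: measurable_funB.
    exact: measurable_funB.
  - by move=> s; rewrite lee_fin mulr_ge0 ?gker_ge0.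
(* Before [m], log-convexity compares the two kernels and positivity of [P alpha] preserves the
   inequality; between [m] and [t0], maximality bounds [P alpha s] by [P alpha m]. *)
have cmp : forall s, gker alpha (t0 - s) * P alpha s <=
    q * (gker alpha (m - s) * P alpha s) +
    P alpha m * (gker alpha (t0 - s) * gker 1 (s - (t0 - eps))).
  move=> s.
  have r0 : 0 <= P alpha m * (gker alpha (t0 - s) * gker 1 (s - (t0 - eps))).
    by rewrite !mulr_ge0 ?gker_ge0// ltW.
  have [s0|s0] := leP s 0.
    by rewrite mlker_eq0// !mulr0 add0r.
  have [ts|st] := leP t0 s.
    rewrite (@gker_eq0 _ _ (t0 - s)) ?subr_le0// !mul0r mulr0 addr0.
    rewrite (@gker_eq0 _ _ (m - s)) ?mul0r ?mulr0//.
    by rewrite subr_le0 ltW// (lt_le_trans mlt).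
  have Ps : 0 <= P alpha s by rewrite ltW// kphi// pos.
  have [ms|sm] := leP m s.
    rewrite (@gker_eq0 _ _ (m - s)) ?subr_le0// mul0r mulr0 add0r.
    rewrite gker1E; last by rewrite subr_gt0; lra.
    rewrite mulr1 mulrC ler_wpM2r ?gker_ge0// mmax//.
    by rewrite in_itv/= (le_trans am ms) ltW.
  rewrite -[leLHS]addr0 lerD// mulrA ler_wpM2r//.
  exact: gker_logconvex.
(* Inserted in the Volterra equations at [t0] and [m], this yields [P alpha t0 >= (q - l * gker
   (alpha + 1) eps) * P alpha m > 0]. *)
have := hasint_le I0 (hasintD (hasintZ q Im) (hasintZ (P alpha m) IH)) cmp.
have r0 := mlker_rec alpha_gt0 l t0 alpha_gt0.
have rm := mlker_rec alpha_gt0 l m alpha_gt0.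
have Pt0 : P alpha t0 <= 0 by rewrite leNgt kphi// -leNgt.
have qm : q * P alpha m = gker alpha t0 - q * (l * P (alpha + alpha) m).
  by rewrite {1}rm mulrBr /q divfK ?gt_eqF ?gm0.
have : P alpha m * (l * gker (alpha + 1) eps) < P alpha m * q.
  by rewrite ltr_pM2l// (lt_le_trans epsc).
move: (P (alpha + alpha) t0) (P (alpha + alpha) m) r0 rm qm => x0 xm r0 rm qm hq.
rewrite -(ler_pM2l l_gt0) => h.
move: Pt0; rewrite leNgt r0 => /negP; apply.
lra.
Unshelve. all: by end_near.
Qed.

Lemma mlker_ge0 t : 0 <= P alpha t.
Proof.
have [t0|t0] := leP t 0; first by rewrite mlker_eq0.
by rewrite ltW// mlker_gt0.
Qed.

Lemma mlker1E t : 0 < t -> P 1 t = 1 - l * P (1 + alpha) t.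
Proof. by move=> t0; rewrite mlker_rec// gker1E// (addrC alpha). Qed.

Lemma mlker1_le s t : 0 < s -> s <= t -> P 1 t <= P 1 s.
Proof.
move=> s0 st; have t0 := lt_le_trans s0 st.
rewrite !mlker1E// lerD2l lerN2 ler_wpM2l ?(ltW l_gt0)//.
have I r := hasint_mlker r ltr01 alpha_gt0.
apply: (hasint_le (I s) (I t)) => r; rewrite ler_wpM2r ?mlker_ge0//.
have [sr|rs] := leP s r.
  by rewrite gker_eq0 ?gker_ge0// subr_le0.
by rewrite !gker1E// subr_gt0// (lt_le_trans rs).
Qed.

(** Convolution with [gker (1 - alpha)] sends [P alpha] to [P 1]. This decreasing kernel is at least
    its value at [t] on (0, t), and the integral of [P alpha] there is [(1 - P 1 t) / l]. *)
Lemma mlker1_lb t : 0 < t ->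
  gker (1 - alpha) t * (1 - P 1 t) <= l * P 1 t.
Proof.
move=> t0.
have a1 : 0 < 1 - alpha by rewrite subr_gt0.
have -> : 1 - P 1 t = l * P (1 + alpha) t by rewrite mlker1E//; ring.
rewrite mulrCA ler_wpM2l ?(ltW l_gt0)//.
have := hasint_mlker t a1 alpha_gt0; rewrite subrK => I1.
have I2 := hasintZ (gker (1 - alpha) t) (hasint_mlker t ltr01 alpha_gt0).
apply: (hasint_le I2 I1) => s; rewrite mulrA.
have [s0|s0] := leP s 0; first by rewrite mlker_eq0// !mulr0.
rewrite ler_wpM2r ?mlker_ge0//.
have [ts|st] := leP t s.
  by rewrite !(@gker_eq0 _ _ (t - s)) ?subr_le0// mulr0.
rewrite gker1E ?subr_gt0// mulr1 gker_le// ?subr_gt0//.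
  by rewrite lerBlDr lerDl ltW.
by rewrite lerBlDr lerDl ltW.
Qed.

(** [P 1] is nonincreasing, so its convolution with [gker alpha] is at least
    [P 1 t * gker (alpha + 1) t]; by [mlker1E] that convolution is [(1 - P 1 t) / l]. *)
Lemma mlker1_ub t : 0 < t ->
  P 1 t * (1 + l * gker (alpha + 1) t) <= 1.
Proof.
move=> t0.
have : P 1 t * gker (alpha + 1) t <= P (alpha + 1) t.
  apply: (hasint_le (hasintZ (P 1 t) (hasint_gker t alpha_gt0 ltr01))
    (hasint_mlker t alpha_gt0 ltr01)) => s.
  rewrite mulrCA; have [s0|s0] := leP s 0.
    by rewrite [P 1 s]mlker_eq0// [gker 1 s]gker_eq0// !mulr0.
  have [ts|st] := leP t s.
    by rewrite (@gker_eq0 _ _ (t - s)) ?subr_le0// !mul0r.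
  by rewrite gker1E// mulr1 ler_wpM2l ?gker_ge0// mlker1_le// ltW.
rewrite -(ler_pM2l l_gt0) => h.
have := mlker1E t0; rewrite (addrC 1 alpha) => e1.
by lra.
Qed.

(** In the Volterra equation for [P alpha], the kernel [gker alpha (t - s)] is bounded below by
    [gker alpha t], which factors out and leaves [1 - l * P (1 + alpha) t = P 1 t]. *)
Lemma mlker_ub t : 0 < t -> P alpha t <= gker alpha t * P 1 t.
Proof.
move=> t0; rewrite mlker_rec// mlker1E// mulrBr mulr1 lerD2l lerN2.
rewrite mulrCA ler_wpM2l ?(ltW l_gt0)//.
apply: (hasint_le (hasintZ (gker alpha t) (hasint_mlker t ltr01 alpha_gt0))
  (hasint_mlker t alpha_gt0 alpha_gt0)) => s.
rewrite mulrA; have [s0|s0] := leP s 0; first by rewrite mlker_eq0// !mulr0.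
rewrite ler_wpM2r ?mlker_ge0//.
have [ts|st] := leP t s.
  by rewrite !(@gker_eq0 _ _ (t - s)) ?subr_le0// mulr0.
rewrite gker1E ?subr_gt0// mulr1 gker_le// ?subr_gt0// ?(ltW alpha_lt1)//.
by rewrite lerBlDr lerDl ltW.
Qed.

End resolvent_kernel.

(** * Mittag-Leffler bounds on the negative half-line *)

Section mittag_leffler_bounds.
Context {R : realType}.
Variable alpha : R.
Hypotheses (alpha_gt0 : 0 < alpha) (alpha_lt1 : alpha < 1).
Local Notation ml := (mittag_leffler alpha).
Implicit Types x : R.

(** Because the argument is [- l * t ^ alpha], time can be fixed at 1 and [l] left to range over all
    positive numbers. *)
Lemma mlker_at1 b x : mlker alpha x b 1 = ml b (- x).
Proof. by rewrite mlker.unlock pkerE// !powR1 mul1r mulr1. Qed.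

Lemma gker_at1 b : gker b 1 = (Gamma b)^-1 :> R.
Proof. by rewrite gkerE// powR1 mul1r. Qed.

Lemma mittag_leffler_lb x : 0 < x ->
  (1 + Gamma (1 - alpha) * x)^-1 <= ml 1 (- x).
Proof.
move=> x0; have a1 : 0 < 1 - alpha by rewrite subr_gt0.
have G0 := Gamma_gt0 a1.
have := mlker1_lb alpha_gt0 alpha_lt1 x0 (@ltr01 R).
rewrite mlker_at1 gker_at1 -(ler_pM2l G0) mulrA mulfV ?gt_eqF// mul1r => h.
have G1 : 0 < 1 + Gamma (1 - alpha) * x by rewrite addr_gt0// mulr_gt0.
by rewrite -[leLHS]mul1r ler_pdivrMr//; lra.
Qed.

Lemma mittag_leffler_ub x : 0 < x ->
  ml 1 (- x) <= (1 + x / Gamma (alpha + 1))^-1.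
Proof.
move=> x0; have G0 := Gamma_gt0 (addr_gt0 alpha_gt0 (@ltr01 R)).
have := mlker1_ub alpha_gt0 alpha_lt1 x0 (@ltr01 R).
rewrite mlker_at1 gker_at1 => h.
rewrite -[leRHS]mul1r ler_pdivlMr// addr_gt0// divr_gt0//.
Qed.

Lemma mittag_leffler_alpha_ge0 x : 0 < x -> 0 <= ml alpha (- x).
Proof. by move=> x0; rewrite -mlker_at1 mlker_ge0. Qed.

Lemma mittag_leffler_alpha_ub x : 0 < x -> ml alpha (- x) <= ml 1 (- x) / Gamma alpha.
Proof.
move=> x0; have := mlker_ub alpha_gt0 alpha_lt1 x0 (@ltr01 R).
by rewrite !mlker_at1 gker_at1 mulrC.
Qed.

End mittag_leffler_bounds.

(** * Poincare inequality and spectral gap *)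

Section L2_space.
Context {R : realType} {d : nat} (Om : set 'rV[R]_d).
Local Notation mu := (@lebesgue_row R d).
Hypothesis mOm : measurable Om.
Implicit Types (u v w : 'rV[R]_d -> R) (c : R).

Lemma L2_integrableM v w : L2 Om v -> L2 Om w ->
  mu.-integrable Om (EFin \o (fun x => v x * w x)).
Proof.
move=> [mv iv] [mw iw].
have mv2 : measurable_fun Om (fun x => ((v x) ^+ 2)%:E).
  by apply/measurable_EFinP; exact: measurable_funX.
have mw2 : measurable_fun Om (fun x => ((w x) ^+ 2)%:E).
  by apply/measurable_EFinP; exact: measurable_funX.
have mvw : measurable_fun Om (fun x => v x * w x) by exact: measurable_funM.
apply: (@le_integrable _ _ _ mu _ mOm _ (fun x => ((v x) ^+ 2)%:E + ((w x) ^+ 2)%:E)%E).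
- exact/measurable_EFinP.
- move=> x _ /=; rewrite !lee_fin [leRHS]ger0_norm ?addr_ge0 ?sqr_ge0//.
  rewrite ler_norml; have := sqr_ge0 (v x + w x); have := sqr_ge0 (v x - w x).
  have := sqr_ge0 (v x); have := sqr_ge0 (w x).
  by rewrite !expr2 => *; apply/andP; split; lra.
- apply: integrableD => //; apply/integrableP; split => //.
    by under eq_integral do rewrite /= ger0_norm ?sqr_ge0//.
  by under eq_integral do rewrite /= ger0_norm ?sqr_ge0//.
Qed.

Lemma L2_0 : L2 Om (fun=> 0).
Proof.
split; first exact: measurable_cst.
by under eq_integral do rewrite expr0n; rewrite integral0 ltry.
Qed.

Lemma L2Z c v : L2 Om v -> L2 Om (fun x => c * v x).
Proof.
move=> Lv; have [mv iv] := Lv; split; first exact: measurable_funM.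
have := integrableZl mOm (c ^+ 2) (L2_integrableM Lv Lv).
move=> /integrableP[_]; apply: le_lt_trans.
rewrite le_eqVlt; apply/orP; left; apply/eqP; apply: eq_integral => x _ /=.
by rewrite -!expr2 exprMn ger0_norm// mulr_ge0 ?sqr_ge0.
Qed.

Lemma L2D v w : L2 Om v -> L2 Om w -> L2 Om (fun x => v x + w x).
Proof.
move=> Lv Lw; have [[mv _] [mw _]] := (Lv, Lw); split; first exact: measurable_funD.
have := integrableD mOm (integrableD mOm (L2_integrableM Lv Lv) (L2_integrableM Lv Lw))
  (integrableD mOm (L2_integrableM Lv Lw) (L2_integrableM Lw Lw)).
move=> /integrableP[_]; apply: le_lt_trans.
rewrite le_eqVlt; apply/orP; left; apply/eqP; apply: eq_integral => x _ /=.
have -> : v x * v x + v x * w x + (v x * w x + w x * w x) = (v x + w x) ^+ 2.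
  by ring.
by rewrite ger0_norm// sqr_ge0.
Qed.

Lemma L2B v w : L2 Om v -> L2 Om w -> L2 Om (v \- w).
Proof.
move=> Lv Lw; have := L2D Lv (L2Z (-1) Lw).
by congr L2; apply/funext => x /=; rewrite mulN1r.
Qed.

Lemma L2_sum (h : nat -> 'rV[R]_d -> R) n :
  (forall j, L2 Om (h j)) -> L2 Om (fun x => \sum_(j < n) h j x).
Proof.
move=> Lh; elim: n => [|n ih].
  by under eq_fun do rewrite big_ord0; exact: L2_0.
by under eq_fun do rewrite big_ord_recr/=; exact: L2D.
Qed.

Lemma L2ipC v w : L2ip Om v w = L2ip Om w v.
Proof. by apply: eq_Rintegral => x _; rewrite mulrC. Qed.

Lemma L2ipDl u v w : L2 Om u -> L2 Om v -> L2 Om w ->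
  L2ip Om (fun x => u x + v x) w = L2ip Om u w + L2ip Om v w.
Proof.
move=> Lu Lv Lw; rewrite /L2ip -RintegralD//; try exact: L2_integrableM.
by apply: eq_Rintegral => x _; rewrite mulrDl.
Qed.

Lemma L2ipZl c v w : L2 Om v -> L2 Om w ->
  L2ip Om (fun x => c * v x) w = c * L2ip Om v w.
Proof.
move=> Lv Lw; rewrite /L2ip -RintegralZl//; last exact: L2_integrableM.
by apply: eq_Rintegral => x _; rewrite mulrA.
Qed.

Lemma L2ipBl u v w : L2 Om u -> L2 Om v -> L2 Om w ->
  L2ip Om (u \- v) w = L2ip Om u w - L2ip Om v w.
Proof.
move=> Lu Lv Lw; rewrite /L2ip -RintegralB//; try exact: L2_integrableM.
by apply: eq_Rintegral => x _ /=; rewrite mulrBl.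
Qed.

Lemma L2ip0l w : L2ip Om (fun=> 0) w = 0.
Proof.
rewrite /L2ip; under eq_Rintegral do rewrite mul0r.
by rewrite /Rintegral integral0.
Qed.

Lemma L2ip_suml (h : nat -> 'rV[R]_d -> R) n w :
  (forall j, L2 Om (h j)) -> L2 Om w ->
  L2ip Om (fun x => \sum_(j < n) h j x) w = \sum_(j < n) L2ip Om (h j) w.
Proof.
move=> Lh Lw; elim: n => [|n ih].
  by under eq_fun do rewrite big_ord0; rewrite L2ip0l big_ord0.
rewrite big_ord_recr/= -ih -L2ipDl//; last exact: L2_sum.
by congr L2ip; apply/funext => x; rewrite big_ord_recr.
Qed.

Lemma L2ip_ge0 v : 0 <= L2ip Om v v.
Proof. by apply: Rintegral_ge0 => x _; rewrite -expr2 sqr_ge0. Qed.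

Lemma L2norm_ge0 v : 0 <= L2norm Om v.
Proof. exact: sqrtr_ge0. Qed.

Lemma L2norm_sqr v : L2norm Om v ^+ 2 = L2ip Om v v.
Proof. by rewrite sqr_sqrtr// L2ip_ge0. Qed.

Lemma L2ip_sqrD v w : L2 Om v -> L2 Om w ->
  L2ip Om (fun x => v x + w x) (fun x => v x + w x) =
  L2ip Om v v + 2 * L2ip Om v w + L2ip Om w w.
Proof.
move=> Lv Lw; have Lvw := L2D Lv Lw.
rewrite L2ipDl// ![L2ip Om _ (fun x => _ + _)]L2ipC !L2ipDl//.
by rewrite (L2ipC w v); ring.
Qed.

Lemma L2_cauchy_schwarz v w : L2 Om v -> L2 Om w ->
  `|L2ip Om v w| <= L2norm Om v * L2norm Om w.
Proof.
move=> Lv Lw.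
have P (t s : R) : 0 <= t ^+ 2 * L2ip Om v v + 2 * (t * s) * L2ip Om v w + s ^+ 2 * L2ip Om w w.
  have := L2ip_ge0 (fun x => t * v x + s * w x).
  have [Ltv Lsw] := (L2Z t Lv, L2Z s Lw).
  rewrite L2ip_sqrD// !L2ipZl// ![L2ip Om _ (fun x => _ * _)]L2ipC !L2ipZl//.
  by rewrite (L2ipC w v); congr (0 <= _); ring.
rewrite -(@ler_pXn2r _ 2)// ?nnegrE ?mulr_ge0 ?L2norm_ge0//.
rewrite exprMn !L2norm_sqr real_normK ?num_real//.
have a0 := L2ip_ge0 v; have b0 := L2ip_ge0 w.
move: (L2ip Om v v) (L2ip Om w w) (L2ip Om v w) P a0 b0 => a b c P a0 b0.
have [b00|bn0] := eqVneq b 0.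
  have [->|c0] := eqVneq c 0; first by rewrite expr0n b00 mulr0.
  (* With [b = 0] the form is affine in [s]; at this point its value is [- a - 2 < 0]. *)
  exfalso; have := P 1 (- (a + 1) / c).
  rewrite b00 mulr0 addr0 expr1n mul1r mul1r -mulrA divfK//.
  by move: a0; lra.
have bp : 0 < b by rewrite lt_neqAle eq_sym bn0.
have := P b (- c).
have -> : b ^+ 2 * a + 2 * (b * - c) * c + (- c) ^+ 2 * b = b * (a * b - c ^+ 2).
  by ring.
by rewrite pmulr_rge0// subr_ge0.
Qed.

Lemma L2norm_triangle v w : L2 Om v -> L2 Om w ->
  L2norm Om (fun x => v x + w x) <= L2norm Om v + L2norm Om w.
Proof.
move=> Lv Lw; rewrite -(@ler_pXn2r _ 2)// ?nnegrE ?addr_ge0 ?L2norm_ge0//.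
rewrite L2norm_sqr L2ip_sqrD// sqrrD !L2norm_sqr lerD2r lerD2l.
have := L2_cauchy_schwarz Lv Lw; have := ler_norm (L2ip Om v w).
by rewrite mulr_natl mulr2n; lra.
Qed.

Lemma L2normN v : L2norm Om (fun x => - v x) = L2norm Om v.
Proof. by congr Num.sqrt; apply: eq_Rintegral => x _; rewrite mulrNN. Qed.

Lemma L2norm_distC v w : L2norm Om (v \- w) = L2norm Om (w \- v).
Proof.
rewrite -L2normN; congr L2norm; apply/funext => x /=; by rewrite opprB.
Qed.

Lemma L2norm_le_lin c v w : 0 <= c -> L2 Om v -> L2 Om w ->
  (forall x, `|v x| <= c * `|w x|) -> L2norm Om v <= c * L2norm Om w.
Proof.
move=> c0 Lv Lw vw.
rewrite -(@ler_pXn2r _ 2)// ?nnegrE ?mulr_ge0 ?L2norm_ge0//.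
rewrite exprMn !L2norm_sqr expr2 -mulrA -L2ipZl// -L2ipZl//; last exact: L2Z.
apply: le_Rintegral => //; do ?exact: L2_integrableM.
  by apply: L2_integrableM => //; do !apply: L2Z.
move=> x _; rewrite -expr2 -real_normK ?num_real// mulrA -expr2.
have -> : c ^+ 2 * w x * w x = (c * `|w x|) ^+ 2.
  by rewrite exprMn real_normK ?num_real// -mulrA -expr2.
by rewrite lerXn2r ?nnegrE// mulr_ge0.
Qed.

Section basis.
Variable phi : nat -> 'rV[R]_d -> R.
Hypothesis ob : orthonormal_basis Om phi.

Lemma basis_L2 j : L2 Om (phi j). Proof. by have [] := ob. Qed.

Lemma basis_ip i j : L2ip Om (phi i) (phi j) = (i == j)%:R.
Proof. by have [] := ob. Qed.

Lemma L2ip_basis_residual v n : L2 Om v ->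
  L2norm Om (fun x => v x - \sum_(j < n) L2ip Om v (phi j) * phi j x) ^+ 2 =
  L2ip Om v v - \sum_(j < n) (L2ip Om v (phi j)) ^+ 2.
Proof.
move=> Lv; pose s x := \sum_(j < n) L2ip Om v (phi j) * phi j x.
have Lc j : L2 Om (fun x => L2ip Om v (phi j) * phi j x) by apply: L2Z; exact: basis_L2.
have Ls : L2 Om s := L2_sum n Lc.
have sv w : L2 Om w -> L2ip Om s w = \sum_(j < n) L2ip Om v (phi j) * L2ip Om (phi j) w.
  move=> Lw; rewrite (L2ip_suml n Lc Lw); apply: eq_bigr => j _.
  by rewrite L2ipZl//; exact: basis_L2.
rewrite L2norm_sqr -/s L2ipBl//; last exact: L2B.
rewrite (L2ipC v) (L2ipC s) !L2ipBl//.
have -> : L2ip Om s s = \sum_(j < n) (L2ip Om v (phi j)) ^+ 2.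
  rewrite sv//; apply: eq_bigr => j _; rewrite (L2ipC (phi j)) sv; last exact: basis_L2.
  rewrite (bigD1 j)//= basis_ip eqxx mulr1 big1 ?addr0// => i ij.
  by rewrite basis_ip val_eqE (negbTE ij) mulr0.
have -> : L2ip Om s v = \sum_(j < n) (L2ip Om v (phi j)) ^+ 2.
  by rewrite sv//; apply: eq_bigr => j _; rewrite (L2ipC (phi j)) expr2.
rewrite (L2ipC v s).
have -> : L2ip Om s v = \sum_(j < n) (L2ip Om v (phi j)) ^+ 2.
  by rewrite sv//; apply: eq_bigr => j _; rewrite (L2ipC (phi j)) expr2.
by rewrite subrr subr0.
Qed.

Lemma bessel v n : L2 Om v ->
  \sum_(j < n) (L2ip Om v (phi j)) ^+ 2 <= L2ip Om v v.
Proof. by move=> Lv; rewrite -subr_ge0 -L2ip_basis_residual// sqr_ge0. Qed.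

(** The squared residual is the norm squared minus the partial sum, and it tends to 0 by
    completeness. Thus bounds on finite sums suffice for L^2 estimates. *)
Lemma parseval_le v (B : R) : L2 Om v ->
  (forall n, \sum_(j < n) (L2ip Om v (phi j)) ^+ 2 <= B) -> L2ip Om v v <= B.
Proof.
move=> Lv hB; have [_ _ /(_ _ Lv) cv] := ob.
have c2 := cvgM cv cv; rewrite mulr0 in c2.
have : L2ip Om v v - B <= 0.
  apply: (cvgr_to_ge (c2 _)); apply: nearW => n /=.
  rewrite -[leRHS]expr2 L2ip_basis_residual// lerD2l lerN2; exact: hB.
by rewrite subr_le0.
Qed.

End basis.
End L2_space.

(** * Measurability of half-spaces and continuous functions on row vectors *)

Section row_measurability.
Context {R : realType} {d : nat}.
Local Notation V := 'rV[R]_d.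

Lemma measurable_coord (i : 'I_d) : measurable_fun setT (fun x : V => x 0 i).
Proof.
move=> _ Y mY; rewrite setTI.
suff : measurable ((fun t : d.-tuple (measurableTypeR R) => tnth t i) @^-1` Y).
  rewrite /measurable/= /preimage/=; congr (_ _).
  by apply/seteqP; split => t /=; rewrite mxE.
by rewrite -[X in measurable X]setTI; exact: measurable_tnth.
Qed.

Lemma measurable_halfspaces (n : nat) (a : 'I_n -> V) (b : 'I_n -> R) :
  measurable [set x : V | forall k, \sum_(i < d) a k 0 i * x 0 i < b k].
Proof.
have -> : [set x : V | forall k, \sum_(i < d) a k 0 i * x 0 i < b k] =
    \bigcap_(k in [set: 'I_n]) [set x : V | \sum_(i < d) a k 0 i * x 0 i < b k].
  by apply/seteqP; split => [x h k _|x h k]; exact: h.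
apply: fin_bigcap_measurable => // k _.
have mf : measurable_fun setT (fun x : V => \sum_(i < d) a k 0 i * x 0 i).
  by apply: measurable_sum => i; apply: measurable_funM => //; exact: measurable_coord.
have := mf measurableT `]-oo, b k[%classic (measurable_itv _).
by rewrite setTI; congr measurable; apply/seteqP; split => x /=; rewrite in_itv.
Qed.

Let cell (n : nat) (x : V) : 'rV[int]_d := \row_i Num.floor (n.+1%:R * x 0 i).
Let corner (n : nat) (z : 'rV[int]_d) : V := \row_i (n.+1%:R^-1 * (z 0 i)%:~R).

Let measurable_cell n (B : set 'rV[int]_d) : measurable (cell n @^-1` B).
Proof.
have -> : cell n @^-1` B = \bigcup_z (cell n @^-1` ([set z] `&` B)).
  by apply/seteqP; split => [x Bx|x [z _ [_ Bz]]] //; exists (cell n x).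
apply: countable_bigcupT_measurable => [|z]; first exact: countableP.
have [Bz|nBz] := pselect (B z); last first.
  rewrite (_ : _ @^-1` _ = set0)//; apply/seteqP; split => // x /= [zE].
  by rewrite -zE in nBz; move: (nBz); rewrite zE.
have -> : [set z] `&` B = [set z] by apply/setIidPl => _ ->.
have -> : cell n @^-1` [set z] = \bigcap_(i in [set: 'I_d])
    [set x | n.+1%:R * x 0 i \in `[(z 0 i)%:~R, ((z 0 i) + 1)%:~R[].
  apply/seteqP; split => [x /= <- i _|x xz] /=.
    by rewrite in_itv/= !mxE floor_itv.
  apply/rowP => i; rewrite !mxE; apply/floor_def.
  by have := xz i Logic.I; rewrite /= in_itv.
apply: fin_bigcap_measurable => // i _.
rewrite -[X in measurable X]setTI.
have mf : measurable_fun setT (fun x : V => n.+1%:R * x 0 i).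
  by apply: measurable_funM => //; exact: measurable_coord.
exact: mf measurableT _ (measurable_itv _).
Qed.

(** The sigma-algebra comes from the coordinates, so [g] is approximated by its values at lower
    corners of a grid of mesh [1 / n.+1]. Each approximation takes countably many values on
    measurable cells. *)
Lemma continuous_measurable_row (g : V -> R) : continuous g -> measurable_fun setT g.
Proof.
move=> cg; apply: (@measurable_fun_cvg _ _ _ _ (fun n x => g (corner n (cell n x)))).
  move=> n _ Y mY; rewrite setTI.
  rewrite (_ : _ @^-1` Y = cell n @^-1` [set z | Y (g (corner n z))])//.
move=> x _; apply: (cvg_comp (fun n => corner n (cell n x)) g); last exact: cg.
apply/cvg_ballP => e e0; near=> n.
split=> // i j; rewrite (ord1 i) /ball/= !mxE.
have /andP[fl fr] := floor_itv (n.+1%:R * x 0 j).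
have n0 : (0 : R) < n.+1%:R by [].
have ne : n.+1%:R^-1 < e by near: n; exact: near_infty_natSinv_lt (PosNum e0).
apply: le_lt_trans ne.
rewrite -(ler_pM2l n0) mulfV ?gt_eqF// -{1}(ger0_norm (ltW n0)) -normrM mulrBr.
rewrite mulrA mulfV ?gt_eqF// mul1r ger0_norm ?subr_ge0//.
by move: fr; rewrite intrD; lra.
Unshelve. all: by end_near.
Qed.

End row_measurability.

(** * Finite measure of bounded sets *)

Section box_measure.
Context {R : realType}.
Local Notation RR := (measurableTypeR R).

Definition tuple_box (n : nat) (M : R) : set (n.-tuple RR) :=
  [set t | forall i, `|tnth t i| <= M].

Lemma measurable_tuple_box n M : measurable (@tuple_box n M).
Proof.
have -> : @tuple_box n M = \bigcap_(i in [set: 'I_n])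
    ((fun t : n.-tuple RR => tnth t i) @^-1` `[- M, M]).
  apply/seteqP; split => [t tM i _|t tM i] /=.
    by rewrite in_itv/= -ler_norml.
  by have := tM i Logic.I; rewrite /= in_itv/= -ler_norml.
apply: fin_bigcap_measurable => // i _.
rewrite -[X in measurable X]setTI.
by apply: measurable_tnth => //; exact: measurable_itv.
Qed.

Lemma lebesgue_tuple_box_lty n M : (lebesgue_tuple R n (@tuple_box n M) < +oo)%E.
Proof.
elim: n => [|n ih] /=; first by rewrite diracE ltry.
rewrite /lebesgue_tuple_succ /pushforward.
have -> : @tcons R n @^-1` (@tuple_box n.+1 M) = `[- M, M] `*` @tuple_box n M.
  apply/seteqP; split => [[x t] /= h|[x t] /= [xM h] i].
    split; first by have := h ord0; rewrite /tcons (tnth_nth 0)/= in_itv/= -ler_norml.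
    by move=> i; have := h (lift ord0 i); rewrite /tcons !(tnth_nth 0).
  rewrite /tcons (tnth_nth 0)/=; case: (unliftP ord0 i) => [j ->|->]/=.
    by have := h j; rewrite (tnth_nth 0).
  by move: xM; rewrite in_itv/= -ler_norml.
rewrite product_measure1E//; last exact: measurable_tuple_box.
apply: lte_mul_pinfty => //.
  have : (@lebesgue_measure R `[(- M)%R, M]) \is a fin_num.
    by rewrite lebesgue_measure_itv/=; case: ifP; rewrite ?ltry// -EFinB.
  by [].
Qed.

Lemma lebesgue_row_box_lty d (M : R) (A : set 'rV[R]_d) : measurable A ->
  (forall x i, A x -> `|x 0 i| <= M) -> (lebesgue_row A < +oo)%E.
Proof.
move=> mA AM; apply: le_lt_trans (lebesgue_tuple_box_lty d M).
apply: (@le_measure _ _ _ (lebesgue_tuple R d)); rewrite ?inE//; first exact: measurable_tuple_box.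
by move=> t At i; have := AM _ i At; rewrite mxE.
Qed.

End box_measure.

(** * Poincare inequality on a line *)

Section poincare_line.
Context {R : realType}.
Local Notation mu := (@lebesgue_measure R).

(* Integrating (x h^2)' = h^2 + 2 x h h' >= h^2 / 2 - 2 x^2 h'^2. *)
Lemma poincare_line (M : R) (h h' : R -> R) : 0 < M ->
  (forall x, is_derive x (1 : R) h (h' x)) -> continuous h' ->
  (forall x, M <= `|x| -> h x = 0) ->
  (\int[mu]_x (h x ^+ 2)%:E <= (4 * M ^+ 2)%:E * \int[mu]_x (h' x ^+ 2)%:E)%E.
Proof.
move=> M0 dh ch' h0.
have ch : continuous h.
  move=> x; apply: differentiable_continuous; apply/derivable1_diffP.
  exact: @ex_derive _ _ _ _ _ _ _ (dh x).
have -> : (\int[mu]_x (h x ^+ 2)%:E = \int[mu]_(x in `[(- M)%R, M]) (h x ^+ 2)%:E)%E.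
  rewrite [RHS]integral_mkcond; apply: eq_integral => x _.
  rewrite patchE mem_setE in_itv/= -ler_norml; case: ifPn => //.
  by rewrite -ltNge => /ltW /h0 ->; rewrite expr0n.
pose F x := x * (h x * h x).
pose F' x := h x ^+ 2 + x * (2 * h x * h' x).
have dF x : is_derive x (1 : R) F (F' x).
  have D : is_derive x (1 : R) F _ := is_deriveM (is_derive_id x (1:R)) (is_deriveM (dh x) (dh x)).
  apply: (is_derive_eq D); rewrite /F' (_ : (h * h) x = h x * h x)//.
  by rewrite /GRing.scale/=; ring.
have csq (k : R -> R) : continuous k -> continuous (fun x => k x ^+ 2).
  by move=> ck x; exact: (continuous_comp (ck x) (@exprn_continuous R 2 (k x))).
have ch2 := csq _ ch; have ch'2 := csq _ ch'.
have cF' : continuous F'.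
  move=> x; rewrite /F'; apply: cvgD; first exact: ch2.
  apply: cvgM; first exact: cvg_id.
  by apply: cvgM; [apply: cvgMr; exact: ch|exact: ch'].
have i1 (k : R -> R) : continuous k -> mu.-integrable `[- M, M] (EFin \o k).
  move=> ck; apply: continuous_compact_integrable; first exact: segment_compact.
  exact: continuous_subspaceT.
have FTC : (\int[mu]_(x in `[(- M)%R, M]) (F' x)%:E = 0)%E.
  rewrite (@continuous_FTC2 _ F' F)//.
  - rewrite /F !h0 ?mulr0 ?sube0//.
    + by rewrite normrN ger0_norm// ltW.
    + by rewrite ger0_norm// ltW.
  - by move: M0; lra.
  - exact: continuous_subspaceT.
  - have cF x : {for x, continuous F}.
      apply: differentiable_continuous; apply/derivable1_diffP.
      exact: @ex_derive _ _ _ _ _ _ _ (dF x).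
    split.
    + by move=> x _; exact: @ex_derive _ _ _ _ _ _ _ (dF x).
    + by apply: cvg_at_right_filter; exact: cF.
    + by apply: cvg_at_left_filter; exact: cF.
  - by move=> x _; rewrite derive1E; exact: @derive_val _ _ _ _ _ _ _ (dF x).
(* The pointwise bound completes a square: [2 F' + 4 x^2 h'^2 - h^2 = (h + 2 x h')^2]. *)
apply: (@le_trans _ _ (\int[mu]_(x in `[(- M)%R, M])
    (2%:E * (F' x)%:E + (4 * M ^+ 2)%:E * (h' x ^+ 2)%:E))%E).
  apply: le_integral => //.
  - exact: i1.
  - apply: integrableD => //; apply: integrableZl => //; exact: i1.
  move=> x; rewrite inE/= in_itv/= => /andP[Mx xM]; rewrite -!EFinM -EFinD lee_fin /F'.
  have xx : x ^+ 2 <= M ^+ 2.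
    rewrite -(real_normK (num_real x)) lerXn2r ?nnegrE ?(ltW M0)//.
    by rewrite ler_norml Mx.
  have := sqr_ge0 (h x + 2 * x * h' x); have := sqr_ge0 (h' x).
  rewrite -subr_ge0 in xx => h'0; have := mulr_ge0 xx h'0.
  by move: (h x) (h' x) => y z; lra.
rewrite integralD//; last 2 first.
- by apply: integrableZl => //; exact: i1.
- by apply: integrableZl => //; exact: i1.
rewrite !integralZl//; last 2 first.
- exact: i1.
- exact: i1.
rewrite FTC mule0 add0e; apply: lee_wpmul2l.
  by rewrite lee_fin; apply: mulr_ge0 => //; exact: sqr_ge0.
apply: ge0_subset_integral => //.
- by apply/measurable_EFinP; exact: continuous_measurable_fun.
- by move=> x _; rewrite lee_fin sqr_ge0.
Qed.

End poincare_line.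

(** * Poincare inequality for test functions, by slicing along the first coordinate *)

Section poincare.
Context {R : realType} {n : nat}.
Local Notation V := 'rV[R]_n.+1.
Local Notation RR := (measurableTypeR R).
Local Notation mu := (@lebesgue_row R n.+1).
Implicit Types (g k : V -> R).

Definition slice (t : n.-tuple RR) (x : R) : V := row_of_tuple (tcons (x, t)).

Lemma sliceE t x : slice t x = x *: delta_mx 0 ord0 + slice t 0.
Proof.
apply/rowP => i; rewrite !mxE !(tnth_nth 0)/=.
by case: (unliftP ord0 i) => [j ->|->]/=; rewrite ?mulr0 ?add0r// mulr1 addr0.
Qed.

Lemma is_derive_slice g t x : differentiable g (slice t x) ->
  is_derive x (1 : R) (fun y => g (slice t y)) (partial ord0 g (slice t x)).
Proof.
move=> dg.
have E : (fun h : R => h^-1 *: (((fun y => g (slice t y)) \o shift x) (h *: 1) - g (slice t x))) =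
  (fun h => h^-1 *: ((g \o shift (slice t x)) (h *: delta_mx 0 ord0) - g (slice t x))).
  apply/funext => h /=; congr (_ *: (g _ - _)).
  by rewrite sliceE [in RHS]sliceE addrA -scalerDl /GRing.scale/= mulr1.
split; last by rewrite /partial /derive E.
by rewrite /derivable E; exact: diff_derivable.
Qed.

Lemma measurable_slice k : continuous k ->
  measurable_fun setT (fun p : RR * n.-tuple RR => (k (slice p.2 p.1) ^+ 2)%:E).
Proof.
move=> ck; apply/measurable_EFinP/measurable_funX.
have := measurableT_comp (continuous_measurable_row ck) (measurableT_comp
  (@measurable_row_of_tuple R n.+1) (@measurable_tcons R n)).
by congr measurable_fun; apply/funext => -[].
Qed.

Lemma integral_slice (Om : set V) k : measurable Om -> continuous k ->
  (forall x, ~ Om x -> k x = 0) ->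
  (\int[mu]_(x in Om) (k x ^+ 2)%:E =
   \int[lebesgue_tuple R n]_t \int[@lebesgue_measure R]_x (k (slice t x) ^+ 2)%:E)%E.
Proof.
move=> mOm ck k0.
have mk : measurable_fun setT (fun x : V => (k x ^+ 2)%:E).
  by apply/measurable_EFinP/measurable_funX; exact: continuous_measurable_row.
have k2 x : (0 <= (k x ^+ 2)%:E)%E by rewrite lee_fin sqr_ge0.
have -> : (\int[mu]_(x in Om) (k x ^+ 2)%:E = \int[mu]_x (k x ^+ 2)%:E)%E.
  rewrite integral_mkcond; apply: eq_integral => x _; rewrite patchE.
  by case: ifPn => // /negP; rewrite inE => /k0 ->; rewrite expr0n.
rewrite (ge0_integral_pushforward (@measurable_row_of_tuple R n.+1))//.
rewrite preimage_setT.
have mkt : measurable_fun setT ((fun x : V => (k x ^+ 2)%:E) \o (@row_of_tuple R n.+1)).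
  exact: measurableT_comp (@measurable_row_of_tuple R n.+1).
rewrite (ge0_integral_pushforward (@measurable_tcons R n))//; last by move=> t _; exact: k2.
rewrite preimage_setT.
transitivity (\int[@lebesgue_measure R \x lebesgue_tuple R n]_p (k (slice p.2 p.1) ^+ 2)%:E)%E.
  by apply: eq_integral => -[x t] _.
by rewrite fubini_tonelli2//; exact: measurable_slice.
Qed.

Lemma bounded_coord (Om : set V) : bounded_set Om ->
  exists2 M : R, 0 < M & forall x i, Om x -> `|x 0 i| <= M.
Proof.
move=> [M [_ HM]]; exists (`|M| + 1); first by rewrite ltr_wpDl.
move=> x i Omx; have M1 : M < `|M| + 1 by rewrite (le_lt_trans (ler_norm M))// ltrDl.
apply: le_trans (HM _ M1 x Omx); rewrite [leRHS]mx_normrE.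
exact: (le_bigmax _ (fun ij => `|x ij.1 ij.2|) (0, i)).
Qed.

Lemma continuous_vanishing_L2 (Om K : set V) k : measurable Om -> bounded_set Om ->
  compact K -> K `<=` Om -> continuous k -> (forall x, ~ K x -> k x = 0) -> L2 Om k.
Proof.
move=> mOm bOm cK KOm ck k0.
have mk : measurable_fun setT k by exact: continuous_measurable_row.
split; first exact: measurable_funTS.
have [M M0 OmM] := bounded_coord bOm.
have [C [_ HC]] := compact_bounded (continuous_compact (continuous_subspaceT ck) cK).
pose C1 := `|C| + 1.
have kC x : `|k x| <= C1.
  have [Kx|nKx] := pselect (K x); last by rewrite k0// normr0 addr_ge0.
  apply: (HC C1); last by exists x.
  by rewrite (le_lt_trans (ler_norm C))// ltrDl.
apply: (@le_lt_trans _ _ (\int[mu]_(x in Om) (C1 ^+ 2)%:E)%E).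
  apply: ge0_le_integral => //.
  - by move=> x _; rewrite lee_fin sqr_ge0.
  - by apply/measurable_EFinP/measurable_funTS; exact: measurable_funX.
  - move=> x _; rewrite lee_fin -(real_normK (num_real (k x))).
    by rewrite lerXn2r ?nnegrE// addr_ge0.
rewrite integral_cst// lte_mul_pinfty ?lee_fin ?sqr_ge0//.
exact: lebesgue_row_box_lty OmM.
Qed.

Lemma test_partial (Om : set V) g (i : 'I_n.+1) : test_function Om g ->
  continuous g /\ continuous (partial i g) /\
  exists K, [/\ compact K, K `<=` Om, forall x, ~ K x -> g x = 0 &
    forall x, ~ K x -> partial i g x = 0].
Proof.
move=> [sg [K [cK KOm g0]]]; split; first by move=> x; apply: differentiable_continuous; exact: sg [::] x.
split; first by move=> x; apply: differentiable_continuous; exact: sg [:: i] x.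
exists K; split => // x nKx.
rewrite /partial (@near_eq_derive _ _ _ g (cst 0)) ?derive_cst//.
have oK : open (~` K) by apply: closed_openC; apply: compact_closed => //.
by apply: filterS (open_nbhs_nbhs (conj oK nKx)) => y /g0.
Qed.

Lemma poincare_test (Om : set V) : measurable Om -> bounded_set Om ->
  exists2 C : R, 0 < C & forall g, test_function Om g ->
    [/\ L2 Om g, L2 Om (partial ord0 g) &
        L2norm Om g <= C * L2norm Om (partial ord0 g)].
Proof.
(* Coordinates in [Om] may reach [M]; with [M + 1] the condition [M1 <= |x|] does place the point
   outside [Om]. *)
move=> mOm bOm; have [M M0 OmM] := bounded_coord bOm; pose M1 := M + 1.
have M10 : 0 < M1 by rewrite addr_gt0.
exists (2 * M1); first by rewrite mulr_gt0.
move=> g tg; have [cg [cpg [K [cK KOm g0 pg0]]]] := test_partial ord0 tg.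
have Lg : L2 Om g := continuous_vanishing_L2 mOm bOm cK KOm cg g0.
have Lpg : L2 Om (partial ord0 g) := continuous_vanishing_L2 mOm bOm cK KOm cpg pg0.
have gOm x : ~ Om x -> g x = 0 by move=> h; apply: g0 => /KOm.
have pgOm x : ~ Om x -> partial ord0 g x = 0 by move=> h; apply: pg0 => /KOm.
split => //.
have main : (\int[mu]_(x in Om) (g x ^+ 2)%:E <=
    (4 * M1 ^+ 2)%:E * \int[mu]_(x in Om) (partial ord0 g x ^+ 2)%:E)%E.
  rewrite !integral_slice//.
  have mk k : continuous k -> measurable_fun setT
      (fun t => \int[@lebesgue_measure R]_x (k (slice t x) ^+ 2)%:E)%E.
    move=> ck; apply: (measurable_fun_fubini_tonelli_G (m1 := @lebesgue_measure R) _ (measurable_slice ck)).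
    by move=> p; rewrite lee_fin sqr_ge0.
  rewrite -ge0_integralZl//; last 3 first.
  - exact: mk.
  - by move=> t _; apply: integral_ge0 => x _; rewrite lee_fin sqr_ge0.
  - by rewrite lee_fin mulr_ge0 ?sqr_ge0.
  apply: ge0_le_integral => //.
  - by move=> t _; apply: integral_ge0 => x _; rewrite lee_fin sqr_ge0.
  - exact: mk.
  - by apply: measurable_funeM; exact: mk.
  move=> t _; apply: (@poincare_line _ M1 (fun x => g (slice t x))) => //.
  - by move=> x; apply: is_derive_slice; case: tg => sg _; exact: sg [::] _.
  - move=> x; apply: differentiable_continuous; apply/derivable1_diffP.
    apply: (@ex_derive _ _ _ _ _ _ _ (@is_derive_slice (partial ord0 g) t x _)).
    by case: tg => sg _; exact: sg [:: ord0] _.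
  - move=> x Mx; apply: gOm => Omx; have := OmM _ ord0 Omx.
    by rewrite mxE (tnth_nth 0)/= => xM; move: Mx xM; rewrite /M1; lra.
have fin k : L2 Om k -> (\int[mu]_(x in Om) (k x ^+ 2)%:E = (L2norm Om k ^+ 2)%:E)%E.
  move=> [_ ik]; rewrite L2norm_sqr /L2ip /Rintegral.
  under [in RHS]eq_integral do rewrite -expr2.
  rewrite fineK// ge0_fin_numE//.
  by apply: integral_ge0 => x _; rewrite lee_fin sqr_ge0.
move: main; rewrite !fin// -EFinM lee_fin => main.
rewrite -(@ler_pXn2r _ 2)// ?nnegrE ?mulr_ge0 ?L2norm_ge0 ?(ltW M10)//.
by rewrite (le_trans main)// !exprMn -natrX.
Qed.

End poincare.

(** * Positive lower bound on the eigenvalues *)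

Section spectral_gap.
Context {R : realType} {d : nat} (Om : set 'rV[R]_d).
Variables (lam : nat -> R) (phi : nat -> 'rV[R]_d -> R).
Hypotheses (d_ge1 : (1 <= d)%N) (Om_dom : convex_polygonal_domain Om)
  (eig : dirichlet_eigenbasis Om lam phi).

Lemma measurable_domain : measurable Om.
Proof. by have [_ _ [n [a [b ->]]]] := Om_dom; exact: measurable_halfspaces. Qed.

Lemma poincare_H10 : exists2 C : R, 0 < C & exists i : 'I_d,
  forall v G, H10 Om v G -> L2norm Om v <= C * L2norm Om (G i).
Proof.
have mOm := measurable_domain; have [_ bOm _] := Om_dom.
case: d d_ge1 Om mOm bOm => // n _ Om' mOm bOm.
have [C C0 hC] := poincare_test mOm bOm.
exists C => //; exists ord0 => v G [Lv LG [g [tg gv gG]]].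
(* Each term of this sequence bounds the norm of [v], by two triangle inequalities around
   [poincare_test], and its limit is the desired right-hand side. *)
have cv : L2norm Om' (g n0 \- v) + C * (L2norm Om' (partial ord0 (g n0) \- G ord0) +
    L2norm Om' (G ord0)) @[n0 --> \oo] --> 0 + C * (0 + L2norm Om' (G ord0)).
  apply: cvgD => //; apply: cvgMr; apply: cvgD; [exact: gG|exact: cvg_cst].
rewrite !add0r in cv; apply: (cvgr_to_ge cv); apply: nearW => m.
have [Lg Lpg gle] := hC _ (tg m).
have tri u w : L2 Om' u -> L2 Om' w -> L2norm Om' w <= L2norm Om' (u \- w) + L2norm Om' u.
  move=> Lu Lw; rewrite -(L2normN _ (u \- w)).
  apply: le_trans (L2norm_triangle mOm _ Lu); last first.
    have := L2Z mOm (-1) (L2B mOm Lu Lw).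
    by congr L2; apply/funext => x; rewrite mulN1r.
  rewrite le_eqVlt; apply/orP; left; apply/eqP; congr L2norm.
  by apply/funext => x /=; rewrite opprB subrK.
apply: le_trans (tri _ _ Lg Lv) _; rewrite lerD2l (le_trans gle)// ler_pM2l//.
apply: le_trans (L2norm_triangle mOm (L2B mOm Lpg (LG ord0)) (LG ord0)).
rewrite le_eqVlt; apply/orP; left; apply/eqP; congr L2norm.
by apply/funext => x /=; rewrite subrK.
Qed.

(** Testing the weak eigenvalue equation with the normalized [phi j] itself writes [lam j] as its
    Dirichlet energy; a single direction already contributes at least [C ^- 2]. *)
Lemma spectral_gap : exists2 lmin : R, 0 < lmin & forall j, lmin <= lam j.
Proof.
have mOm := measurable_domain.
have [C C0 [i hC]] := poincare_H10.
exists (C ^- 2); first by rewrite invr_gt0 exprn_gt0.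
move=> j; have [ob dl] := eig.
have Lphi := basis_L2 ob j.
have [_ [G HG /(_ _ _ HG)]] := dl j.
rewrite L2ipZl// (basis_ip ob) eqxx mulr1 => <-.
have : L2norm Om (phi j) <= C * L2norm Om (G i) := hC _ _ HG.
rewrite -(@ler_pXn2r _ 2) ?nnegrE ?mulr_ge0 ?L2norm_ge0 ?(ltW C0)//.
rewrite exprMn !L2norm_sqr (basis_ip ob) eqxx => h.
rewrite -ler_pdivrMl ?exprn_gt0// mulr1 in h.
apply: (le_trans h); rewrite (bigD1 i)//= lerDl.
by apply: sumr_ge0 => k _; exact: L2ip_ge0.
Qed.

End spectral_gap.

(** * Stability of the nonlinear solution operator *)

Section eigenvalue_estimates.
Context {R : realType}.
Variables alpha mu lmin : R.
Hypotheses (alpha_gt0 : 0 < alpha) (alpha_lt1 : alpha < 1) (mu_gt0 : 0 < mu)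
  (mu_le1 : mu <= 1) (lmin_gt0 : 0 < lmin).
Local Notation ml := (mittag_leffler alpha).
Implicit Types l t x p : R.

(** The exponent for which [(l * t ^ alpha) ^ (mu / 2) = l ^ (mu / 2) * t ^ beta]: the price in time
    of passing from dot H^(-mu) to L^2. *)
Definition smoothing_exponent := alpha * mu / 2.
Local Notation beta := smoothing_exponent.

Lemma smoothing_exponent_gt0 : 0 < beta.
Proof. by rewrite divr_gt0// mulr_gt0. Qed.

Lemma smoothing_exponent_lt : beta < alpha.
Proof.
rewrite /smoothing_exponent -mulrA -[ltRHS]mulr1 ltr_pM2l//.
by rewrite ltr_pdivrMr// mul1r (le_lt_trans mu_le1)// ltr1n.
Qed.

Lemma smoothing_exponent_lt1 : beta < 1.
Proof. exact: lt_trans smoothing_exponent_lt alpha_lt1. Qed.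

Lemma powR_le1D x p : 0 < x -> 0 <= p -> p <= 1 -> x `^ p <= 1 + x.
Proof.
move=> x0 p0 p1; have [x1|x1] := leP x 1.
  rewrite (@le_trans _ _ 1)// ?lerDl ?(ltW x0)//.
  by rewrite -(powRr0 x); apply: ger_powR => //; rewrite x0.
rewrite (@le_trans _ _ x)// ?lerDr//.
by rewrite -[leRHS]powRr1 ?(ltW x0)// ler_powR// ltW.
Qed.

(** A bound for [(1 + x) / (1 + x / Gamma (alpha + 1))], which lies between 1 and
    [Gamma (alpha + 1)]. *)
Definition decay_constant : R := 1 + Gamma (alpha + 1).
Local Notation A := decay_constant.

Let G1 : 0 < Gamma (alpha + 1).
Proof. by apply: Gamma_gt0; rewrite addr_gt0. Qed.

Lemma decay_constant_gt0 : 0 < A.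
Proof. by rewrite addr_gt0. Qed.

Lemma ml1_gt0 x : 0 < x -> 0 < ml 1 (- x).
Proof.
move=> x0; apply: lt_le_trans (mittag_leffler_lb alpha_gt0 alpha_lt1 x0).
have G0 : 0 < Gamma (1 - alpha) by apply: Gamma_gt0; rewrite subr_gt0.
rewrite invr_gt0; exact: (addr_gt0 ltr01 (mulr_gt0 G0 x0)).
Qed.

Lemma powR_ml1_ub x p : 0 < x -> 0 <= p -> p <= 1 -> x `^ p * ml 1 (- x) <= A.
Proof.
move=> x0 p0 p1.
have d0 : 0 < 1 + x / Gamma (alpha + 1) by rewrite addr_gt0// divr_gt0.
apply: (@le_trans _ _ ((1 + x) * (1 + x / Gamma (alpha + 1))^-1)).
  apply: ler_pM; rewrite ?powR_ge0 ?(ltW (ml1_gt0 _))// ?powR_le1D//.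
  exact: mittag_leffler_ub.
rewrite ler_pdivrMr// /decay_constant; move: (Gamma _) G1 => G G0.
have -> : (1 + G) * (1 + x / G) = 1 + x + G + x / G by field; rewrite gt_eqF.
by rewrite -addrA lerDl addr_ge0// ?divr_ge0// ltW.
Qed.

Lemma ml1_le1 x : 0 < x -> ml 1 (- x) <= 1.
Proof.
move=> x0; apply: (le_trans (mittag_leffler_ub alpha_gt0 alpha_lt1 x0)).
rewrite invf_le1 ?lerDl ?addr_gt0 ?divr_gt0//.
by rewrite divr_ge0// ltW.
Qed.

Lemma initial_smoothing l t : 0 < l -> 0 < t ->
  l `^ (mu / 2) * ml 1 (- l * t `^ alpha) <= A * t `^ (- beta).
Proof.
move=> l0 t0; have ta0 : 0 < t `^ alpha by rewrite powR_gt0.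
have tb0 : 0 < t `^ beta by rewrite powR_gt0.
rewrite powRN ler_pdivlMr// mulNr.
have -> : l `^ (mu / 2) * ml 1 (- (l * t `^ alpha)) * t `^ beta =
    (l * t `^ alpha) `^ (mu / 2) * ml 1 (- (l * t `^ alpha)).
  rewrite powRM ?(ltW l0) ?(ltW ta0)// -powRrM mulrAC; congr (_ * _ `^ _ * _).
  by rewrite /smoothing_exponent mulrA.
apply: powR_ml1_ub; first exact: mulr_gt0.
  by rewrite divr_ge0// ltW.
by rewrite ler_pdivrMr// mul1r (le_trans mu_le1)// ler1n.
Qed.

(** The literal form found in [Eop]; for [t > 0] it agrees with [mlker alpha l alpha t]. *)
Definition duhamel_kernel l t := t `^ (alpha - 1) * ml alpha (- l * t `^ alpha).

Lemma duhamel_kernel_ge0 l t : 0 < l -> 0 < t -> 0 <= duhamel_kernel l t.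
Proof.
move=> l0 t0; rewrite mulr_ge0 ?powR_ge0// mulNr.
by apply: mittag_leffler_alpha_ge0 => //; rewrite mulr_gt0// powR_gt0.
Qed.

Lemma duhamel_kernel_le l t : 0 < l -> 0 < t ->
  duhamel_kernel l t <= gker alpha t * ml 1 (- l * t `^ alpha).
Proof.
move=> l0 t0.
have h := mittag_leffler_alpha_ub alpha_gt0 alpha_lt1 (mulr_gt0 l0 (powR_gt0 alpha t0)).
rewrite /duhamel_kernel (gkerE _ t0) -mulrA mulNr.
apply: ler_wpM2l; first exact: powR_ge0.
by rewrite [leRHS]mulrC.
Qed.

Lemma duhamel_kernel_le_gker l t : 0 < l -> 0 < t ->
  duhamel_kernel l t <= gker alpha t.
Proof.
move=> l0 t0; apply: le_trans (duhamel_kernel_le l0 t0) _.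
by rewrite ler_piMr ?gker_ge0// mulNr ml1_le1// mulr_gt0// powR_gt0.
Qed.

Lemma inv_ml1_ub l t : 0 < l -> 0 < t ->
  (ml 1 (- l * t `^ alpha))^-1 <= 1 + Gamma (1 - alpha) * t `^ alpha * l.
Proof.
move=> l0 t0; have x0 : 0 < l * t `^ alpha by rewrite mulr_gt0// powR_gt0.
have G0 : 0 < Gamma (1 - alpha) by rewrite Gamma_gt0// subr_gt0.
rewrite mulNr invf_ple ?posrE ?ml1_gt0 ?addr_gt0 ?mulr_gt0 ?powR_gt0//.
apply: le_trans (mittag_leffler_lb alpha_gt0 alpha_lt1 x0).
by rewrite -mulrA (mulrC l).
Qed.

Lemma powR_half_split l : 0 < l -> l `^ (- (mu / 2)) * l = l `^ (1 - mu / 2).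
Proof.
move=> l0; rewrite -{2}(@powRr1 _ l) ?(ltW l0)// -powRD ?(gt_eqF l0) ?implybT//.
by rewrite addrC.
Qed.

Lemma inverse_smoothing l T : lmin <= l -> 0 < T ->
  (ml 1 (- l * T `^ alpha))^-1 * l `^ (- (mu / 2)) <=
  (lmin^-1 + Gamma (1 - alpha) * T `^ alpha) * l `^ (1 - mu / 2).
Proof.
move=> ll T0; have l0 := lt_le_trans lmin_gt0 ll.
apply: (@le_trans _ _ ((1 + Gamma (1 - alpha) * T `^ alpha * l) * l `^ (- (mu / 2)))).
  by rewrite ler_wpM2r ?powR_ge0// inv_ml1_ub.
rewrite mulrDl mul1r mulrDl lerD//; last by rewrite -mulrA (mulrC l) powR_half_split.
rewrite -powR_half_split// mulrCA ler_peMr ?powR_ge0//.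
by rewrite mulrC ler_pdivlMr// mul1r.
Qed.

(** The two summands come from the terms 1 and [C * l] of the inverse bound [inv_ml1_ub]; the Gamma
    quotient arises in writing [gker alpha s] as a multiple of
    [s ^ (alpha - beta) * gker beta s]. *)
Definition duhamel_constant : R :=
  (lmin `^ (- (mu / 2)) + Gamma (1 - alpha) * A) * (Gamma beta / Gamma alpha).

Lemma duhamel_constant_gt0 : 0 < duhamel_constant.
Proof.
have G0 : 0 < Gamma (1 - alpha) by apply: Gamma_gt0; rewrite subr_gt0.
apply: mulr_gt0; last exact: divr_gt0 (Gamma_gt0 smoothing_exponent_gt0) (Gamma_gt0 alpha_gt0).
apply: addr_gt0; first exact: powR_gt0.
exact: mulr_gt0 G0 decay_constant_gt0.
Qed.

Lemma duhamel_smoothing l s T : lmin <= l -> 0 < s -> s <= T -> T <= 1 ->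
  (ml 1 (- l * T `^ alpha))^-1 * l `^ (- (mu / 2)) * duhamel_kernel l s <=
  duhamel_constant * T `^ (alpha - beta) * gker beta s.
Proof.
move=> ll s0 sT T1; have l0 := lt_le_trans lmin_gt0 ll.
have T0 := lt_le_trans s0 sT.
have ab0 : 0 <= alpha - beta by rewrite subr_ge0 ltW// smoothing_exponent_lt.
have Ga := Gamma_gt0 alpha_gt0; have Gb := Gamma_gt0 smoothing_exponent_gt0.
have G0 : 0 < Gamma (1 - alpha) by rewrite Gamma_gt0// subr_gt0.
have sa0 : 0 < s `^ alpha by rewrite powR_gt0.
apply: (@le_trans _ _ ((1 + Gamma (1 - alpha) * T `^ alpha * l) * l `^ (- (mu / 2)) *
    duhamel_kernel l s)).
  by rewrite ler_wpM2r ?duhamel_kernel_ge0// ler_wpM2r ?powR_ge0// inv_ml1_ub.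
rewrite mulrDl mul1r -mulrA (mulrC l) powR_half_split// mulrDl.
have gab : gker alpha s = s `^ (alpha - beta) * (Gamma beta / Gamma alpha * gker beta s).
  rewrite !gkerE// [RHS]mulrCA.
  have -> : s `^ (alpha - 1) = s `^ (alpha - beta) * s `^ (beta - 1).
    rewrite -powRD ?(gt_eqF s0) ?implybT//; congr (_ `^ _); ring.
  move: (s `^ _) (s `^ _) (Gamma beta) (Gamma alpha) Ga Gb => u v g h h0 g0.
  by field; rewrite !gt_eqF.
have sab : s `^ (alpha - beta) <= T `^ (alpha - beta) by apply: ler_powRl => //; exact: ltW.
have gg : 0 <= Gamma beta / Gamma alpha * gker beta s.
  apply: mulr_ge0; last exact: gker_ge0 smoothing_exponent_gt0.
  exact: (divr_ge0 (ltW Gb) (ltW Ga)).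
have -> : duhamel_constant * T `^ (alpha - beta) * gker beta s =
    lmin `^ (- (mu / 2)) * (T `^ (alpha - beta) * (Gamma beta / Gamma alpha * gker beta s)) +
    Gamma (1 - alpha) * T `^ (alpha - beta) * (A * (Gamma beta / Gamma alpha * gker beta s)).
  rewrite /duhamel_constant; move: (Gamma beta / Gamma alpha) (gker _ _) (Gamma _) A => u v w z; ring.
apply: lerD.
  apply: ler_pM; rewrite ?powR_ge0 ?duhamel_kernel_ge0//.
    rewrite !powRN lef_pV2 ?posrE ?powR_gt0//.
    by apply: ler_powRl => //; [rewrite divr_ge0// ltW|exact: ltW].
  apply: le_trans (duhamel_kernel_le_gker l0 s0) _.
  by rewrite gab ler_wpM2r.
rewrite -mulrA; apply: ler_pM.
- exact: (mulr_ge0 (ltW G0) (powR_ge0 _ _)).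
- by rewrite mulr_ge0 ?powR_ge0 ?duhamel_kernel_ge0.
(* [T <= 1] weakens [T ^ alpha] to [T ^ (alpha - beta)], the factor carried by the other summand. *)
- rewrite ler_wpM2l ?(ltW G0)//; apply: ger_powR; rewrite ?T0//.
  by rewrite lerBlDr lerDl ltW// smoothing_exponent_gt0.
apply: (@le_trans _ _ (l `^ (1 - mu / 2) * (gker alpha s * ml 1 (- l * s `^ alpha)))).
  by apply: ler_wpM2l; [exact: powR_ge0|exact: duhamel_kernel_le].
(* The factor [s ^ (alpha - beta)] split off [gker alpha] is what completes [l ^ (1 - mu / 2)] to a
   power of [l * s ^ alpha], giving a bound uniform in [l]. *)
have -> : l `^ (1 - mu / 2) * (gker alpha s * ml 1 (- l * s `^ alpha)) =
   (l * s `^ alpha) `^ (1 - mu / 2) * ml 1 (- (l * s `^ alpha)) *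
   (Gamma beta / Gamma alpha * gker beta s).
  rewrite gab.
  rewrite powRM ?(ltW l0) ?(ltW sa0)// -powRrM mulNr.
  have -> : alpha * (1 - mu / 2) = alpha - beta by rewrite /smoothing_exponent; ring.
  by move: (s `^ _) (_ * gker _ _) (ml _ _) (l `^ _) => a b c e; ring.
apply: (ler_wpM2r gg); apply: powR_ml1_ub.
- exact: mulr_gt0.
- by rewrite subr_ge0 ler_pdivrMr// mul1r (le_trans mu_le1)// ler1n.
- by rewrite lerBlDr lerDl divr_ge0// ltW.
Qed.

End eigenvalue_estimates.

(** * Cauchy-Schwarz and Minkowski inequalities for finitely many modes *)

Section finite_l2.
Context {R : realType}.
Implicit Types (a b : nat -> R) (A B : R).

Lemma sum_cauchy_schwarz n a b A B : 0 <= A -> 0 <= B ->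
  \sum_(j < n) a j ^+ 2 <= A ^+ 2 -> \sum_(j < n) b j ^+ 2 <= B ^+ 2 ->
  \sum_(j < n) `|a j| * `|b j| <= A * B.
Proof.
move=> A0 B0 aA bB.
have zero (c : nat -> R) : \sum_(j < n) c j ^+ 2 <= 0 -> forall j : 'I_n, c j = 0.
  move=> h j; apply/eqP; rewrite -sqrf_eq0; apply/eqP/le_anti.
  rewrite sqr_ge0 andbT; apply: le_trans h; rewrite (bigD1 j)//= lerDl.
  by apply: sumr_ge0 => k _; exact: sqr_ge0.
have [A00|An0] := eqVneq A 0.
  rewrite A00 expr0n/= in aA.
  by rewrite A00 mul0r big1// => j _; rewrite (zero _ aA) normr0 mul0r.
have [B00|Bn0] := eqVneq B 0.
  rewrite B00 expr0n/= in bB.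
  by rewrite B00 mulr0 big1// => j _; rewrite (zero _ bB) normr0 mulr0.
have Ap : 0 < A by rewrite lt_neqAle eq_sym An0.
have Bp : 0 < B by rewrite lt_neqAle eq_sym Bn0.
(* Young's inequality, weighted so that each of the two sums contributes at most [A * B / 2]. *)
apply: (@le_trans _ _ (\sum_(j < n) (B / (2 * A) * a j ^+ 2 + A / (2 * B) * b j ^+ 2))).
  apply: ler_sum => j _; rewrite -(real_normK (num_real (a j))) -(real_normK (num_real (b j))).
  move: `|a j| `|b j| => x y; rewrite -subr_ge0.
  have -> : B / (2 * A) * x ^+ 2 + A / (2 * B) * y ^+ 2 - x * y =
     (B * x - A * y) ^+ 2 / (2 * A * B) by field; rewrite !gt_eqF.
  by rewrite divr_ge0 ?sqr_ge0// !mulr_ge0.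
rewrite big_split/= -!mulr_sumr.
have -> : A * B = B / (2 * A) * A ^+ 2 + A / (2 * B) * B ^+ 2 by field; rewrite !gt_eqF.
by apply: lerD; rewrite ler_wpM2l// divr_ge0// mulr_ge0.
Qed.

Lemma sum_sqr_triangle n a b A B : 0 <= A -> 0 <= B ->
  \sum_(j < n) a j ^+ 2 <= A ^+ 2 -> \sum_(j < n) b j ^+ 2 <= B ^+ 2 ->
  \sum_(j < n) (a j + b j) ^+ 2 <= (A + B) ^+ 2.
Proof.
move=> A0 B0 aA bB.
apply: (@le_trans _ _ (\sum_(j < n) (a j ^+ 2 + 2 * (`|a j| * `|b j|) + b j ^+ 2))).
  apply: ler_sum => j _; rewrite sqrrD lerD2r lerD2l -mulr_natl ler_wpM2l//.
  by rewrite -normrM ler_norm.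
rewrite !big_split/= -mulr_sumr.
have := sum_cauchy_schwarz A0 B0 aA bB.
by rewrite !expr2 in aA bB *; lra.
Qed.

Lemma integrable_scale d (X : measurableType d) (m : {measure set X -> \bar R})
    (D : set X) (q : X -> R) (r : R) :
  measurable D -> m.-integrable D (EFin \o q) ->
  m.-integrable D (EFin \o (fun s => r * q s)).
Proof. by move=> mD iq; apply: eq_integrable (integrableZl mD r iq). Qed.

(** Minkowski's integral inequality, by duality: with [c] the vector of integrals and [N] its norm,
    [N ^ 2] is the integral of [\sum c j * h j s], at most that of [N * k s * G s] by
    Cauchy-Schwarz. *)
Lemma sum_sqr_Rintegral d (X : measurableType d) (m : {measure set X -> \bar R})
    (D : set X) n (h : nat -> X -> R) (k G : X -> R) (g : nat -> X -> R) :
  measurable D -> (forall j, m.-integrable D (EFin \o h j)) ->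
  m.-integrable D (EFin \o (fun s => k s * G s)) ->
  (forall s, D s -> 0 <= k s) -> (forall s, D s -> 0 <= G s) ->
  (forall j s, D s -> `|h j s| <= k s * `|g j s|) ->
  (forall s, D s -> \sum_(j < n) g j s ^+ 2 <= G s ^+ 2) ->
  \sum_(j < n) (\int[m]_(s in D) h j s) ^+ 2 <= (\int[m]_(s in D) (k s * G s)) ^+ 2.
Proof.
move=> mD ih ikG k0 G0 hk gG.
pose c j := \int[m]_(s in D) h j s.
pose N := Num.sqrt (\sum_(j < n) c j ^+ 2).
have S0 : 0 <= \sum_(j < n) c j ^+ 2 by apply: sumr_ge0 => j _; exact: sqr_ge0.
have NE : N ^+ 2 = \sum_(j < n) c j ^+ 2 by rewrite sqr_sqrtr.
have N0 : 0 <= N by exact: sqrtr_ge0.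
have I0 : 0 <= \int[m]_(s in D) (k s * G s).
  by apply: Rintegral_ge0 => s Ds; rewrite mulr_ge0 ?k0 ?G0.
suff : N <= \int[m]_(s in D) (k s * G s).
  by rewrite -/c -NE => h1; rewrite lerXn2r ?nnegrE.
have [->//|Nn0] := eqVneq N 0.
have Np : 0 < N by rewrite lt_neqAle eq_sym Nn0.
rewrite -(ler_pM2l Np) -expr2 NE -RintegralZl//.
have isum p : m.-integrable D (EFin \o (fun s => \sum_(j < p) c j * h j s)).
  elim: p => [|p ih'].
    apply: eq_integrable (integrable0 m D) => // s _ /=; by rewrite big_ord0.
  apply: eq_integrable (integrableD mD ih' (integrableZl mD (c p) (ih p))) => // s _ /=.
  by rewrite big_ord_recr/= EFinD EFinM.
have Esum p : \sum_(j < p) c j ^+ 2 = \int[m]_(s in D) (\sum_(j < p) c j * h j s).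
  elim: p => [|p ihp].
    rewrite big_ord0; under eq_Rintegral do rewrite big_ord0.
    by rewrite /Rintegral integral0.
  rewrite big_ord_recr/= ihp expr2 {2}/c -RintegralZl// -RintegralD//.
    by apply: eq_Rintegral => s _; rewrite big_ord_recr.
  exact: integrable_scale.
rewrite Esum; apply: le_Rintegral => //.
  exact: integrable_scale.
move=> s Ds.
apply: (@le_trans _ _ (k s * \sum_(j < n) `|c j| * `|g j s|)).
  rewrite mulr_sumr; apply: ler_sum => j _.
  rewrite (le_trans (ler_norm _))// normrM mulrCA ler_wpM2l//.
  exact: hk.
rewrite mulrCA ler_wpM2l ?k0//.
by apply: (@sum_cauchy_schwarz _ c (fun j => g j s)); rewrite ?NE ?G0//; exact: gG.
Qed.

End finite_l2.

(** * A Gronwall inequality with weakly singular kernels on a short interval *)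

Section singular_gronwall.
Context {R : realType}.
Local Notation leb := (@lebesgue_measure R).
Variables (alpha beta T L c : R) (G : R -> R).
Hypotheses (alpha_gt0 : 0 < alpha) (beta_gt0 : 0 < beta) (beta_lt1 : beta < 1)
  (T_gt0 : 0 < T) (L_ge0 : 0 <= L) (c_ge0 : 0 <= c).
Hypothesis mG : measurable_fun `]0, T[ G.
Hypothesis G_ge0 : forall s, s \in `]0, T[ -> 0 <= G s.
Hypothesis iGT : leb.-integrable `]0, T[ (EFin \o (fun s => gker beta (T - s) * G s)).
Hypothesis iG : forall t, t \in `]0, T[ ->
  leb.-integrable `]0, t[ (EFin \o (fun s => gker alpha (t - s) * G s)).
Hypothesis G_le : forall t, t \in `]0, T[ ->
  G t <= c * t `^ (- beta) + L * \int[leb]_(s in `]0, t[) (gker alpha (t - s) * G s).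
Hypothesis small : L * (Gamma beta / Gamma (alpha + beta) * T `^ alpha) <= 2^-1.

(** Extension by 0 turns integrals over (0, t) into whole-line convolutions, to which Tonelli and
    [conv_gker] apply. *)
Let Gx : R -> R := G \_ `]0, T[.

Let GxE s : s \in `]0, T[ -> Gx s = G s.
Proof. by move=> sT; rewrite /Gx patchE mem_setE sT. Qed.

Let Gx0 s : s \notin `]0, T[ -> Gx s = 0.
Proof. by move=> /negbTE sT; rewrite /Gx patchE mem_setE sT. Qed.

Let Gx_ge0 s : 0 <= Gx s.
Proof.
by have [sT|sT] := boolP (s \in `]0, T[); [rewrite GxE// G_ge0|rewrite Gx0].
Qed.

Let mGx : measurable_fun setT Gx.
Proof. by apply/(measurable_restrictT G). Qed.

Let integral_kerGx a t : t <= T -> 0 < a ->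
  leb.-integrable `]0, t[ (EFin \o (fun s => gker a (t - s) * G s)) ->
  (\int[leb]_s (gker a (t - s) * Gx s)%:E =
   (\int[leb]_(s in `]0, t[) (gker a (t - s) * G s))%:E)%E.
Proof.
move=> tT a0 iK; rewrite /Rintegral fineK; last exact: integrable_fin_num.
rewrite [RHS]integral_mkcond; apply: eq_integral => s _.
rewrite patchE mem_setE in_itv/=; case: ifPn => [/andP[s0 st]|].
  by rewrite GxE// in_itv/= s0 (lt_le_trans st).
rewrite negb_and -!leNgt => /orP[s0|ts].
  by rewrite Gx0 ?mulr0// in_itv/= ltNge s0.
by rewrite gker_eq0 ?mul0r// subr_le0.
Qed.

Let mker a t : measurable_fun setT (fun s : R => gker a (t - s)).
Proof. by apply: measurableT_comp; [exact: measurable_gker|exact: measurable_funB]. Qed.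

Let mkerGx a t : measurable_fun setT (fun s : R => (gker a (t - s) * Gx s)%:E).
Proof. by apply/measurable_EFinP/measurable_funM. Qed.

Let kerGx_ge0 a t s : 0 < a -> (0 <= (gker a (t - s) * Gx s)%:E)%E.
Proof. by move=> a0; rewrite lee_fin mulr_ge0// gker_ge0. Qed.

Let Gx_le t : ((Gx t)%:E <= (c * Gamma (1 - beta) * gker (1 - beta) t)%:E +
  L%:E * \int[leb]_s (gker alpha (t - s) * Gx s)%:E)%E.
Proof.
have b1 : 0 < 1 - beta by rewrite subr_gt0.
have Gb := Gamma_gt0 b1.
have [tT|tT] := boolP (t \in `]0, T[); last first.
  rewrite Gx0//; apply: adde_ge0.
    by rewrite lee_fin; exact: (mulr_ge0 (mulr_ge0 c_ge0 (ltW Gb)) (gker_ge0 t b1)).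
  apply: mule_ge0; first by rewrite lee_fin.
  by apply: integral_ge0 => s _; exact: kerGx_ge0.
have := tT; rewrite in_itv/= => /andP[t0 tT'].
rewrite integral_kerGx ?(ltW tT')//; last exact: iG.
rewrite GxE// -EFinM -EFinD lee_fin.
(* The forcing term is a multiple of [gker (1 - beta)], whose convolution with [gker beta] at [T] is
   [gker 1 T = 1]. *)
have -> : c * Gamma (1 - beta) * gker (1 - beta) t = c * t `^ (- beta).
  rewrite gkerE// -mulrA [X in c * X]mulrC divfK ?(lt0r_neq0 Gb)//.
  by congr (c * _ `^ _); ring.
exact: G_le.
Qed.

Let conv_shift r :
  (\int[leb]_t (gker beta (T - t) * gker alpha (t - r))%:E = (gker (beta + alpha) (T - r))%:E)%E.
Proof.
rewrite (@ge0_integral_affine _ 1 r).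
- rewrite normr1 mul1e -conv_gker//; apply: eq_integral => s _.
  by congr (gker _ _ * gker _ _)%:E; ring.
- exact: oner_neq0.
- apply/measurable_EFinP/measurable_funM; first exact: mker.
  by apply: measurableT_comp; [exact: measurable_gker|exact: measurable_funB].
- by move=> s; rewrite lee_fin mulr_ge0// gker_ge0.
Qed.

(* Integrating the hypothesis against gker beta (T - .) turns its convolution
   term into gker (alpha + beta) (T - .) * G, which is at most
   Gamma beta / Gamma (alpha + beta) * T ^ alpha times gker beta (T - .) * G
   and is absorbed by the left-hand side. *)
Lemma singular_gronwall :
  \int[leb]_(s in `]0, T[) (gker beta (T - s) * G s) <= 2 * (c * Gamma (1 - beta)).
Proof.
have b1 : 0 < 1 - beta by rewrite subr_gt0.
have Gb1 := Gamma_gt0 b1.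
have ab0 : 0 < alpha + beta by rewrite addr_gt0.
have [Gb Gab] := (Gamma_gt0 beta_gt0, Gamma_gt0 ab0).
set Phi := \int[leb]_(s in _) _.
have PhiE := integral_kerGx (lexx T) beta_gt0 iGT; rewrite -/Phi in PhiE.
pose k := Gamma beta / Gamma (alpha + beta) * T `^ alpha.
have small' : L * k <= 2^-1 := small.
have k0 : 0 <= k := mulr_ge0 (divr_ge0 (ltW Gb) (ltW Gab)) (powR_ge0 _ _).
pose f (p : R * R) := (gker beta (T - p.1) * gker alpha (p.1 - p.2) * Gx p.2)%:E.
have mf : measurable_fun setT f.
  apply/measurable_EFinP/measurable_funM.
    apply: measurable_funM; apply: measurableT_comp; do ?exact: measurable_gker.
      exact: measurable_funB.
    exact: measurable_funB.
  exact: measurableT_comp.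
have f0 p : (0 <= f p)%E by rewrite lee_fin !mulr_ge0// gker_ge0.
have conv2 : (\int[leb]_t ((gker beta (T - t))%:E *
    \int[leb]_s (gker alpha (t - s) * Gx s)%:E) <= (k * Phi)%:E)%E.
  have -> : (\int[leb]_t ((gker beta (T - t))%:E * \int[leb]_s (gker alpha (t - s) * Gx s)%:E) =
      \int[leb]_t \int[leb]_s f (t, s))%E.
    apply: eq_integral => t _; rewrite -ge0_integralZl//; last 3 first.
    - exact: mkerGx.
    - by move=> s _; exact: kerGx_ge0.
    - by rewrite lee_fin gker_ge0.
    by apply: eq_integral => s _; rewrite /f/= -EFinM mulrA.
  rewrite fubini_tonelli//.
  have -> : (\int[leb]_y \int[leb]_x f (x, y) =
      \int[leb]_s ((gker (beta + alpha) (T - s))%:E * (Gx s)%:E))%E.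
    apply: eq_integral => s _; rewrite -conv_shift -ge0_integralZr//.
    - apply/measurable_EFinP/measurable_funM; first exact: mker.
      by apply: measurableT_comp; [exact: measurable_gker|exact: measurable_funB].
    - by move=> t _; rewrite lee_fin mulr_ge0// gker_ge0.
    - by rewrite lee_fin.
  rewrite EFinM -PhiE -ge0_integralZl//; last 2 first.
  - exact: mkerGx.
  - by move=> s _; exact: kerGx_ge0.
  apply: ge0_le_integral => //.
  - by move=> s _; rewrite -EFinM lee_fin mulr_ge0// gker_ge0// addr_gt0.
  - exact: (mkerGx (beta + alpha) T).
  - by apply: measurable_funeM; exact: mkerGx.
  move=> s _; rewrite -!EFinM lee_fin mulrA.
  have [sT|sT] := boolP (s \in `]0, T[); last by rewrite Gx0// !mulr0.
  rewrite ler_wpM2r//; move: sT; rewrite in_itv/= => /andP[s0 sT].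
  have Ts : 0 < T - s by rewrite subr_gt0.
  rewrite !gkerE// /k (addrC beta).
  have -> : (T - s) `^ (alpha + beta - 1) = (T - s) `^ alpha * (T - s) `^ (beta - 1).
    by rewrite -powRD ?(gt_eqF Ts) ?implybT//; congr (_ `^ _); ring.
  have h : (T - s) `^ alpha <= T `^ alpha.
    by apply: ler_powRl; [exact: ltW|exact: ltW|rewrite lerBlDr lerDl ltW].
  have p0 := powR_ge0 (T - s) (beta - 1).
  move: (_ `^ (beta - 1)) p0 ((T - s) `^ alpha) (T `^ alpha) h => p p0 x y xy.
  have -> : Gamma beta / Gamma (alpha + beta) * y * (p / Gamma beta) = y * p / Gamma (alpha + beta).
    by move: (Gamma beta) (Gamma _) Gb Gab => u v u0 v0; field; rewrite !gt_eqF.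
  apply: ler_wpM2r; first by rewrite invr_ge0; exact: (ltW Gab).
  exact: ler_wpM2r.
have mI : measurable_fun setT (fun t : R => \int[leb]_s (gker alpha (t - s) * Gx s)%:E)%E.
  apply: (measurable_fun_fubini_tonelli_F (m2 := leb)
    (fun p : R * R => (gker alpha (p.1 - p.2) * Gx p.2)%:E)).
    apply/measurable_EFinP/measurable_funM; apply: measurableT_comp => //.
      exact: measurable_gker.
    exact: measurable_funB.
  by move=> p; exact: kerGx_ge0.
have I0 t : (0 <= \int[leb]_s (gker alpha (t - s) * Gx s)%:E)%E.
  by apply: integral_ge0 => s _; exact: kerGx_ge0.
have gb t : (0 <= (gker beta (T - t))%:E)%E by rewrite lee_fin gker_ge0.
pose p1 (t : R) := ((c * Gamma (1 - beta))%:E * (gker beta (T - t) * gker (1 - beta) t)%:E)%E.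
pose p2 (t : R) := (L%:E * ((gker beta (T - t))%:E * \int[leb]_s (gker alpha (t - s) * Gx s)%:E))%E.
have mgg : measurable_fun setT (fun t : R => (gker beta (T - t) * gker (1 - beta) t)%:E).
  by apply/measurable_EFinP/measurable_funM => //; exact: measurable_gker.
have mgI : measurable_fun setT
    (fun t : R => (gker beta (T - t))%:E * \int[leb]_s (gker alpha (t - s) * Gx s)%:E)%E.
  by apply: emeasurable_funM => //; exact/measurable_EFinP.
have cG0 : 0 <= c * Gamma (1 - beta) := mulr_ge0 c_ge0 (ltW Gb1).
have gg0 t : (0 <= (gker beta (T - t) * gker (1 - beta) t)%:E)%E.
  by rewrite lee_fin mulr_ge0// gker_ge0.
have p10 t : (0 <= p1 t)%E by apply: mule_ge0 => //; rewrite lee_fin.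
have p20 t : (0 <= p2 t)%E.
  by apply: mule_ge0; [rewrite lee_fin|exact: mule_ge0].
have mp1 : measurable_fun setT p1 by exact: measurable_funeM.
have mp2 : measurable_fun setT p2 by exact: measurable_funeM.
have : (Phi%:E <= (c * Gamma (1 - beta) + L * (k * Phi))%:E)%E.
  rewrite -PhiE.
  apply: (@le_trans _ _ (\int[leb]_t (p1 t + p2 t))%E).
    apply: ge0_le_integral => //.
    - by move=> s _; exact: kerGx_ge0.
    - exact: mkerGx.
    - exact: emeasurable_funD.
    move=> t _; rewrite EFinM.
    apply: le_trans (lee_wpmul2l (gb t) (Gx_le t)) _.
    rewrite ge0_muleDr; first 1 last.
    - by rewrite lee_fin; exact: (mulr_ge0 cG0 (gker_ge0 t b1)).
    - by apply: mule_ge0 => //; rewrite lee_fin.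
    rewrite /p1 /p2 [X in (_ <= _ + X)%E]muleCA leeD2r// -!EFinM lee_fin.
    by rewrite mulrCA.
  rewrite ge0_integralD// EFinD; apply: leeD.
    rewrite ge0_integralZl ?lee_fin// conv_gker//.
    have -> : beta + (1 - beta) = 1 by ring.
    by rewrite gker1E// mule1.
  rewrite ge0_integralZl ?lee_fin//; last by move=> t _; exact: mule_ge0.
  by rewrite EFinM lee_wpmul2l// lee_fin.
have Phi0 : 0 <= Phi by apply: Rintegral_ge0 => s sT; rewrite mulr_ge0 ?gker_ge0 ?G_ge0.
(* [Phi] is a finite integral by [iGT], so the term [L * k * Phi <= Phi / 2] can be absorbed. *)
rewrite lee_fin; have := ler_wpM2r Phi0 small'.
by rewrite -mulrA; move: (c * _) (L * (k * Phi)) => x y; lra.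
Qed.

End singular_gronwall.

(** * Continuous curves in L^2 and their singular integrals *)

Section L2_curves.
Context {R : realType} {d : nat} (Om : set 'rV[R]_d).
Hypothesis mOm : measurable Om.
Variable T : R.
Local Notation leb := (@lebesgue_measure R).
Local Notation fn := ('rV[R]_d -> R).
Implicit Types (U V : R -> fn) (w : fn).

Lemma within_continuous_dist (A : set R) (h : R -> R) (r : R -> R -> R) (c : R) :
  (forall t t0, A t -> A t0 -> `|h t - h t0| <= c * r t0 t) ->
  (forall t0, A t0 -> r t0 t @[t --> within A (nbhs t0)] --> (0 : R)) ->
  {within A, continuous h}.
Proof.
move=> hr r0; apply/subspace_continuousP => t0 At0.
apply/cvgrPdist_lt => e e0.
have cr : c * r t0 t @[t --> within A (nbhs t0)] --> c * 0.
  by apply: cvgMr; exact: r0.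
rewrite mulr0 in cr; move/cvgrPdist_lt : cr => /(_ e e0) near_r.
near=> t; rewrite distrC; apply: le_lt_trans (hr _ _ _ At0) _.
  by near: t; exact: withinT.
have : `|0 - c * r t0 t| < e by near: t.
by rewrite sub0r normrN; exact: le_lt_trans (ler_norm _).
Unshelve. all: by end_near.
Qed.

(** The interval is open at 0, where the L^2 norm may blow up since the initial value is only in dot
    H^(-mu). *)
Definition L2_curve V :=
  (forall t, t \in `]0, T] -> L2 Om (V t)) /\
  forall t0, t0 \in `]0, T] ->
    L2norm Om (V t \- V t0) @[t --> within `]0, T] (nbhs t0)] --> (0 : R).

Lemma L2norm_dist v w : L2 Om v -> L2 Om w ->
  `|L2norm Om v - L2norm Om w| <= L2norm Om (v \- w).
Proof.
have tri u z : L2 Om u -> L2 Om z -> L2norm Om u - L2norm Om z <= L2norm Om (u \- z).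
  move=> Lu Lz; rewrite lerBlDr.
  apply: le_trans (L2norm_triangle mOm (L2B mOm Lu Lz) Lz).
  rewrite le_eqVlt; apply/orP; left; apply/eqP; congr L2norm.
  by apply/funext => x /=; rewrite subrK.
move=> Lv Lw; rewrite ler_norml tri// andbT lerNl opprB L2norm_distC.
exact: tri.
Qed.

Lemma L2_curve_norm V : L2_curve V ->
  {within `]0, T], continuous (fun t => L2norm Om (V t))}.
Proof.
move=> [LV cV]; apply: (@within_continuous_dist _ _ (fun t0 t => L2norm Om (V t \- V t0)) 1).
  by move=> t t0 tT t0T; rewrite mul1r; apply: L2norm_dist; exact: LV.
exact: cV.
Qed.

Lemma L2_curve_ip V w : L2_curve V -> L2 Om w ->
  {within `]0, T], continuous (fun t => L2ip Om (V t) w)}.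
Proof.
move=> [LV cV] Lw.
apply: (@within_continuous_dist _ _ (fun t0 t => L2norm Om (V t \- V t0)) (L2norm Om w)).
  move=> t t0 tT t0T; rewrite -L2ipBl//; try exact: LV.
  by rewrite mulrC; apply: L2_cauchy_schwarz => //; apply: L2B; try exact: LV.
exact: cV.
Qed.

Lemma L2_lipschitz (f : R -> R) (L : R) w : 0 <= L ->
  (forall x y, `|f x - f y| <= L * `|x - y|) -> f 0 = 0 -> L2 Om w -> L2 Om (f \o w).
Proof.
move=> L0 fL f0 Lw; have [mw _] := Lw.
have cf : continuous f.
  apply/continuous_subspace_setT; apply: (@within_continuous_dist _ _ (fun t0 t => `|t - t0|) L).
    by move=> t t0 _ _; exact: fL.
  move=> t0 _.
  have h : `|t - t0| @[t --> t0] --> `|t0 - t0|.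
    by apply: cvg_norm; apply: cvgB; [exact: cvg_id|exact: cvg_cst].
  rewrite subrr normr0 in h; exact: cvg_within_filter h.
have mf : measurable_fun Om (f \o w).
  by apply: measurableT_comp => //; exact: continuous_measurable_fun.
split => //.
have [_ h] := L2Z mOm L Lw; apply: le_lt_trans h.
apply: ge0_le_integral => //.
- by move=> x _; rewrite lee_fin sqr_ge0.
- by apply/measurable_EFinP; exact: measurable_funX.
- by apply/measurable_EFinP/measurable_funX; exact: measurable_funM.
move=> x _; rewrite lee_fin -(real_normK (num_real (f (w x)))) -(real_normK (num_real (L * w x))).
rewrite lerXn2r ?nnegrE// normrM (ger0_norm L0).
by have := fL (w x) 0; rewrite f0 !subr0.
Qed.

Lemma L2norm_lipschitz (f : R -> R) (L : R) v w : 0 <= L ->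
  (forall x y, `|f x - f y| <= L * `|x - y|) -> f 0 = 0 -> L2 Om v -> L2 Om w ->
  L2norm Om ((f \o v) \- (f \o w)) <= L * L2norm Om (v \- w).
Proof.
move=> L0 fL f0 Lv Lw; apply: L2norm_le_lin => //.
- by apply: L2B => //; exact: L2_lipschitz fL f0 _.
- exact: L2B.
- by move=> x; exact: fL.
Qed.

Lemma L2_curve_lipschitz (f : R -> R) (L : R) U : 0 <= L ->
  (forall x y, `|f x - f y| <= L * `|x - y|) -> f 0 = 0 ->
  L2_curve U -> L2_curve (fun t => f \o U t).
Proof.
move=> L0 fL f0 [LU cU]; split.
  by move=> t tT; apply: (L2_lipschitz L0 fL f0); exact: LU.
move=> t0 t0T.
have cL : L * L2norm Om (U t \- U t0) @[t --> within `]0, T] (nbhs t0)] --> L * 0.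
  by apply: cvgMr; exact: cU.
rewrite mulr0 in cL.
apply: (squeeze_cvgr _ (cvg_cst 0) cL).
near=> t; rewrite L2norm_ge0/=; apply: L2norm_lipschitz => //; apply: LU => //.
by near: t; exact: withinT.
Unshelve. all: by end_near.
Qed.

Lemma L2_curveB U V : L2_curve U -> L2_curve V -> L2_curve (fun t => U t \- V t).
Proof.
move=> [LU cU] [LV cV]; split.
  by move=> t tT; apply: L2B => //; [exact: LU|exact: LV].
move=> t0 t0T.
have cS := cvgD (cU _ t0T) (cV _ t0T); rewrite addr0 in cS.
apply: (squeeze_cvgr _ (cvg_cst 0) (cS _)).
near=> t.
have tT : t \in `]0, T] by near: t; exact: withinT.
rewrite L2norm_ge0/=.
have LU' : L2 Om (U t \- U t0) by apply: L2B => //; exact: LU.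
have LV' : L2 Om (V t \- V t0) by apply: L2B => //; exact: LV.
rewrite -[X in _ <= _ + X]L2norm_distC.
have LV'' : L2 Om (V t0 \- V t) by apply: L2B => //; exact: LV.
apply: le_trans (L2norm_triangle mOm LU' LV'').
rewrite le_eqVlt; apply/orP; left; apply/eqP; congr L2norm.
by apply/funext => x /=; ring.
Unshelve. all: by end_near.
Qed.

(** The possible singularities, of [N] at 0 and of the kernel at [t], are separated at [t / 2]:
    below it the kernel is at most [gker a (t / 2)], above it [N] is bounded by continuity on a
    compact interval. *)
Lemma kernel_integrable a (N : R -> R) t : 0 < a -> a <= 1 -> t \in `]0, T] ->
  {within `]0, T], continuous N} -> (forall s, 0 <= N s) ->
  leb.-integrable `]0, T[ (EFin \o N) ->
  leb.-integrable `]0, t[ (EFin \o (fun s => gker a (t - s) * N s)).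
Proof.
move=> a0 a1; rewrite in_itv/= => /andP[t0 tT] cN N0 iN.
have t2 : 0 < t / 2 by rewrite divr_gt0.
have [m _ Nm] : exists2 c : R, c \in `[t / 2, t] &
    forall s, s \in `[t / 2, t] -> N s <= N c.
  apply: EVT_max; first lra.
  apply: continuous_subspaceW cN => s /=; rewrite !in_itv/= => /andP[ts st].
  by rewrite (lt_le_trans t2 ts) (le_trans st tT).
have sub : `]0, t[ `<=` `]0, T] by move=> s /=; rewrite !in_itv/= => /andP[-> st] /=; lra.
have sub' : `]0, t[ `<=` `]0, T[ by move=> s /=; rewrite !in_itv/= => /andP[-> st] /=; lra.
have mt : measurable (`]0, t[%classic : set R) by exact: measurable_itv.
have mN : measurable_fun `]0, t[ N.
  apply: (measurable_funS _ sub); first exact: measurable_itv.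
  by apply: subspace_continuous_measurable_fun => //; exact: measurable_itv.
have mk : measurable_fun `]0, t[ (fun s => gker a (t - s)).
  apply: measurable_funTS; apply: measurableT_comp; first exact: measurable_gker.
  exact: measurable_funB.
have ik : leb.-integrable `]0, t[ (EFin \o (fun s => gker a (t - s))).
  have [ig _] := hasint_gker t a0 (@ltr01 R).
  have ig' : leb.-integrable `]0, t[ (fun s => (gker a (t - s) * gker 1 s)%:E).
    by apply: integrableS ig.
  apply: eq_integrable ig' => //.
  by move=> s; rewrite inE/= in_itv/= => /andP[s0 st]; rewrite gker1E// mulr1.
have iN' : leb.-integrable `]0, t[ (EFin \o N).
  by apply: integrableS iN.
apply: (@le_integrable _ _ _ leb _ mt _
  (fun s => ((gker a (t / 2))%:E * (EFin \o N) s + (N m)%:E * (EFin \o (fun s => gker a (t - s))) s)%E)).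
- by apply/measurable_EFinP; exact: measurable_funM.
- move=> s /=; rewrite in_itv/= => /andP[s0 st].
  have g0 u : 0 <= gker a u by exact: gker_ge0.
  rewrite lee_fin ger0_norm ?mulr_ge0// [leRHS]ger0_norm ?addr_ge0 ?mulr_ge0//.
  have [s2|s2] := leP s (t / 2).
    rewrite -[leLHS]addr0 lerD ?mulr_ge0// ler_wpM2r// gker_le//.
    by rewrite lerBrDr; lra.
  rewrite -[leLHS]add0r lerD ?mulr_ge0// mulrC ler_wpM2r// Nm//.
  by rewrite in_itv/= !ltW.
- by apply: integrableD => //; exact: integrableZl.
Qed.

End L2_curves.

(** * Spectral norms through finite sums of coefficients *)

Section spectral_norms.
Context {R : realType} {d : nat} (Om : set 'rV[R]_d).
Variables (lam : nat -> R) (phi : nat -> 'rV[R]_d -> R).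
Local Notation functional := (('rV[R]_d -> R) -> R).
Implicit Types (q B : R) (ell : functional).

Lemma powR_half_sqr (x q : R) : (x `^ (q / 2)) ^+ 2 = x `^ q.
Proof. by rewrite -powR_mulrn ?powR_ge0// -powRrM divfK. Qed.

Lemma weighted_sqr j q c : lam j `^ q * c ^+ 2 = (lam j `^ (q / 2) * c) ^+ 2.
Proof. by rewrite exprMn powR_half_sqr. Qed.

Lemma hterm_ge0 q ell j : (0 <= (lam j `^ q * coef phi ell j ^+ 2)%:E)%E.
Proof. by rewrite lee_fin mulr_ge0 ?powR_ge0 ?sqr_ge0. Qed.

Lemma hnorm2_ge0 q ell : (0 <= hnorm2 lam phi q ell)%E.
Proof. by apply: nneseries_ge0 => j _ _; exact: hterm_ge0. Qed.

Lemma hnorm_ge0 q ell : 0 <= hnorm lam phi q ell.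
Proof. exact: sqrtr_ge0. Qed.

Lemma hnorm2_le q ell B :
  (forall n, \sum_(j < n) (lam j `^ (q / 2) * coef phi ell j) ^+ 2 <= B) ->
  (hnorm2 lam phi q ell <= B%:E)%E.
Proof.
move=> hB; apply: lime_le; first by apply: is_cvg_nneseries => j _ _; exact: hterm_ge0.
apply: nearW => n; rewrite sumEFin lee_fin big_mkord.
by apply: le_trans (hB n); apply: ler_sum => j _; rewrite weighted_sqr.
Qed.

Lemma hnorm_le q ell B : 0 <= B ->
  (forall n, \sum_(j < n) (lam j `^ (q / 2) * coef phi ell j) ^+ 2 <= B ^+ 2) ->
  hnorm lam phi q ell <= B.
Proof.
move=> B0 hB; have h := hnorm2_le hB.
rewrite /hnorm -(ger0_norm B0) -sqrtr_sqr ler_wsqrtr//.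
rewrite -lee_fin fineK//; rewrite ge0_fin_numE ?hnorm2_ge0//.
exact: le_lt_trans h (ltry _).
Qed.

(** Finiteness matters here: [fine] would turn a divergent sum into 0. *)
Lemma hnorm_partial q ell n : (hnorm2 lam phi q ell < +oo)%E ->
  \sum_(j < n) (lam j `^ (q / 2) * coef phi ell j) ^+ 2 <= hnorm lam phi q ell ^+ 2.
Proof.
move=> fin; rewrite sqr_sqrtr; last by rewrite fine_ge0// hnorm2_ge0.
rewrite -lee_fin fineK; last by rewrite ge0_fin_numE// hnorm2_ge0.
apply: (@le_trans _ _ (\sum_(0 <= j < n) (lam j `^ q * coef phi ell j ^+ 2)%:E)%E); last first.
  by apply: nneseries_lim_ge => j _ _; exact: hterm_ge0.
rewrite sumEFin lee_fin big_mkord.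
by apply: ler_sum => j _; rewrite weighted_sqr.
Qed.

Lemma hnorm2B_lty q ell1 ell2 :
  (hnorm2 lam phi q ell1 < +oo)%E -> (hnorm2 lam phi q ell2 < +oo)%E ->
  (hnorm2 lam phi q (ell1 \- ell2)%R < +oo)%E.
Proof.
move=> f1 f2.
apply: (@le_lt_trans _ _ ((hnorm lam phi q ell1 + hnorm lam phi q ell2) ^+ 2)%:E); last exact: ltry.
apply: hnorm2_le => n.
have h2 : \sum_(j < n) (- (lam j `^ (q / 2) * coef phi ell2 j)) ^+ 2 <= hnorm lam phi q ell2 ^+ 2.
  by under eq_bigr do rewrite sqrrN; exact: hnorm_partial.
have := @sum_sqr_triangle _ n (fun j => lam j `^ (q / 2) * coef phi ell1 j)
  (fun j => - (lam j `^ (q / 2) * coef phi ell2 j)) _ _ (hnorm_ge0 _ _) (hnorm_ge0 _ _) (@hnorm_partial q ell1 n f1) h2.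
apply: le_trans; apply: ler_sum => j _.
by rewrite /coef/= mulrBr.
Qed.

(** Makes [phi j] an admissible test element, so that the duality identity of a mild solution yields
    its coefficients. *)
Lemma dotH_basis q j : orthonormal_basis Om phi -> in_dotH Om lam phi q (phi j).
Proof.
move=> ob; split; first exact: basis_L2 ob j.
apply: (@le_lt_trans _ _ (lam j `^ q)%:E); last exact: ltry.
apply: hnorm2_le => n.
have -> : \sum_(k < n) (lam k `^ (q / 2) * coef phi (as_functional Om (phi j)) k) ^+ 2 =
    (j < n)%:R * lam j `^ q.
  elim: n => [|n ih]; first by rewrite big_ord0 mul0r.
  rewrite big_ord_recr/= ih /coef /as_functional (basis_ip ob) [in RHS]ltnS [in RHS]leq_eqVlt.
  have [->|jn] := eqVneq j n.
    by rewrite ltnn mul0r add0r mulr1 powR_half_sqr mul1r.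
  by rewrite mulr0 expr0n addr0.
by case: (j < n)%N; rewrite ?mul1r// mul0r powR_ge0.
Qed.

End spectral_norms.

(** * Stability estimate for two mild solutions *)

Section mild_solutions_stability.
Context {R : realType} {d : nat} (Om : set 'rV[R]_d).
Variables (lam : nat -> R) (phi : nat -> 'rV[R]_d -> R).
Variables alpha mu lmin L : R.
Hypotheses (mOm : measurable Om) (ob : orthonormal_basis Om phi)
  (lmin_gt0 : 0 < lmin) (lam_ge : forall j, lmin <= lam j)
  (alpha_gt0 : 0 < alpha) (alpha_lt1 : alpha < 1)
  (mu_gt0 : 0 < mu) (mu_le1 : mu <= 1) (L_gt0 : 0 < L).
Variable f : R -> R.
Hypotheses (f_lip : forall x y : R, `|f x - f y| <= L * `|x - y|) (f0 : f 0 = 0).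
Variable T : R.
Hypothesis T_gt0 : 0 < T.
Local Notation leb := (@lebesgue_measure R).
Local Notation fn := ('rV[R]_d -> R).
Local Notation functional := (fn -> R).
Local Notation beta := (smoothing_exponent alpha mu).
Local Notation ker := (duhamel_kernel alpha).
Local Notation ml := (mittag_leffler alpha).

Let lam_gt0 j : 0 < lam j. Proof. exact: lt_le_trans (lam_ge j). Qed.

Lemma eq_hnorm2 q (ell1 ell2 : functional) :
  (forall j, coef phi ell1 j = coef phi ell2 j) ->
  hnorm2 lam phi q ell1 = hnorm2 lam phi q ell2.
Proof. by move=> e; apply: eq_eseriesr => j _; rewrite e. Qed.

Lemma L2norm_le_hnorm w (ell : functional) : L2 Om w ->
  (forall j, L2ip Om w (phi j) = coef phi ell j) ->
  (hnorm2 lam phi (2 - mu) ell < +oo)%E ->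
  L2norm Om w <= lmin `^ (- ((2 - mu) / 2)) * hnorm lam phi (2 - mu) ell.
Proof.
move=> Lw cw fin; have h0 := hnorm_ge0 lam phi (2 - mu) ell.
have l0 : 0 <= lmin `^ (- ((2 - mu) / 2)) by exact: powR_ge0.
have q0 : 0 <= (2 - mu) / 2 by rewrite divr_ge0// subr_ge0 (le_trans mu_le1)// ler1n.
rewrite -(@ler_pXn2r _ 2)// ?nnegrE ?mulr_ge0 ?L2norm_ge0// L2norm_sqr.
apply: (parseval_le mOm ob Lw) => n; rewrite exprMn.
apply: (@le_trans _ _ ((lmin `^ (- ((2 - mu) / 2))) ^+ 2 *
    \sum_(j < n) (lam j `^ ((2 - mu) / 2) * coef phi ell j) ^+ 2)); last first.
  by apply: ler_wpM2l; [exact: sqr_ge0|exact: hnorm_partial].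
rewrite mulr_sumr; apply: ler_sum => j _; rewrite cw -exprMn mulrA [leRHS]exprMn.
rewrite ler_peMl ?sqr_ge0// exprn_ege1// powRN mulrC.
rewrite ler_pdivlMr ?powR_gt0// mul1r.
by apply: ler_powRl => //; exact: ltW.
Qed.

(** The mild solution seen as a curve in L^2: continuity is transferred from dot H^(2-mu) by the
    embedding [L2norm_le_hnorm], and the coefficients of [u t] become inner products. *)
Definition mild_data (phi0 : functional) (u : R -> functional) (U : R -> fn) : Prop :=
  [/\ L2_curve Om T U,
      forall t, t \in `]0, T] -> forall j, coef phi (u t) j = L2ip Om (U t) (phi j),
      forall t, t \in `]0, T] -> (hnorm2 lam phi (2 - mu) (u t) < +oo)%E,
      leb.-integrable `]0, T[ (EFin \o (fun s => L2norm Om (f \o U s))) &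
      forall t, t \in `]0, T] -> forall j,
        L2ip Om (U t) (phi j) = ml 1 (- lam j * t `^ alpha) * coef phi phi0 j +
        \int[leb]_(s in `]0, t[) (ker (lam j) (t - s) * L2ip Om (f \o U s) (phi j))].

Lemma mild_solution_data phi0 u : mild_solution Om lam phi alpha mu f T phi0 u ->
  exists U, mild_data phi0 u U.
Proof.
move=> [U [_ _ [Uu cu] iU duh]]; exists U.
have cE t : t \in `]0, T] -> forall j, coef phi (u t) j = L2ip Om (U t) (phi j).
  by move=> tT j; rewrite /coef (Uu _ tT).2//; exact: dotH_basis.
have fin t : t \in `]0, T] -> (hnorm2 lam phi (2 - mu) (u t) < +oo)%E.
  move=> tT; rewrite (@eq_hnorm2 _ _ (as_functional Om (U t))); last first.
    by move=> j; rewrite cE.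
  by have [[_ ?] _] := Uu _ tT.
have LU t : t \in `]0, T] -> L2 Om (U t) by move=> /Uu[[]].
split => //.
- split => // t0 t0T.
  have cl : lmin `^ (- ((2 - mu) / 2)) * hnorm lam phi (2 - mu) (u t \- u t0)
      @[t --> within `]0, T] (nbhs t0)] --> lmin `^ (- ((2 - mu) / 2)) * 0.
    by apply: cvgMr; exact: cu.
  rewrite mulr0 in cl; apply: (squeeze_cvgr _ (cvg_cst 0) cl).
  near=> t; have tT : t \in `]0, T] by near: t; exact: withinT.
  rewrite L2norm_ge0/=; apply: L2norm_le_hnorm.
  + by apply: L2B => //; exact: LU.
  + move=> j; rewrite L2ipBl//; [|exact: LU|exact: LU|exact: basis_L2 ob j].
    by rewrite /coef/= -!cE.
  + by apply: hnorm2B_lty; exact: fin.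
- by move=> t tT j; rewrite -cE// duh.
Unshelve. all: by end_near.
Qed.

Lemma measurable_duhamel_kernel l t D :
  measurable_fun D (fun s : R => ker l (t - s)).
Proof.
apply: measurable_funTS.
have mts : measurable_fun setT (fun s : R => t - s) by exact: measurable_funB.
apply: measurable_funM.
  exact: (measurableT_comp (measurable_powR (alpha - 1)) mts).
apply: measurableT_comp.
  by apply: continuous_measurable_fun; exact: continuous_mittag_leffler.
by apply: measurable_funM => //; exact: (measurableT_comp (measurable_powR alpha) mts).
Qed.

Let subitv t : t \in `]0, T] -> `]0, t[ `<=` `]0, T].
Proof.
by rewrite in_itv/= => /andP[t0 tT] s /=; rewrite !in_itv/= => /andP[-> st] /=; lra.
Qed.

Lemma abs_ip_basis w j : L2 Om w -> `|L2ip Om w (phi j)| <= L2norm Om w.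
Proof.
move=> Lw; rewrite -[leRHS]mulr1.
have -> : 1 = L2norm Om (phi j) by rewrite /L2norm (basis_ip ob) eqxx sqrtr1.
exact: L2_cauchy_schwarz (basis_L2 ob j).
Qed.

Lemma measurable_curve_ip V t j : L2_curve Om T V -> t \in `]0, T] ->
  measurable_fun `]0, t[ (fun s => L2ip Om (V s) (phi j)).
Proof.
move=> cV tT; apply: (measurable_funS _ (subitv tT)); first exact: measurable_itv.
apply: subspace_continuous_measurable_fun; first exact: measurable_itv.
have cc := L2_curve_ip mOm cV (basis_L2 ob j).
exact: cc.
Qed.

Lemma kernel_norm_integrable a V t : 0 < a -> a <= 1 -> L2_curve Om T V ->
  leb.-integrable `]0, T[ (EFin \o (fun s => L2norm Om (V s))) -> t \in `]0, T] ->
  leb.-integrable `]0, t[ (EFin \o (fun s => gker a (t - s) * L2norm Om (V s))).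
Proof.
move=> a0 a1 cV iV tT; apply: kernel_integrable tT _ _ iV => //.
  exact: L2_curve_norm.
by move=> s; exact: L2norm_ge0.
Qed.

Lemma duhamel_integrable V t j : L2_curve Om T V ->
  leb.-integrable `]0, T[ (EFin \o (fun s => L2norm Om (V s))) -> t \in `]0, T] ->
  leb.-integrable `]0, t[
    (EFin \o (fun s => ker (lam j) (t - s) * L2ip Om (V s) (phi j))).
Proof.
move=> cV iV tT.
have iK := kernel_norm_integrable alpha_gt0 (ltW alpha_lt1) cV iV tT.
apply: le_integrable iK => //.
  apply/measurable_EFinP/measurable_funM; first exact: measurable_duhamel_kernel.
  exact: measurable_curve_ip.
move=> s st; have sT := subitv tT st.
move: st; rewrite /= in_itv/= => /andP[s0 st].
have ts : 0 < t - s by rewrite subr_gt0.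
rewrite lee_fin normrM [leRHS]ger0_norm ?mulr_ge0 ?gker_ge0 ?L2norm_ge0//.
rewrite ger0_norm ?duhamel_kernel_ge0// ler_pM ?duhamel_kernel_ge0//.
  exact: duhamel_kernel_le_gker.
by apply: abs_ip_basis; exact: cV.1.
Qed.

Section two_solutions.
Variables (phi1 phi2 : functional) (u1 u2 : R -> functional) (U1 U2 : R -> fn).
Hypotheses (md1 : mild_data phi1 u1 U1) (md2 : mild_data phi2 u2 U2).

Let H t := (f \o U1 t) \- (f \o U2 t).
Let W t := U1 t \- U2 t.
Let delta j := coef phi (phi1 \- phi2) j.
Let cV1 : L2_curve Om T (fun t => f \o U1 t).
Proof. by have [cU _ _ _ _] := md1; exact: L2_curve_lipschitz (ltW L_gt0) f_lip f0 cU. Qed.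
Let cV2 : L2_curve Om T (fun t => f \o U2 t).
Proof. by have [cU _ _ _ _] := md2; exact: L2_curve_lipschitz (ltW L_gt0) f_lip f0 cU. Qed.
Let cH : L2_curve Om T H. Proof. exact: L2_curveB. Qed.

Let T_in : T \in `]0, T]. Proof. by rewrite in_itv/= T_gt0 lexx. Qed.

Let LW t : t \in `]0, T] -> L2 Om (W t).
Proof.
by move=> tT; apply: L2B => //; [have [[h _] _ _ _ _] := md1|have [[h _] _ _ _ _] := md2];
  exact: h.
Qed.

Let iH : leb.-integrable `]0, T[ (EFin \o (fun s => L2norm Om (H s))).
Proof.
have [_ _ _ i1 _] := md1; have [_ _ _ i2 _] := md2.
have mT : measurable (`]0, T[%classic : set R) by exact: measurable_itv.
apply: (@le_integrable _ _ _ leb _ mT _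
  (fun s => (EFin \o (fun s => L2norm Om (f \o U1 s))) s +
            (EFin \o (fun s => L2norm Om (f \o U2 s))) s)%E).
- apply/measurable_EFinP; apply: (measurable_funS _ (subitv T_in)); first exact: measurable_itv.
  apply: subspace_continuous_measurable_fun; first exact: measurable_itv.
  exact: L2_curve_norm.
- move=> s sT; have sT' := subitv T_in sT.
  rewrite lee_fin ger0_norm ?L2norm_ge0// [leRHS]ger0_norm ?addr_ge0 ?L2norm_ge0//.
  have L1 := cV1.1 _ sT'; have L2' := cV2.1 _ sT'.
  rewrite -[X in _ <= _ + X]L2normN.
  have LN : L2 Om (fun x => - (f \o U2 s) x).
    have := L2Z mOm (-1) L2'; congr L2; apply/funext => x; by rewrite mulN1r.
  exact: L2norm_triangle.
- exact: integrableD.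
Qed.

Let duhamelB t j : t \in `]0, T] ->
  L2ip Om (W t) (phi j) = ml 1 (- lam j * t `^ alpha) * delta j +
  \int[leb]_(s in `]0, t[) (ker (lam j) (t - s) * L2ip Om (H s) (phi j)).
Proof.
move=> tT; have Lj := basis_L2 ob j.
have [[LU1 _] _ _ i1 d1] := md1; have [[LU2 _] _ _ i2 d2] := md2.
rewrite L2ipBl//; [|exact: LU1|exact: LU2].
rewrite d1// d2//.
have -> : \int[leb]_(s in `]0, t[) (ker (lam j) (t - s) * L2ip Om (H s) (phi j)) =
  \int[leb]_(s in `]0, t[) (ker (lam j) (t - s) * L2ip Om (f \o U1 s) (phi j)) -
  \int[leb]_(s in `]0, t[) (ker (lam j) (t - s) * L2ip Om (f \o U2 s) (phi j)).
  rewrite -RintegralB//; try exact: duhamel_integrable.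
  apply: eq_Rintegral => s; rewrite inE => st; have sT := subitv tT st.
  by rewrite -mulrBr L2ipBl//; [exact: cV1.1|exact: cV2.1].
rewrite /delta /coef/=.
by move: (Rintegral _ _ _) (Rintegral _ _ _) (ml _ _) => a b c; ring.
Qed.

Let sum_ipH n s : s \in `]0, T] ->
  \sum_(j < n) L2ip Om (H s) (phi j) ^+ 2 <= L2norm Om (H s) ^+ 2.
Proof. by move=> sT; rewrite L2norm_sqr; apply: bessel => //; exact: cH.1. Qed.

Let D := hnorm lam phi (- mu) (phi1 \- phi2).
Hypothesis D_fin : (hnorm2 lam phi (- mu) (phi1 \- phi2)%R < +oo)%E.
Local Notation A := (decay_constant alpha).

Let D_ge0 : 0 <= D. Proof. exact: hnorm_ge0. Qed.
Let A_ge0 : 0 <= A. Proof. exact/ltW/decay_constant_gt0. Qed.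

(** The Lipschitz bound reduces this to the norm of [W t], whose coefficients [duhamelB] splits.
    [initial_smoothing] moves the weight [lam j ^ (- mu / 2)] onto [delta], and the integral part
    follows from [sum_sqr_Rintegral] with Bessel's inequality for [H s]. *)
Let G_le t : t \in `]0, T[ ->
  L2norm Om (H t) <= L * A * D * t `^ (- beta) +
    L * \int[leb]_(s in `]0, t[) (gker alpha (t - s) * L2norm Om (H s)).
Proof.
rewrite in_itv/= => /andP[t0 tT'].
have tT : t \in `]0, T] by rewrite in_itv/= t0 ltW.
have [[LU1 _] _ _ _ _] := md1; have [[LU2 _] _ _ _ _] := md2.
have HW : L2norm Om (H t) <= L * L2norm Om (W t).
  by apply: L2norm_lipschitz => //; [exact: ltW|exact: LU1|exact: LU2].
apply: (le_trans HW); rewrite -!mulrA -mulrDr ler_pM2l//.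
set I := \int[leb]_(s in _) _.
have I0 : 0 <= I.
  by apply: Rintegral_ge0 => s _; rewrite mulr_ge0 ?gker_ge0 ?L2norm_ge0.
have AD0 : 0 <= A * (D * t `^ (- beta)) by rewrite !mulr_ge0 ?powR_ge0.
rewrite -(@ler_pXn2r _ 2)// ?nnegrE ?addr_ge0 ?L2norm_ge0// L2norm_sqr.
apply: (parseval_le mOm ob (LW tT)) => n.
under eq_bigr do rewrite duhamelB//.
apply: (@sum_sqr_triangle _ n (fun j => ml 1 (- lam j * t `^ alpha) * delta j)
  (fun j => \int[leb]_(s in `]0, t[) (ker (lam j) (t - s) * L2ip Om (H s) (phi j)))) => //.
  have := @hnorm_partial _ _ lam phi (- mu) (phi1 \- phi2) n D_fin.
  rewrite -/D => hD.
  have -> : A * (D * t `^ (- beta)) = (A * t `^ (- beta)) * D by ring.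
  rewrite exprMn.
  apply: (le_trans _ (ler_wpM2l (sqr_ge0 _) hD)).
  rewrite mulr_sumr; apply: ler_sum => j _; rewrite -exprMn.
  rewrite -(real_normK (num_real (_ * delta j))) -[leRHS](real_normK (num_real _)).
  rewrite lerXn2r ?nnegrE// mulrA !normrM ler_wpM2r//.
  have x0 : 0 < lam j * t `^ alpha by rewrite mulr_gt0// powR_gt0.
  have m0 : 0 < ml 1 (- lam j * t `^ alpha) by rewrite mulNr; exact: ml1_gt0.
  rewrite (gtr0_norm m0) -normrM ger0_norm ?mulr_ge0 ?powR_ge0//.
  have is1 := initial_smoothing alpha_gt0 alpha_lt1 mu_gt0 mu_le1 (lam_gt0 j) t0.
  rewrite [(- mu) / 2]mulNr (ger0_norm (powR_ge0 _ _)) (powRN (lam j)).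
  rewrite ler_pdivlMr ?powR_gt0//.
  by rewrite mulrC.
apply: (@sum_sqr_Rintegral _ _ _ leb _ n
  (fun j s => ker (lam j) (t - s) * L2ip Om (H s) (phi j)) (fun s => gker alpha (t - s))
  (fun s => L2norm Om (H s)) (fun j s => L2ip Om (H s) (phi j))) => //.
- by move=> j; exact: duhamel_integrable.
- exact: kernel_norm_integrable alpha_gt0 (ltW alpha_lt1) cH iH tT.
- by move=> s _; rewrite gker_ge0.
- by move=> s _; exact: L2norm_ge0.
- move=> j s; rewrite /= in_itv/= => /andP[s0 st].
  have ts : 0 < t - s by rewrite subr_gt0.
  rewrite normrM ger0_norm ?duhamel_kernel_ge0// ler_wpM2r//.
  exact: duhamel_kernel_le_gker.
- by move=> s st; apply: sum_ipH; exact: subitv st.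
Qed.

Hypothesis T_le1 : T <= 1.
(** [small1] closes the Gronwall argument; [small2] leaves at most half of [D] on the right of the
    stability estimate. *)
Hypothesis small1 : L * (Gamma beta / Gamma (alpha + beta) * T `^ alpha) <= 2^-1.
Hypothesis small2 : duhamel_constant alpha mu lmin * T `^ (alpha - beta) *
  (2 * (L * A * Gamma (1 - beta))) <= 2^-1.

Let b0 : 0 < beta. Proof. exact: smoothing_exponent_gt0. Qed.
Let b1 : beta < 1. Proof. exact: smoothing_exponent_lt1. Qed.

Let Phi_le :
  \int[leb]_(s in `]0, T[) (gker beta (T - s) * L2norm Om (H s)) <=
  2 * (L * A * D * Gamma (1 - beta)).
Proof.
apply: (@singular_gronwall _ alpha beta T L (L * A * D) (fun s => L2norm Om (H s))) => //.
- exact: ltW.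
- by rewrite !mulr_ge0// ltW.
- apply: (measurable_funS _ (subitv T_in)); first exact: measurable_itv.
  apply: subspace_continuous_measurable_fun; first exact: measurable_itv.
  exact: L2_curve_norm.
- by move=> s _; exact: L2norm_ge0.
- exact: kernel_norm_integrable b0 (ltW b1) cH iH T_in.
- move=> t; rewrite in_itv/= => /andP[t0 tT].
  apply: kernel_norm_integrable alpha_gt0 (ltW alpha_lt1) cH iH _.
  by rewrite in_itv/= t0 ltW.
Qed.

(** The factor of [inverse_smoothing], doubled by the absorption of [D / 2]. *)
Definition stability_constant : R :=
  2 * (lmin^-1 + Gamma (1 - alpha) * T `^ alpha).

Lemma stability_estimate :
  D <= stability_constant * hnorm lam phi (2 - mu) (u1 T \- u2 T).
Proof.
have [_ c1 fin1 _ _] := md1; have [_ c2 fin2 _ _] := md2.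
have [[LU1 _] _ _ _ _] := md1; have [[LU2 _] _ _ _ _] := md2.
set X := hnorm lam phi (2 - mu) (u1 T \- u2 T).
have X0 : 0 <= X by exact: hnorm_ge0.
have finX := hnorm2B_lty (fin1 _ T_in) (fin2 _ T_in).
have a1 : 0 < 1 - alpha by rewrite subr_gt0.
have Ga := Gamma_gt0 a1.
pose C := lmin^-1 + Gamma (1 - alpha) * T `^ alpha.
have C0 : 0 <= C.
  apply: addr_ge0; first by rewrite invr_ge0 ltW.
  exact: (mulr_ge0 (ltW Ga) (powR_ge0 _ _)).
pose e := duhamel_constant alpha mu lmin * T `^ (alpha - beta).
have e0 : 0 <= e.
  apply: mulr_ge0; last exact: powR_ge0.
  by apply: ltW; exact: duhamel_constant_gt0.
have PhiB := Phi_le.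
set Phi := \int[leb]_(s in `]0, T[) (gker beta (T - s) * L2norm Om (H s)) in PhiB.
have Phi0 : 0 <= Phi.
  by apply: Rintegral_ge0 => s _; rewrite mulr_ge0 ?gker_ge0 ?L2norm_ge0.
have F0 j : 0 < ml 1 (- lam j * T `^ alpha).
  by rewrite mulNr; apply: ml1_gt0 => //; rewrite mulr_gt0// powR_gt0.
have main : D <= C * X + e * Phi.
  apply: hnorm_le; first by rewrite addr_ge0// mulr_ge0.
  move=> n.
  pose p j := (ml 1 (- lam j * T `^ alpha))^-1 * lam j `^ (- (mu / 2)).
  have p0 j : 0 <= p j by rewrite mulr_ge0 ?powR_ge0// invr_ge0 ltW.
  (* Duhamel's formula at [T], solved for the initial difference. The factor [- p j] is put inside
     the integral so that all modes can be estimated together by [sum_sqr_Rintegral]. *)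
  have wE j : lam j `^ (- mu / 2) * coef phi (phi1 \- phi2) j =
      p j * L2ip Om (W T) (phi j) +
      \int[leb]_(s in `]0, T[) (- p j * (ker (lam j) (T - s) * L2ip Om (H s) (phi j))).
    rewrite RintegralZl//; last exact: duhamel_integrable.
    rewrite (mulNr (p j)) -mulrBr duhamelB// addrK /p.
    by rewrite [RHS]mulrA [X in _ = X * _]mulrC mulrA (mulfV (lt0r_neq0 (F0 j))) mul1r (mulNr mu).
  under eq_bigr do rewrite wE.
  apply: (@sum_sqr_triangle _ n (fun j => p j * L2ip Om (W T) (phi j))
    (fun j => \int[leb]_(s in `]0, T[) (- p j * (ker (lam j) (T - s) * L2ip Om (H s) (phi j))))).
  - exact: mulr_ge0.
  - exact: mulr_ge0.
  - have hX := @hnorm_partial _ _ lam phi (2 - mu) (u1 T \- u2 T) n finX.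
    rewrite exprMn; apply: (le_trans _ (ler_wpM2l (sqr_ge0 _) hX)).
    rewrite mulr_sumr; apply: ler_sum => j _; rewrite -exprMn.
    have -> : L2ip Om (W T) (phi j) = coef phi (u1 T \- u2 T) j.
      rewrite L2ipBl//; [|exact: LU1|exact: LU2|exact: basis_L2 ob j].
      by rewrite -c1// -c2.
    rewrite mulrA [leLHS]exprMn [leRHS]exprMn ler_wpM2r ?sqr_ge0//.
    rewrite lerXn2r ?nnegrE ?p0 ?(mulr_ge0 C0 (powR_ge0 _ _))//.
    have -> : (2 - mu) / 2 = 1 - mu / 2 by rewrite mulrBl divff.
    exact: inverse_smoothing.
  - have -> : e * Phi = \int[leb]_(s in `]0, T[) ((e * gker beta (T - s)) * L2norm Om (H s)).
      rewrite /Phi -RintegralZl//.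
        by apply: eq_Rintegral => s _; rewrite mulrA.
      exact: kernel_norm_integrable b0 (ltW b1) cH iH T_in.
    apply: (@sum_sqr_Rintegral _ _ _ leb _ n
      (fun j s => - p j * (ker (lam j) (T - s) * L2ip Om (H s) (phi j)))
      (fun s => e * gker beta (T - s))
      (fun s => L2norm Om (H s)) (fun j s => L2ip Om (H s) (phi j))) => //.
    + move=> j; have iD := duhamel_integrable j cH iH T_in.
      by apply: integrable_scale iD; exact: measurable_itv.
    + under [X in _.-integrable _ (EFin \o X)]eq_fun do rewrite -mulrA.
      apply: integrable_scale; first exact: measurable_itv.
      exact: kernel_norm_integrable b0 (ltW b1) cH iH T_in.
    + by move=> s _; rewrite mulr_ge0// gker_ge0.
    + by move=> s _; exact: L2norm_ge0.
    + move=> j s; rewrite /= in_itv/= => /andP[s0 sT].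
      have Ts : 0 < T - s by rewrite subr_gt0.
      rewrite mulrA normrM ler_wpM2r// normrM normrN (ger0_norm (p0 j)).
      rewrite ger0_norm ?duhamel_kernel_ge0//.
      apply: duhamel_smoothing => //.
      by rewrite lerBlDr lerDl ltW.
    + by move=> s sT; apply: sum_ipH; exact: subitv sT.
have eP : e * Phi <= e * (2 * (L * A * D * Gamma (1 - beta))) by rewrite ler_wpM2l.
have : e * (2 * (L * A * D * Gamma (1 - beta))) <= 2^-1 * D.
  have -> : e * (2 * (L * A * D * Gamma (1 - beta))) = e * (2 * (L * A * Gamma (1 - beta))) * D.
    by rewrite (mulrAC (L * A)) !mulrA.
  exact: ler_wpM2r D_ge0 _ _ small2.
move=> /(le_trans eP) eD.
have DX : D <= C * X + 2^-1 * D by rewrite (le_trans main)// lerD2l.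
rewrite /stability_constant -/C -mulrA.
by move: D (C * X) DX => a b; lra.
Qed.

End two_solutions.
End mild_solutions_stability.

Theorem theorem2p1 (R : realType) (d : nat) (d_ge1 : (1 <= d)%N)
    (Om : set 'rV[R]_d) (Om_dom : convex_polygonal_domain Om)
    (lam : nat -> R) (phi : nat -> 'rV[R]_d -> R)
    (eig : dirichlet_eigenbasis Om lam phi)
    (alpha : R) (alpha_gt0 : 0 < alpha) (alpha_lt1 : alpha < 1)
    (mu : R) (mu_gt0 : 0 < mu) (mu_le1 : mu <= 1)
    (L : R) (L_gt0 : 0 < L) :
  exists2 Tstar : R, 0 < Tstar &
    forall f : R -> R,
      (forall x y : R, `|f x - f y| <= L * `|x - y|) -> f 0 = 0 ->
    forall T : R, 0 < T -> T < Tstar ->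
    exists2 c : R, 0 < c &
      forall phi1 phi2 : ('rV[R]_d -> R) -> R,
        in_dotH_dual Om lam phi mu phi1 ->
        in_dotH_dual Om lam phi mu phi2 ->
      forall w1 w2 : ('rV[R]_d -> R) -> R,
        solution_operator Om lam phi alpha mu f T phi1 w1 ->
        solution_operator Om lam phi alpha mu f T phi2 w2 ->
        hnorm lam phi (- mu) (phi1 \- phi2)
          <= c * hnorm lam phi (2 - mu) (w1 \- w2).
Proof.
have mOm := measurable_domain Om_dom.
have [lmin lmin0 lam_ge] := spectral_gap d_ge1 Om_dom eig.
have [ob _] := eig.
pose beta := smoothing_exponent alpha mu.
have b0 : 0 < beta := smoothing_exponent_gt0 alpha_gt0 mu_gt0.
have ba : beta < alpha := smoothing_exponent_lt alpha_gt0 mu_le1.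
have b1 : 0 < 1 - beta by rewrite subr_gt0 (lt_trans ba).
have [Gb Gab] := (Gamma_gt0 b0, Gamma_gt0 (addr_gt0 alpha_gt0 b0)).
have Gb1 := Gamma_gt0 b1.
(* [K1] and [K2] are the factors of [T ^ alpha] and [T ^ (alpha - beta)] in the two smallness
   conditions of [stability_estimate]. *)
pose K1 := L * (Gamma beta / Gamma (alpha + beta)).
pose K2 := duhamel_constant alpha mu lmin * (2 * (L * decay_constant alpha * Gamma (1 - beta))).
have K10 : 0 < K1 := mulr_gt0 L_gt0 (divr_gt0 Gb Gab).
have K20 : 0 < K2.
  apply: mulr_gt0; first exact: duhamel_constant_gt0.
  apply: mulr_gt0 => //; apply: mulr_gt0 Gb1; apply: mulr_gt0 => //.
  exact: decay_constant_gt0.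
pose K := K1 + K2.
have K0 : 0 < K by rewrite addr_gt0.
have ab0 : 0 < alpha - beta by rewrite subr_gt0.
(* For [T <= 1] both powers are at most [T ^ (alpha - beta)], so the single bound
   [K * T ^ (alpha - beta) <= 1/2] gives both conditions. [f] enters only through [L], hence the
   threshold is common to all such [f]. *)
pose Tstar := Num.min 1 ((2 * K)^-1 `^ (alpha - beta)^-1).
have Ts0 : 0 < Tstar by rewrite lt_min ltr01 powR_gt0// invr_gt0 mulr_gt0.
exists Tstar => // f f_lip f0 T T0 TT.
have T1 : T <= 1 by rewrite ltW// (lt_le_trans TT)// ge_min lexx.
have TK : K * T `^ (alpha - beta) <= 2^-1.
  have K2i : 0 <= (2 * K)^-1 by rewrite invr_ge0 mulr_ge0// ltW.
  have : T `^ (alpha - beta) <= (2 * K)^-1.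
    rewrite -[leRHS]powRr1// -[X in _ <= _ `^ X](mulVf (lt0r_neq0 ab0)) powRrM.
    apply: ler_powRl; [exact: ltW|exact: ltW|].
    by rewrite ltW// (lt_le_trans TT)// ge_min lexx orbT.
  by rewrite invfM (mulrC 2^-1) ler_pdivlMl.
have Tp0 : 0 <= T `^ (alpha - beta) by exact: powR_ge0.
have small1 : L * (Gamma beta / Gamma (alpha + beta) * T `^ alpha) <= 2^-1.
  rewrite mulrA -/K1; apply: le_trans TK.
  apply: ler_pM; [exact: ltW|exact: powR_ge0|by rewrite lerDl ltW|].
  by apply: ger_powR; rewrite ?T0// lerBlDr lerDl ltW.
have small2 : duhamel_constant alpha mu lmin * T `^ (alpha - beta) *
    (2 * (L * decay_constant alpha * Gamma (1 - beta))) <= 2^-1.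
  rewrite mulrAC -/K2; apply: le_trans TK.
  by apply: ler_wpM2r => //; rewrite lerDr ltW.
have c0 : 0 < stability_constant alpha lmin T.
  apply: mulr_gt0 => //; apply: addr_gt0; first by rewrite invr_gt0.
  by apply: mulr_gt0 (powR_gt0 _ T0); apply: Gamma_gt0; rewrite subr_gt0.
exists (stability_constant alpha lmin T) => //.
move=> phi1 phi2 _ _ w1 w2 [u1 m1 ->] [u2 m2 ->].
(* A divergent sum has hnorm = sqrt (fine +oo) = 0. *)
have [D_fin|] := ltP (hnorm2 lam phi (- mu) (phi1 \- phi2)%R) +oo%E; last first.
  rewrite leye_eq => /eqP D_oo; rewrite {1}/hnorm D_oo/= sqrtr0.
  by rewrite mulr_ge0 ?hnorm_ge0// ltW.
have [U1 md1] := mild_solution_data mOm ob lmin0 lam_ge mu_le1 m1.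
have [U2 md2] := mild_solution_data mOm ob lmin0 lam_ge mu_le1 m2.
exact: (stability_estimate mOm ob lmin0 lam_ge alpha_gt0 alpha_lt1 mu_gt0 mu_le1 L_gt0
  f_lip f0 T0 md1 md2).
Qed.
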